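(* Let the balanced-weights assumption hold with constants $c_0>0$, $c_1\ge1$. Consider an instance generated by an IMLSBM in $\mathcal P_n(\rho,\{p_\ell\},\{q_\ell\},\beta)$ with $\rho\in[0,1/2)$, $L\le C_0n^c$ ($c\ge0$, $C_0>0$ constants) and $$\frac{\bar p}{\bar p-\bar q}\le c'\cdot\frac{2(1-2\rho)^2}{\beta-\beta^{-1}}+2(\rho-\rho^2)$$ for a constant $c'\in[0,1)$ (the condition is void if $\beta=1$), where $\bar p=\sum_\ell\omega_\ell p_\ell$, $\bar q=\sum_\ell\omega_\ell q_\ell$. Fix $r\ge1$, $\varepsilon>0$, and a trimming parameter $\gamma>e^{c_1}$. Then there are constants $c_2=c_2(c_1,\gamma)>1$ and $C=C(c,C_0,c',c_0,c_1,\gamma,r)$ such that with probability at least $1-11n^{-r}-c_2^{-n}$ the output $\tilde{\mathbf z}^\star$ of Algorithm 1 satisfies $$\mathcal L(\tilde{\mathbf z}^\star,\mathbf z^\star)\le\frac{C(2+\varepsilon)(\Delta_1+\Delta_2+\Delta_3)}{n^2(1-2\rho)^4(\bar p-\bar q)^2},$$ where $\Delta_1=[\bar p-2\rho(1-\rho)(\bar p-\bar q)]^2$, $\Delta_2=n\sum_\ell\omega_\ell^2p_\ell$, and $\Delta_3=\max_\ell\{\omega_\ell^2(p_\ell-q_\ell)^2\}(L^2\rho^2+n^2L\rho+n\log n)+\rho^2(1-\rho)^2(\bar p-\bar q)^2$.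
   Context: Inhomogeneous multilayer SBM (IMLSBM). Fix integers $n,L\ge1$, a global label vector $\mathbf z^\star\in\{\pm1\}^n$, $\rho\in[0,1/2]$, and $0<q_\ell<p_\ell<1$ for $\ell\in[L]$. Individual label vectors $\mathbf z^{(\ell)}_i=\mathbf z^\star_i\xi_{\ell i}$ with $\xi_{\ell i}$ i.i.d., $P(\xi_{\ell i}=1)=1-\rho$, $P(\xi_{\ell i}=-1)=\rho$. Given the labels, the symmetric adjacency matrices $A^{(\ell)}\in\{0,1\}^{n\times n}$ have zero diagonal and independent entries $A^{(\ell)}_{ij}=A^{(\ell)}_{ji}$ ($i<j$), Bern$(p_\ell)$ if $\mathbf z^{(\ell)}_i=\mathbf z^{(\ell)}_j$ and Bern$(q_\ell)$ otherwise. $\mathcal P_n(\rho,\{p_\ell\},\{q_\ell\},\beta)$ ($\beta\ge1$): such models with $n/(2\beta)\le\#\{i:\mathbf z^\star_i=\pm1\}\le n\beta/2$. Loss $\mathcal L(\hat{\mathbf z},\mathbf z)=n^{-1}\min\{d_H(\hat{\mathbf z},\mathbf z),d_H(-\hat{\mathbf z},\mathbf z)\}$. Probabilities are over label sampling and edges. Balanced-weights assumption: the weights satisfy $\omega_\ell>0$, $\sum_\ell\omega_\ell=1$, $\max_\ell\omega_\ell\cdot\sum_\ell\omega_\ell p_\ell\le c_0\sum_\ell\omega_\ell^2p_\ell$ and $\max_\ell\omega_\ell\cdot\sum_\ell p_\ell\le c_1\sum_\ell\omega_\ell q_\ell$. Algorithm 1 (inputs $\{A^{(\ell)}\}$, weights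 $\omega$, $\{p_\ell\}$, $\gamma>1$, $\varepsilon>0$): let $\bar A=\sum_\ell\omega_\ell A^{(\ell)}$; let $I=\{i\in[n]:\sum_j\bar A_{ij}>\gamma n\sum_\ell\omega_\ell p_\ell\}$; let $\tau(\bar A)$ be $\bar A$ with all entries in rows or columns indexed by $I$ set to $0$; let $U\in\mathbb R^{n\times2}$ have orthonormal columns that are eigenvectors of $\tau(\bar A)$ for its two leading eigenvalues (largest in absolute value); let $(\hat Z,\hat X)$ be any pair with $\hat Z\in\{0,1\}^{n\times 2}$ having each row a standard basis vector of $\mathbb R^2$ and $\hat X\in\mathbb R^{2\times2}$, such that $\|\hat Z\hat X-U\|_F^2\le(1+\varepsilon)\min_{Z,X}\|ZX-U\|_F^2$ (minimum over all such $Z$ and all $X\in\mathbb R^{2\times2}$); output $\tilde{\mathbf z}^\star_i=1$ if $\hat Z_{i1}=1$ and $\tilde{\mathbf z}^\star_i=-1$ otherwise. *)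

(* Defs.v *)
From HB Require Import structures.
From mathcomp Require Import all_boot all_order all_algebra.
From mathcomp Require Import boolp reals sequences exp.
Set Implicit Arguments. Unset Strict Implicit. Unset Printing Implicit Defensive.
Import Order.TTheory GRing.Theory Num.Theory.
Local Open Scope ring_scope.

(* Labels are booleans: true <-> +1, false <-> -1.
   Sample space of the IMLSBM: a flip indicator xi(l,i) (true <-> xi_{l i} = -1)
   and an edge indicator e(l,i,j); only entries with i < j are used (those with
   i >= j are forced to be false by the probability weight). *)
Notation Omega L n :=
  ({ffun 'I_L * 'I_n -> bool} * {ffun 'I_L * 'I_n * 'I_n -> bool})%type.

Definition layer_label L n (zs : 'I_n -> bool) (xi : {ffun 'I_L * 'I_n -> bool})
  (l : 'I_L) (i : 'I_n) : bool := xorb (zs i) (xi (l, i)).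

Definition imlsbm_weight (R : realType) L n (zs : 'I_n -> bool) (rho : R)
  (p q : 'I_L -> R) (w : Omega L n) : R :=
  (\prod_(li : 'I_L * 'I_n) (if w.1 li then rho else 1 - rho)) *
  (\prod_(lij : 'I_L * 'I_n * 'I_n)
     (if (lij.1.2 < lij.2)%N then
        let pi := if layer_label zs w.1 lij.1.1 lij.1.2
                     == layer_label zs w.1 lij.1.1 lij.2
                  then p lij.1.1 else q lij.1.1 in
        (if w.2 lij then pi else 1 - pi)
      else (if w.2 lij then 0 else 1))).

Definition imlsbm_prob (R : realType) L n (zs : 'I_n -> bool) (rho : R)
  (p q : 'I_L -> R) (E : Omega L n -> Prop) : R :=
  \sum_(w : Omega L n) (if `[< E w >] then imlsbm_weight zs rho p q w else 0).

Definition adj (R : realType) L n (w : Omega L n) (l : 'I_L) : 'M[R]_n :=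
  \matrix_(i, j) (if (i < j)%N then (w.2 (l, i, j))%:R
                  else if (j < i)%N then (w.2 (l, j, i))%:R else 0).

Definition balanced_labels (R : realType) n (beta : R) (zs : 'I_n -> bool) : Prop :=
  n%:R / (2 * beta) <= #|[set i | zs i]|%:R <= n%:R * beta / 2 /\
  n%:R / (2 * beta) <= #|[set i | ~~ zs i]|%:R <= n%:R * beta / 2.

Definition wavg (R : realType) L (om f : 'I_L -> R) : R := \sum_l om l * f l.
Definition maxL (R : realType) L (f : 'I_L -> R) : R := \big[Num.max/0]_l f l.

Definition balanced_weights (R : realType) L (om p q : 'I_L -> R) (c0 c1 : R) : Prop :=
  (forall l, 0 < om l) /\ \sum_l om l = 1 /\
  maxL om * wavg om p <= c0 * \sum_l om l ^+ 2 * p l /\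
  maxL om * \sum_l p l <= c1 * wavg om q.

Definition Abar (R : realType) L n (om : 'I_L -> R) (A : 'I_L -> 'M[R]_n) : 'M[R]_n :=
  \sum_l om l *: A l.

Definition trim_set (R : realType) n (gamma pbar : R) (M : 'M[R]_n) : {set 'I_n} :=
  [set i | gamma * n%:R * pbar < \sum_j M i j].

Definition trim (R : realType) n (I : {set 'I_n}) (M : 'M[R]_n) : 'M[R]_n :=
  \matrix_(i, j) (if (i \in I) || (j \in I) then 0 else M i j).

(* U has orthonormal columns which are eigenvectors of the symmetric T for its
   two leading eigenvalues (largest in absolute value, counted with multiplicity):
   every eigenvalue of an eigenvector orthogonal to both columns is at most
   |lam k| in absolute value. *)
Definition leading2_eigvecs (R : realType) n (T : 'M[R]_n) (U : 'M[R]_(n, 2)) : Prop :=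
  U^T *m U = 1%:M /\
  exists lam : 'I_2 -> R,
    (forall k, T *m col k U = lam k *: col k U) /\
    (forall (v : 'cV[R]_n) (mu : R), v != 0 -> U^T *m v = 0 -> T *m v = mu *: v ->
       forall k, `|mu| <= `|lam k|).

(* Z in {0,1}^{n x 2} with standard-basis rows, encoded by the cluster map g *)
Definition memb_mx (R : realType) n (g : 'I_n -> 'I_2) : 'M[R]_(n, 2) :=
  \matrix_(i, k) (g i == k)%:R.

Definition frob2 (R : realType) m k (M : 'M[R]_(m, k)) : R :=
  \sum_i \sum_j M i j ^+ 2.

Definition kmeans_approx (R : realType) n (eps : R) (U : 'M[R]_(n, 2))
  (g : 'I_n -> 'I_2) (X : 'M[R]_2) : Prop :=
  forall (g' : 'I_n -> 'I_2) (X' : 'M[R]_2),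
    frob2 (memb_mx R g *m X - U) <= (1 + eps) * frob2 (memb_mx R g' *m X' - U).

Definition alg1_output (R : realType) L n (A : 'I_L -> 'M[R]_n) (om p : 'I_L -> R)
  (gamma eps : R) (zt : 'I_n -> bool) : Prop :=
  let Ab := Abar om A in
  let T := trim (trim_set gamma (wavg om p) Ab) Ab in
  exists (U : 'M[R]_(n, 2)) (g : 'I_n -> 'I_2) (X : 'M[R]_2),
    leading2_eigvecs T U /\ kmeans_approx eps U g X /\
    (forall i, zt i = (g i == ord0)).

Definition hamming n (a b : 'I_n -> bool) : nat := #|[set i | a i != b i]|.

Definition loss (R : realType) n (a b : 'I_n -> bool) : R :=
  (minn (hamming a b) (hamming (fun i => ~~ a i) b))%:R / n%:R.

Definition error_bound (R : realType) L n (om p q : 'I_L -> R) (rho C eps : R) : R :=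
  let pb := wavg om p in let qb := wavg om q in
  let D1 := (pb - 2 * rho * (1 - rho) * (pb - qb)) ^+ 2 in
  let D2 := n%:R * \sum_l om l ^+ 2 * p l in
  let D3 := maxL (fun l => om l ^+ 2 * (p l - q l) ^+ 2) *
              (L%:R ^+ 2 * rho ^+ 2 + n%:R ^+ 2 * L%:R * rho + n%:R * ln n%:R)
            + rho ^+ 2 * (1 - rho) ^+ 2 * (pb - qb) ^+ 2 in
  C * (2 + eps) * (D1 + D2 + D3) /
    (n%:R ^+ 2 * (1 - 2 * rho) ^+ 4 * (pb - qb) ^+ 2).

(* Main.v *)
(** Average the aggregated matrix over edges and labels: off the diagonal the result is the
    rank-two matrix P with entries al + ka on pairs of equal global labels and al - ka on the
    others, ka = (1 - 2 rho)^2 (pbar - qbar) / 2.  The trimmed matrix T differs from P by three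
    terms, which give Delta_2, Delta_3 and Delta_1.

    (i) The edge noise given the labels.  After division by max om the weights lie in [0, 1] and
    the aggregated entries have Poisson-type exponential moments of intensity mu; with d = n mu
    one gets a bound of order sqrt d by the method of Friedman-Kahn-Szemeredi and Feige-Ofek:
    restrict to vectors of an integer grid, treat the pairs with small |x_i y_j| by a union bound
    over the grid, and the others by splitting into dyadic level sets and using that the number
    of edges between any two sets of vertices is controlled by their entropy.  Trimmed rows are
    so few (at most 4 / mu, up to probability 2^-n) that removing them from the mean costs
    another sqrt d.

    (ii) The label fluctuation, in Frobenius norm.  It is a linear plus a quadratic form in the
    centred flips; given the flips of one node, each row of the quadratic part is again a linear
    form in the independent flips of the other nodes, so one tail bound for sums of squares of
    such linear forms handles both.

    (iii) The diagonal, which is a multiple of the identity.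

    The imbalance condition forces beta <= 5, hence the smallest nonzero eigenvalue of P is of
    order n ka, and a sin-theta argument places the indicator vectors of the two classes near
    the span of the two leading eigenvectors.  Averaging the rows of U over the classes is
    then a competitor in the k-means problem with small cost and well separated centers. *)

Require Import Defs.
From HB Require Import structures.
From mathcomp Require Import all_boot all_order all_algebra.
From mathcomp Require Import boolp reals sequences exp.
From mathcomp Require Import ring lra.
Set Implicit Arguments. Unset Strict Implicit. Unset Printing Implicit Defensive.
Import Order.TTheory GRing.Theory Num.Theory.
Local Open Scope ring_scope.

(** * Product Bernoulli measures *)

Section Bernoulli.
Variables (R : realType) (I : finType).
Implicit Types (pi a : I -> R) (e : {ffun I -> bool}) (h : {ffun I -> bool} -> R).
Implicit Types (E F : {ffun I -> bool} -> Prop).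

Definition bern_weight pi e : R := \prod_i (if e i then pi i else 1 - pi i).

Definition bern_mean pi h : R := \sum_e bern_weight pi e * h e.

Definition bern_pr pi E : R := bern_mean pi (fun e => (`[< E e >])%:R).

Variable pi : I -> R.
Hypothesis pi01 : forall i, 0 <= pi i <= 1.

Lemma bern_weight_ge0 e : 0 <= bern_weight pi e.
Proof.
apply: prodr_ge0 => i _; have /andP[p0 p1] := pi01 i.
by case: ifP; rewrite ?subr_ge0.
Qed.

Lemma bern_mean_prod (F : I -> bool -> R) :
  bern_mean pi (fun e => \prod_i F i (e i)) =
  \prod_i (pi i * F i true + (1 - pi i) * F i false).
Proof.
transitivity (\prod_i \sum_b (if b then pi i else 1 - pi i) * F i b); last first.
  by apply: eq_bigr => i _; rewrite big_bool.
by rewrite bigA_distr_bigA; apply: eq_bigr => e _; rewrite big_split.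
Qed.

Lemma bern_mean_cst (x : R) : bern_mean pi (fun=> x) = x.
Proof.
rewrite /bern_mean -mulr_suml.
transitivity (bern_mean pi (fun e => \prod_(i : I) (1 : R)) * x).
  by congr (_ * _); apply: eq_bigr => e _; rewrite big1 ?mulr1.
rewrite (bern_mean_prod (fun _ _ => 1)) big1 ?mul1r // => i _.
by rewrite !mulr1 addrC subrK.
Qed.

Lemma bern_mean_le h1 h2 : (forall e, h1 e <= h2 e) -> bern_mean pi h1 <= bern_mean pi h2.
Proof.
by move=> le12; apply: ler_sum => e _; rewrite ler_wpM2l// bern_weight_ge0.
Qed.

Lemma bern_meanZ x h : bern_mean pi (fun e => x * h e) = x * bern_mean pi h.
Proof. by rewrite /bern_mean mulr_sumr; apply: eq_bigr => e _; rewrite mulrCA. Qed.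

Lemma bern_meanD h1 h2 :
  bern_mean pi (fun e => h1 e + h2 e) = bern_mean pi h1 + bern_mean pi h2.
Proof. by rewrite /bern_mean -big_split; apply: eq_bigr => e _; rewrite mulrDr. Qed.

Lemma bern_pr_le E h : (forall e, 0 <= h e) -> (forall e, E e -> 1 <= h e) ->
  bern_pr pi E <= bern_mean pi h.
Proof.
move=> h0 h1; apply: bern_mean_le => e.
by case: asboolP => [/h1//|_]; exact: h0.
Qed.

Lemma bern_pr_sub E F : (forall e, E e -> F e) -> bern_pr pi E <= bern_pr pi F.
Proof.
move=> EF; apply: bern_pr_le => e; first exact: ler0n.
by move=> /EF Fe; case: asboolP.
Qed.

Lemma bern_pr_union (K : finType) (P : pred K) (E : K -> {ffun I -> bool} -> Prop) :
  bern_pr pi (fun e => exists2 k, P k & E k e) <= \sum_(k | P k) bern_pr pi (E k).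
Proof.
rewrite /bern_pr /bern_mean exchange_big/=; apply: ler_sum => e _.
rewrite -mulr_sumr ler_wpM2l ?bern_weight_ge0//.
case: asboolP => [[k Pk Eke]|_]; last by apply: sumr_ge0 => k _; exact: ler0n.
rewrite (bigD1 k)//= asboolT// lerDl.
by apply: sumr_ge0 => j _; exact: ler0n.
Qed.

Lemma bern_pr_or E F :
  bern_pr pi (fun e => E e \/ F e) <= bern_pr pi E + bern_pr pi F.
Proof.
rewrite /bern_pr -bern_meanD; apply: bern_mean_le => e.
by do 3!case: asboolP => //=; rewrite ?(addr0, add0r, lerDl, ler01)//; tauto.
Qed.

(** Markov's inequality for [expR (h e)]. The Chernoff parameter is part of [h], so each application
    fixes its own scale. *)
Lemma bern_chernoff h (t : R) (E : {ffun I -> bool} -> Prop) :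
  (forall e, E e -> t <= h e) ->
  bern_pr pi E <= expR (- t) * bern_mean pi (fun e => expR (h e)).
Proof.
move=> Eh; rewrite -bern_meanZ; apply: bern_pr_le => e.
  by rewrite mulr_ge0// expR_ge0.
by move=> /Eh th; rewrite -expRD -expR0 ler_expR addrC subr_ge0.
Qed.

(** Each factor is [1 + pi i * (expR (a i) - 1)], and [1 + x <= expR x]: the moments are dominated
    by Poisson ones. *)
Lemma bern_mgf_le a :
  bern_mean pi (fun e => expR (\sum_i a i * (e i)%:R)) <=
  expR (\sum_i pi i * (expR (a i) - 1)).
Proof.
under [X in bern_mean pi X]funext => e do rewrite expR_sum.
rewrite (bern_mean_prod (fun i b => expR (a i * b%:R))) expR_sum.
apply: ler_prod => i _; have /andP[p0 p1] := pi01 i.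
rewrite mulr1 mulr0 expR0 mulr1; apply/andP; split.
  by rewrite addr_ge0 ?subr_ge0// mulr_ge0// expR_ge0.
by apply: le_trans (expR_ge1Dx _); lra.
Qed.

Lemma bern_mgf_centered_le a :
  bern_mean pi (fun e => expR (\sum_i a i * ((e i)%:R - pi i))) <=
  expR (\sum_i pi i * (expR (a i) - 1 - a i)).
Proof.
have -> : bern_mean pi (fun e => expR (\sum_i a i * ((e i)%:R - pi i))) =
  expR (- \sum_i a i * pi i) * bern_mean pi (fun e => expR (\sum_i a i * (e i)%:R)).
  rewrite -bern_meanZ; congr bern_mean; apply/funext => e.
  rewrite -expRD; congr expR; rewrite addrC -sumrB.
  by apply: eq_bigr => i _; rewrite mulrBr.
have -> : \sum_i pi i * (expR (a i) - 1 - a i) =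
  - \sum_i a i * pi i + \sum_i pi i * (expR (a i) - 1).
  by rewrite addrC -sumrB; apply: eq_bigr => i _; ring.
by rewrite expRD ler_wpM2l ?expR_ge0// bern_mgf_le.
Qed.

End Bernoulli.

(** * Resampling a block of coordinates, and independence of columns *)

Section Merge.
Variables (R : realType) (I : finType) (pi : I -> R).
Hypothesis pi01 : forall i, 0 <= pi i <= 1.

Definition merge (A : pred I) (f g : {ffun I -> bool}) : {ffun I -> bool} :=
  [ffun i => if A i then f i else g i].

(* Swapping the coordinates in A between two independent copies preserves their joint law. *)
Lemma bern_pr_merge (A : pred I) (E : {ffun I -> bool} -> Prop) (x : R) :
  (forall f, bern_pr pi (fun g => E (merge A f g)) <= x) -> bern_pr pi E <= x.
Proof.
move=> H.
have -> : bern_pr pi E = bern_mean pi (fun f => bern_pr pi (fun g => E (merge A f g))).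
  rewrite /bern_pr -[LHS](bern_mean_cst pi) {1 2}/bern_mean.
  rewrite [RHS]/bern_mean.
  under eq_bigr do rewrite /bern_mean mulr_sumr.
  under [RHS]eq_bigr do rewrite /bern_mean mulr_sumr.
  rewrite !pair_big/=.
  pose sw (fg : {ffun I -> bool} * {ffun I -> bool}) :=
    (merge A fg.2 fg.1, merge A fg.1 fg.2).
  have swK : involutive sw.
    move=> [f g]; congr pair; apply/ffunP => i; rewrite !ffunE/=;
    by rewrite ?ffunE; case: (A i).
  rewrite (reindex_inj (inv_inj swK)) /=; apply: eq_bigr => -[f g] _ /=.
  rewrite !mulrA; congr (_ * _); rewrite /bern_weight -!big_split/=.
  apply: eq_bigr => i _; rewrite !ffunE; case: (A i) => //.
  by rewrite mulrC.
rewrite -[leRHS](bern_mean_cst pi); exact: bern_mean_le.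
Qed.

End Merge.

Section Columns.
Variables (R : realType) (A B : finType).

(** Currying turns a configuration on [A * B] into a [B]-indexed family of columns, over which the
    product of sums distributes. *)
Lemma sum_columns (K : B -> {ffun A -> bool} -> R) :
  \sum_(f : {ffun A * B -> bool}) \prod_b K b [ffun a => f (a, b)] =
  \prod_b \sum_h K b h.
Proof.
rewrite bigA_distr_bigA/=.
pose cur (F : {ffun B -> {ffun A -> bool}}) : {ffun A * B -> bool} :=
  [ffun ab => F ab.2 ab.1].
pose unc (f : {ffun A * B -> bool}) : {ffun B -> {ffun A -> bool}} :=
  [ffun b => [ffun a => f (a, b)]].
rewrite (reindex cur) /=; last first.
  exists unc => f _; first by apply/ffunP => b; apply/ffunP => a; rewrite !ffunE.
  by apply/ffunP => -[a b]; rewrite !ffunE.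
apply: eq_bigr => F _; apply: eq_bigr => b _; congr (K _ _).
by apply/ffunP => a; rewrite !ffunE.
Qed.

Lemma bern_mean_columns (rho : R) (K : B -> {ffun A -> bool} -> R) :
  bern_mean (fun=> rho) (fun f : {ffun A * B -> bool} => \prod_b K b [ffun a => f (a, b)]) =
  \prod_b bern_mean (fun=> rho) (K b).
Proof.
rewrite /bern_mean -sum_columns; apply: eq_bigr => f _.
rewrite /bern_weight big_split/=; congr (_ * _).
rewrite (eq_bigr (fun ab => (fun a b => if f (a, b) then rho else 1 - rho) ab.1 ab.2)); last by case.
rewrite -(pair_bigA _ (fun a b => if f (a, b) then rho else 1 - rho))/= exchange_big/=.
by apply: eq_bigr => b _; apply: eq_bigr => a _; rewrite ffunE.
Qed.

End Columns.

(** * Exponential moments of the aggregated adjacency matrix *)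

Section ExpBounds.
Variable R : realType.
Implicit Types x a t : R.

(** Up to 1/2, multiply by [1 - y]: the left side becomes at most 1, the right side
    [1 + y ^+ 2 * (1 - 2 * y)]. Between 1/2 and 1, square the bound at [x / 2]. *)
Lemma expR_le_quadratic x : x <= 1 -> expR x <= 1 + x + 2 * x ^+ 2.
Proof.
have half y : y <= 1 / 2 -> expR y <= 1 + y + 2 * y ^+ 2.
  move=> y2; have yp : 0 < 1 - y by lra.
  have := expR_ge1Dx (- y); rewrite expRN => H.
  have Ep := expR_gt0 y.
  have H1 : (1 - y) * expR y <= 1.
    by rewrite -(ler_pM2r Ep) mulVf ?gt_eqF// in H.
  rewrite -(ler_pM2l yp); apply: le_trans H1 _.
  have -> : (1 - y) * (1 + y + 2 * y ^+ 2) = 1 + y ^+ 2 * (1 - 2 * y) by ring.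
  by rewrite lerDl mulr_ge0 ?sqr_ge0//; lra.
move=> x1; have [x2|x2] := leP x (1 / 2); first exact: half.
have -> : expR x = expR (x / 2) ^+ 2 by rewrite expr2 -expRD; congr expR; lra.
have e0 := expR_ge0 (x / 2).
have h : expR (x / 2) <= 1 + x / 2 + 2 * (x / 2) ^+ 2 by apply: half; lra.
apply: (@le_trans _ _ ((1 + x / 2 + 2 * (x / 2) ^+ 2) ^+ 2)).
  by rewrite lerXn2r ?nnegrE//; apply: le_trans h.
have -> : (1 + x / 2 + 2 * (x / 2) ^+ 2) ^+ 2 =
  1 + x + x ^+ 2 * (5 / 4 + x / 2 + x ^+ 2 / 4) by field.
rewrite lerD2l mulrC ler_wpM2r ?sqr_ge0//.
have : x ^+ 2 <= 1 by rewrite expr_le1//; lra.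
lra.
Qed.

(** Convexity: the tangent at [a], evaluated at 0 and at [t], lies below the graph; combine with
    weights [1 - a / t] and [a / t]. *)
Lemma expR_chord a t : 0 <= a -> a <= t -> 0 < t ->
  expR a - 1 <= a / t * (expR t - 1).
Proof.
move=> a0 at' t0; set s := a / t.
have s0 : 0 <= s by rewrite divr_ge0// ltW.
have s1 : s <= 1 by rewrite ler_pdivrMr// mul1r.
have st : s * t = a by rewrite divfK// gt_eqF.
have Ep := expR_gt0 a.
have h0 : expR a * (1 - a) <= 1.
  have := expR_ge1Dx (- a); rewrite expRN => H.
  by rewrite -(ler_pM2l Ep) mulfV ?gt_eqF// in H.
have h1 : expR a * (1 + (t - a)) <= expR t.
  by rewrite -[in leRHS](subrKC a t) expRD ler_pM2l// expR_ge1Dx.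
suff : expR a * (1 - a + s * t) <= (1 - s) * 1 + s * expR t.
  by rewrite st subrK mulr1; lra.
have -> : expR a * (1 - a + s * t) =
  (1 - s) * (expR a * (1 - a)) + s * (expR a * (1 + (t - a))) by ring.
by rewrite lerD// ler_wpM2l// subr_ge0.
Qed.

Lemma expR1_ge2 : 2 <= expR (1 : R).
Proof. by have := expR_ge1Dx (1 : R). Qed.

(** Bounds second moments by exponential ones. The bracket is the square of
    [expR (x / 2) - expR (- (x / 2))], which is at least [x / 2] for nonnegative [x]. *)
Lemma sqr_le_cosh x : x ^+ 2 <= 4 * (expR x + expR (- x) - 2).
Proof.
wlog x0 : x / 0 <= x.
  move=> H; have [|/ltW] := leP 0 x; first exact: H.
  by rewrite -oppr_ge0 => /H; rewrite opprK sqrrN (addrC (expR (- x))).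
have -> : expR x + expR (- x) - 2 = (expR (x / 2) - expR (- (x / 2))) ^+ 2.
  rewrite sqrrB -expRD subrr expR0 !expr2 -!expRD.
  have -> : - (x / 2) + - (x / 2) = - x by field.
  have -> : x / 2 + x / 2 = x by field.
  by rewrite mulr2n; ring.
have h : x / 2 <= expR (x / 2) - expR (- (x / 2)).
  have h1 := expR_ge1Dx (x / 2).
  have h2 : expR (- (x / 2)) <= 1 by rewrite expR_le1; lra.
  lra.
have h2 : (x / 2) ^+ 2 <= (expR (x / 2) - expR (- (x / 2))) ^+ 2.
  rewrite lerXn2r ?nnegrE//; first lra.
  by apply: le_trans h; lra.
have -> : x ^+ 2 = 4 * (x / 2) ^+ 2 by field.
by rewrite ler_wpM2l.
Qed.

End ExpBounds.

Section Indicator.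
Variables (R : realType) (n : nat).

Lemma sum_indicator (S T : {set 'I_n}) (F : 'I_n -> 'I_n -> R) (x : R) :
  \sum_i \sum_j (if (i \in S) && (j \in T) then x else 0) * F i j =
  x * \sum_(i in S) \sum_(j in T) F i j.
Proof.
rewrite [in RHS]big_mkcond mulr_sumr; apply: eq_bigr => i _.
case: (i \in S) => /=; last by rewrite mulr0 big1// => j _; rewrite mul0r.
rewrite [in RHS]big_mkcond mulr_sumr; apply: eq_bigr => j _.
by case: ifP; rewrite ?mul0r ?mulr0.
Qed.

End Indicator.

Section LayerSum.
Variables (R : realType) (L n : nat) (w : 'I_L -> R).
Implicit Types (v : 'I_L * 'I_n * 'I_n -> R) (c : 'I_n -> 'I_n -> R).

(** For edge indicators [v] this is the aggregated adjacency matrix; for edge probabilities it is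
    its conditional mean. *)
Definition layer_sum v (i j : 'I_n) : R :=
  \sum_l w l * (if (i < j)%N then v (l, i, j) else if (j < i)%N then v (l, j, i) else 0).

Definition edge_coef c (x : 'I_L * 'I_n * 'I_n) : R :=
  if (x.1.2 < x.2)%N then w x.1.1 * (c x.1.2 x.2 + c x.2 x.1.2) else 0.

(** Turns a form in the entries of a symmetric matrix into a linear form in the independent edge
    variables; each edge collects the coefficients of both its ordered pairs. *)
Lemma sum_layer_sum c v :
  \sum_i \sum_j c i j * layer_sum v i j = \sum_x edge_coef c x * v x.
Proof.
pose F (a b : 'I_n) l (i j : 'I_n) := if (i < j)%N then w l * c a b * v (l, i, j) else 0.
transitivity (\sum_i \sum_j \sum_l F i j l i j + \sum_i \sum_j \sum_l F i j l j i).
  rewrite -big_split; apply: eq_bigr => i _; rewrite -big_split; apply: eq_bigr => j _.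
  rewrite mulr_sumr -big_split; apply: eq_bigr => l _ /=; rewrite /F.
  by case: (ltngtP i j) => _; rewrite ?mulr0 ?addr0 ?add0r// mulrCA mulrA.
rewrite [X in _ + X]exchange_big/= -big_split/=.
transitivity (\sum_i \sum_j \sum_l edge_coef c (l, i, j) * v (l, i, j)).
  apply: eq_bigr => i _; rewrite -big_split; apply: eq_bigr => j _ /=.
  rewrite -big_split; apply: eq_bigr => l _ /=; rewrite /F /edge_coef /=.
  by case: ifP => _; rewrite ?addr0 ?mul0r// mulrDr mulrDl.
set G := fun x => edge_coef c x * v x.
rewrite -[RHS]/(\sum_x G x).
transitivity (\sum_l \sum_i \sum_j G (l, i, j)).
  by rewrite [RHS]exchange_big/=; apply: eq_bigr => i _; rewrite [RHS]exchange_big.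
rewrite (eq_bigr (fun x => (fun li j => G (li, j)) x.1 x.2)); last by case.
rewrite -(pair_bigA _ (fun li j => G (li, j)))/=.
rewrite (eq_bigr (fun li => (fun l i => \sum_j G (l, i, j)) li.1 li.2)); last by case.
by rewrite -(pair_bigA _ (fun l i => \sum_j G (l, i, j))).
Qed.

Lemma layer_sumC v i j : layer_sum v i j = layer_sum v j i.
Proof. by apply: eq_bigr => l _; case: (ltngtP i j). Qed.

Variable p : 'I_L -> R.
Hypothesis w01 : forall l, 0 <= w l <= 1.
Hypothesis p0 : forall l, 0 <= p l.

Local Notation mu := (\sum_l w l * p l).

Lemma layer_sum_ge0 v i j : (forall x, 0 <= v x) -> 0 <= layer_sum v i j.
Proof.
move=> v0; apply: sumr_ge0 => l _; have /andP[wl _] := w01 l.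
by rewrite mulr_ge0//; case: ifP => // _; case: ifP.
Qed.

Lemma layer_sum_le v i j : (forall x, v x <= p x.1.1) -> layer_sum v i j <= mu.
Proof.
move=> vp; apply: ler_sum => l _; have /andP[wl _] := w01 l.
by rewrite ler_wpM2l//; case: ifP => _; [exact: vp|case: ifP => _; [exact: vp|]].
Qed.

Variable pi : 'I_L * 'I_n * 'I_n -> R.
Hypothesis pi01 : forall x, 0 <= pi x <= 1.
Hypothesis pip : forall x, pi x <= p x.1.1.

Let edge_coef_mean c : (forall i j, 0 <= c i j) ->
  \sum_x edge_coef c x * pi x <= mu * \sum_i \sum_j c i j.
Proof.
move=> c0; rewrite -sum_layer_sum mulr_sumr; apply: ler_sum => i _.
rewrite mulr_sumr; apply: ler_sum => j _; rewrite mulrC ler_wpM2r//.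
exact: layer_sum_le.
Qed.

(** With [c] at most [t / 2] every edge coefficient is at most [t], and the chord inequality makes
    the exponent linear in [c], so only the total of [c] enters. *)
Lemma edge_mgf c (t : R) : 0 < t -> (forall i j, 0 <= c i j <= t / 2) ->
  bern_mean pi (fun e => expR (\sum_i \sum_j c i j * layer_sum (fun x => (e x)%:R) i j)) <=
  expR (mu * (\sum_i \sum_j c i j) * ((expR t - 1) / t)).
Proof.
move=> t0 ct.
have c0 i j : 0 <= c i j by case/andP: (ct i j).
have et : 0 <= (expR t - 1) / t.
  by rewrite divr_ge0 ?ltW// subr_gt0 -expR0 ltr_expR.
under [X in bern_mean pi X]funext => e do rewrite sum_layer_sum.
apply: le_trans (bern_mgf_le pi01 _) _; rewrite ler_expR.
apply: le_trans (ler_wpM2r et (edge_coef_mean c0)).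
rewrite mulr_suml; apply: ler_sum => -[[l i] j] _.
have /andP[pi0 _] := pi01 (l, i, j).
rewrite (mulrC (edge_coef c _)) -mulrA ler_wpM2l//.
rewrite mulrA -[leRHS]mulrAC; apply: expR_chord => //; rewrite /edge_coef/=;
  have /andP[wl w1] := w01 l; case: ifP => // _; last exact: ltW.
  by rewrite mulr_ge0// addr_ge0.
have /andP[_ h1] := ct i j; have /andP[_ h2] := ct j i.
apply: (@le_trans _ _ (1 * (c i j + c j i))); last by lra.
by rewrite ler_wpM2r// addr_ge0.
Qed.

(** Edge coefficients are at most 1, so the quadratic bound applies. The 4 is its factor 2 times the
    2 of [(a + b)^2 <= 2 a^2 + 2 b^2]; [w l ^+ 2 <= w l] keeps the intensity linear in the
    weights. *)
Lemma edge_mgf_centered c : (forall i j, `|c i j| <= 1 / 2) ->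
  bern_mean pi (fun e => expR (\sum_i \sum_j
     c i j * (layer_sum (fun x => (e x)%:R) i j - layer_sum pi i j))) <=
  expR (4 * mu * \sum_i \sum_j c i j ^+ 2).
Proof.
move=> c1.
have E e : \sum_i \sum_j c i j * (layer_sum (fun x => (e x)%:R) i j - layer_sum pi i j) =
    \sum_x edge_coef c x * ((e x)%:R - pi x).
  under eq_bigr do (under eq_bigr do rewrite mulrBr; rewrite sumrB).
  by rewrite sumrB !sum_layer_sum -sumrB; apply: eq_bigr => x _; rewrite mulrBr.
under [X in bern_mean pi X]funext => e do rewrite E.
apply: le_trans (bern_mgf_centered_le pi01 _) _; rewrite ler_expR.
have c20 i j : 0 <= c i j ^+ 2 by exact: sqr_ge0.
rewrite -mulrA; apply: le_trans (ler_wpM2l _ (edge_coef_mean c20)) => //.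
rewrite mulr_sumr; apply: ler_sum => -[[l i] j] _.
have /andP[pi0 _] := pi01 (l, i, j).
rewrite (mulrC (edge_coef _ _)) mulrCA ler_wpM2l//.
rewrite /edge_coef/=; have /andP[wl w1] := w01 l; case: ifP => _; last first.
  by rewrite expR0 !subr0 subrr mulr0.
have s1 : `|c i j + c j i| <= 1.
  by apply: le_trans (ler_normD _ _) _; have := c1 i j; have := c1 j i; lra.
have a1 : w l * (c i j + c j i) <= 1.
  apply: le_trans (ler_norm _) _; rewrite normrM (ger0_norm wl).
  by rewrite -[leRHS]mulr1 ler_pM.
have := expR_le_quadratic a1; set a := w l * _ => h.
apply: (@le_trans _ _ (2 * a ^+ 2)); first by lra.
rewrite /a exprMn.
have s2 : (c i j + c j i) ^+ 2 <= 2 * (c i j ^+ 2 + c j i ^+ 2).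
  by have := sqr_ge0 (c i j - c j i); rewrite sqrrB sqrrD; lra.
have w2 : w l ^+ 2 <= w l by rewrite expr2 -[leRHS]mulr1 ler_wpM2l.
have := ler_pM (sqr_ge0 _) (sqr_ge0 _) w2 s2; lra.
Qed.

End LayerSum.

(** * Entropy of grids and of families of subsets *)

Section ExistsParam.
Variables (R : realType) (I : finType) (pi : I -> R).
Hypothesis pi01 : forall i, 0 <= pi i <= 1.

(* The union over t costs nothing: for t > 0 the event g t < t * h e is upward closed in h e,
   so the union is one of its members, the one attained at the smallest value of h. *)
Lemma bern_pr_exists_param (g : R -> R) (h : {ffun I -> bool} -> R) (x : R) :
  0 <= x -> (forall t, 0 < t -> bern_pr pi (fun e => g t < t * h e) <= x) ->
  bern_pr pi (fun e => exists2 t, 0 < t & g t < t * h e) <= x.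
Proof.
move=> x0 Hx; pose P e := `[< exists2 t, 0 < t & g t < t * h e >].
have [[e0 Pe0]|/forallNP nP] := pselect (exists e, P e).
  have [e1 /asboolP[t t0 te1] mine1] := arg_minP h Pe0.
  apply: le_trans (Hx t t0); apply: bern_pr_sub => // e /asboolP/mine1 he.
  by apply: lt_le_trans te1 _; rewrite ler_pM2l.
rewrite -(bern_mean_cst pi x); apply: bern_mean_le => // e.
by have /negP/negbTE := nP e; rewrite /P => ->.
Qed.

End ExistsParam.

Section Grid.
Variables (R : realType) (n : nat).

(* Integer vectors coded by sign and absolute value; 0 has two codes, which is harmless in union
   bounds. *)
Definition grid := {ffun 'I_n -> bool * 'I_(4 * n).+1}.

Definition grid_val (k : grid) (i : 'I_n) : R :=
  if (k i).1 then - ((k i).2%:R) else (k i).2%:R.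

(** The ball of radius 2 sqrt n. Since [k <= k ^ 2] for naturals, it only contains coordinates of
    absolute value at most [4 * n], the range allowed in [grid]. *)
Definition grid_ball (k : grid) : bool := (\sum_i (k i).2 ^ 2 <= 4 * n)%N.

Lemma grid_val_sqr k i : grid_val k i ^+ 2 = ((k i).2 ^ 2)%:R.
Proof. by rewrite /grid_val natrX; case: ifP; rewrite ?sqrrN. Qed.

Lemma grid_ball_sum k : grid_ball k -> \sum_i grid_val k i ^+ 2 <= 4 * n%:R.
Proof.
move=> kb; under eq_bigr do rewrite grid_val_sqr.
by rewrite -natr_sum -natrM ler_nat.
Qed.

Lemma sum_geometric_half m : \sum_(j < m) (1 / 2 : R) ^+ j <= 2.
Proof.
suff : \sum_(j < m) (1 / 2 : R) ^+ j = 2 - 2 * (1 / 2) ^+ m.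
  by move=> ->; rewrite lerBlDr lerDl mulr_ge0// exprn_ge0// divr_ge0.
elim: m => [|m IH]; first by rewrite big_ord0 expr0 mulr1 subrr.
by rewrite big_ord_recr/= IH exprS; field.
Qed.

(** In the ball the absolute values sum to at most [4 * n], so 2 to minus that sum is at least
    [16 ^- n]. This weight factors over coordinates, with total at most 4 for each: two signs times
    a geometric series. *)
Lemma card_grid_ball : \sum_(k | grid_ball k) (1 : R) <= 64 ^+ n.
Proof.
apply: (@le_trans _ _ (16 ^+ n * \prod_(i < n) \sum_(x : bool * 'I_(4 * n).+1) (1 / 2 : R) ^+ x.2)).
  rewrite bigA_distr_bigA mulr_sumr big_mkcond/=; apply: ler_sum => k _; case: ifP => kb; last first.
    by rewrite mulr_ge0 ?exprn_ge0// prodr_ge0// => i _; rewrite exprn_ge0// divr_ge0.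
  rewrite prodrXr.
  have le4n : (\sum_i (k i).2 <= 4 * n)%N.
    apply: leq_trans kb; apply: leq_sum => i _; case: (nat_of_ord _) => // j.
    by rewrite expnS leq_pmulr.
  have -> : (16 : R) ^+ n = 2 ^+ (4 * n) by rewrite exprM; congr (_ ^+ _); ring.
  rewrite div1r exprVn -[leLHS](@mulfV _ (2 ^+ (4 * n))) ?expf_neq0 ?pnatr_eq0//.
  by rewrite ler_pM2l ?exprn_gt0// lef_pV2 ?posrE ?exprn_gt0// ler_eXn2l// ltr1n.
have -> : (64 : R) ^+ n = 16 ^+ n * 4 ^+ n by rewrite -exprMn; congr (_ ^+ _); ring.
rewrite ler_wpM2l ?exprn_ge0// prodr_const card_ord lerXn2r ?nnegrE//.
  by apply: sumr_ge0 => i _; rewrite exprn_ge0// divr_ge0.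
have -> : \sum_(x : bool * 'I_(4 * n).+1) (1 / 2 : R) ^+ x.2 =
    \sum_(b : bool) \sum_(j < (4 * n).+1) (1 / 2) ^+ j by rewrite pair_bigA.
by rewrite big_bool/=; have := sum_geometric_half (4 * n).+1; lra.
Qed.

End Grid.

Section Entropy.
Variables (R : realType) (n : nat).
Hypothesis n0 : (0 < n)%N.

(* Up to constants, the logarithm of the number of subsets of size a of a set of size n. *)
Definition subset_entropy (a : nat) : R := a%:R * (1 + ln (n%:R / a%:R)).

(** The difference is [(a - ln a) + (a - 1) * (ln n - ln a)], with both summands nonnegative. This
    converts entropy into powers of [n]. *)
Lemma subset_entropy_ge (a : nat) : (0 < a <= n)%N -> ln n%:R <= subset_entropy a.
Proof.
move=> /andP[a0 an]; rewrite /subset_entropy.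
have a0' : (0 : R) < a%:R by rewrite ltr0n.
have n0' : (0 : R) < n%:R by rewrite ltr0n.
rewrite ln_div ?posrE//.
have la : ln (a%:R : R) <= ln n%:R by rewrite ler_ln ?posrE// ler_nat.
have la0 : 0 <= ln (a%:R : R) by rewrite ln_ge0// ler1n.
have a1 : ln (a%:R : R) <= a%:R - 1.
  by have := expR_ge1Dx (ln (a%:R : R)); rewrite lnK ?posrE//; lra.
have a1' : (1 : R) <= a%:R by rewrite ler1n.
have := mulr_ge0 (x := (a%:R - 1 : R)) (y := ln n%:R - ln a%:R); lra.
Qed.

(** Keep the single term ['C(n, a) * t ^+ a] of [(1 + t) ^+ n <= expR (n * t)] at [t = a / n]. *)
Lemma bin_le_entropy (a : nat) : (0 < a)%N -> 'C(n, a)%:R <= expR (subset_entropy a).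
Proof.
move=> a0.
have a0' : (0 : R) < a%:R by rewrite ltr0n.
have n0' : (0 : R) < n%:R by rewrite ltr0n.
have [na|an] := ltnP n a; first by rewrite bin_small// expR_ge0.
set t := (a%:R : R) / n%:R; have t0 : 0 < t by rewrite divr_gt0.
have -> : expR (subset_entropy a) = expR a%:R * (t ^+ a)^-1.
  rewrite /subset_entropy mulrDr mulr1 expRD; congr (_ * _).
  by rewrite mulrC expRM_natr lnK ?posrE ?divr_gt0// -exprVn invf_div.
rewrite ler_pdivlMr ?exprn_gt0//.
have -> : expR (a%:R : R) = expR t ^+ n.
  by rewrite -expRM_natr /t divfK// gt_eqF.
apply: (@le_trans _ _ ((1 + t) ^+ n)); last first.
  by rewrite lerXn2r ?nnegrE ?expR_ge1Dx ?expR_ge0// addr_ge0// ltW.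
rewrite exprDn (bigD1 (Ordinal (an : (a < n.+1)%N)))//= expr1n mul1r mulr_natl lerDl.
by apply: sumr_ge0 => i _; rewrite expr1n mul1r mulrn_wge0// exprn_ge0// ltW.
Qed.

Lemma powR_expR (x a : R) : 0 < x -> x `^ a = expR (a * ln x).
Proof. by move=> x0; rewrite /powR gt_eqF. Qed.

(** Grouped by size, one factor [expR (subset_entropy a)] pays for the number of subsets; what
    remains is at most [n ^ (- r - 1)] for each of the [n] sizes. *)
Lemma sum_entropy (r : R) : 1 <= r ->
  \sum_(S : {set 'I_n} | S != set0) expR (- ((r + 2) * subset_entropy #|S|)) <= n%:R `^ (- r).
Proof.
move=> r1; have n0' : (0 : R) < n%:R by rewrite ltr0n.
rewrite (partition_big (fun S : {set 'I_n} => inord #|S| : 'I_n.+1) (fun a => a != ord0))/=; last first.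
  move=> S; rewrite -card_gt0 -val_eqE/= inordK ?lt0n//.
  by rewrite ltnS -[leqRHS]card_ord max_card.
have -> : n%:R `^ (- r) = \sum_(a : 'I_n.+1 | a != ord0) n%:R `^ (- r - 1) :> R.
  rewrite sumr_const (@eq_card _ _ (predC1 ord0))// cardC1 card_ord/=.
  rewrite -[RHS]mulr_natr !powR_expR// -{3}[n%:R](@lnK R) ?posrE// -expRD.
  by congr expR; ring.
apply: ler_sum => a a0.
have an : (0 < a <= n)%N by rewrite lt0n a0 -ltnS ltn_ord.
apply: (@le_trans _ _ (\sum_(S : {set 'I_n} | #|S| == a) expR (- ((r + 2) * subset_entropy a)))).
  rewrite [leLHS]big_mkcond [leRHS]big_mkcond/=; apply: ler_sum => S _.
  have -> : (inord #|S| == a) = (#|S| == a).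
    by rewrite -val_eqE/= inordK// ltnS -[leqRHS]card_ord max_card.
  by case: (#|S| =P a :> nat) => [->|_]; rewrite ?andbT ?andbF//; case: ifP => // _; exact: expR_ge0.
rewrite sumr_const -[#|_|]/(#|[pred S : {set 'I_n} | #|S| == a]|) -cardsE card_draws card_ord.
rewrite -[leLHS]mulr_natl.
apply: (@le_trans _ _ (expR (subset_entropy a) * expR (- ((r + 2) * subset_entropy a)))).
  by rewrite ler_wpM2r ?expR_ge0// bin_le_entropy//; case/andP: an.
rewrite -expRD powR_expR// ler_expR.
have := subset_entropy_ge an; have : 0 <= r + 1 by lra.
by move=> h1 h2; have := ler_wpM2l h1 h2; lra.
Qed.

End Entropy.

(** * Trimmed rows, light pairs and edge discrepancy *)

Section NoiseEvents.
Variables (R : realType) (L n : nat) (w p : 'I_L -> R) (pi : 'I_L * 'I_n * 'I_n -> R).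
Hypothesis n0 : (0 < n)%N.
Hypothesis w01 : forall l, 0 <= w l <= 1.
Hypothesis p0 : forall l, 0 <= p l.
Hypothesis pi01 : forall x, 0 <= pi x <= 1.
Hypothesis pip : forall x, pi x <= p x.1.1.

Let mu := \sum_l w l * p l.
Hypothesis mu0 : 0 < mu.
Let d := n%:R * mu.

Local Notation adj_of e := (layer_sum w (fun x => (e x)%:R)).

Let n0R : (0 : R) < n%:R. Proof. by rewrite ltr0n. Qed.
Let d0 : 0 < d. Proof. exact: mulr_gt0. Qed.

(** Halving [t] allows for edges counted twice when [S] and [T] overlap. *)
Lemma edge_mgf_sets (S T : {set 'I_n}) (t : R) : 0 < t ->
  bern_mean pi (fun e => expR (t / 2 * \sum_(i in S) \sum_(j in T) adj_of e i j)) <=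
  expR (mu * #|S|%:R * #|T|%:R * (expR t - 1) / 2).
Proof.
move=> t0.
under [X in bern_mean pi X]funext => e do rewrite -sum_indicator.
apply: le_trans (edge_mgf w01 p0 pi01 pip t0 _) _.
  by move=> i j; case: ifP => _; rewrite ?lexx ?andbT; lra.
have -> : \sum_i \sum_j (if (i \in S) && (j \in T) then t / 2 else 0) =
    t / 2 * (#|S|%:R * #|T|%:R).
  have := sum_indicator S T (fun _ _ => 1) (t / 2).
  under eq_bigr do under eq_bigr do rewrite mulr1.
  move=> ->; congr (_ * _).
  by rewrite !sumr_const -mulrnA mulrC -natrM mulnC.
rewrite ler_expR -/mu le_eqVlt; apply/orP; left; apply/eqP; field.
by rewrite gt_eqF.
Qed.

(* Since gamma > e, Chernoff's bound with exponent 1 gives exp (- 2 n) for a fixed set of size at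
   least 4 / mu, which beats the number 2 ^ n of sets. *)
Lemma trim_card_pr (gamma : R) : expR 1 < gamma ->
  bern_pr pi (fun e =>
    4 / mu <= #|[set i | gamma * n%:R * mu < \sum_j adj_of e i j]|%:R) <= (2 : R) ^- n.
Proof.
move=> gam.
pose bad (S : {set 'I_n}) (e : {ffun 'I_L * 'I_n * 'I_n -> bool}) := gamma * n%:R * mu * #|S|%:R <= \sum_(i in S) \sum_(j in setT) adj_of e i j.
apply: (@le_trans _ _ (bern_pr pi (fun e => exists2 S : {set 'I_n}, 4 / mu <= #|S|%:R & bad S e))).
  apply: bern_pr_sub => // e; set S := [set i | _] => hS; exists S => //.
  rewrite /bad -mulr_natr mulrC mulr_natl mulr_natr -sumr_const; apply: ler_sum => i.
  by rewrite inE => /ltW; under [in X in _ -> X]eq_bigl do rewrite inE.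
apply: le_trans (bern_pr_union pi01 _ _) _ => /=.
apply: (@le_trans _ _ (\sum_(S : {set 'I_n}) expR (- (2 * n%:R)))).
  rewrite big_mkcond/=; apply: ler_sum => S _; case: ifP => [Sbig|_]; last exact: expR_ge0.
  apply: le_trans (bern_chernoff (t := gamma * n%:R * mu * #|S|%:R / 2) pi01
    (h := fun e => 1 / 2 * \sum_(i in S) \sum_(j in setT) adj_of e i j) _) _.
    by move=> e; rewrite /bad; lra.
  apply: le_trans (ler_wpM2l (expR_ge0 _) (edge_mgf_sets S setT ltr01)) _.
  rewrite -expRD ler_expR cardsT card_ord.
  have hS : 4 <= mu * #|S|%:R by rewrite ler_pdivrMr// mulrC in Sbig.
  have h1 : 0 <= n%:R * (mu * #|S|%:R) * (gamma - expR 1).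
    by rewrite mulr_ge0 ?subr_ge0 ?(ltW gam)// mulr_ge0// ?ltW// (lt_le_trans _ hS).
  have h2 := ler_wpM2l (ltW n0R) hS.
  have := @ler_wpM2l R.
  lra.
rewrite sumr_const -cardsT -powersetT card_powerset cardsT card_ord -[leLHS]mulr_natr natrX.
have -> : - (2 * n%:R) = (- 2) * (n%:R : R) by ring.
rewrite expRM_natr -exprMn -exprVn lerXn2r ?nnegrE ?mulr_ge0 ?expR_ge0 ?invr_ge0//.
have h4 : 4 <= expR (2 : R).
  have -> : 2 = 1 + 1 :> R by ring.
  by rewrite expRD; have := expR1_ge2 R => h; have := ler_pM (ler0n R 2) (ler0n R 2) h h; lra.
rewrite expRN -(ler_pM2l (expR_gt0 2)) mulrA mulfV ?gt_eqF ?expR_gt0// mul1r; lra.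
Qed.

(** For a fixed pair of grid vectors, division by [8 * Num.sqrt d] makes the coefficients at most
    1/2 and the centered exponent at most [n]. The remaining [expR (- ((r + 12) * n))] beats the
    number of pairs, at most [64 ^+ n * 64 ^+ n <= expR (12 * n)]. *)
Lemma light_pr (r : R) : 1 <= r ->
  bern_pr pi (fun e => exists2 kk : grid n * grid n, grid_ball kk.1 && grid_ball kk.2 &
    8 * (r + 13) * n%:R * Num.sqrt d <
    \sum_i \sum_j (if `|grid_val R kk.1 i * grid_val R kk.2 j| <= 4 * Num.sqrt d
                   then grid_val R kk.1 i * grid_val R kk.2 j else 0) *
       (adj_of e i j - layer_sum w pi i j)) <= n%:R `^ (- r).
Proof.
move=> r1; have sd0 : 0 < Num.sqrt d by rewrite sqrtr_gt0.
apply: le_trans (bern_pr_union pi01 _ _) _ => /=.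
apply: (@le_trans _ _ (\sum_(kk : grid n * grid n | grid_ball kk.1 && grid_ball kk.2)
   expR (- ((r + 12) * n%:R)))).
  apply: ler_sum => -[k k'] /= /andP[kb kb'].
  pose c i j : R := (if `|grid_val R k i * grid_val R k' j| <= 4 * Num.sqrt d
                   then grid_val R k i * grid_val R k' j else 0) / (8 * Num.sqrt d).
  apply: le_trans (bern_chernoff (t := (r + 13) * n%:R) pi01
    (h := fun e => \sum_i \sum_j c i j * (adj_of e i j - layer_sum w pi i j)) _) _.
    move=> e /ltW; rewrite -(ler_pM2r (x := (8 * Num.sqrt d)^-1)) ?invr_gt0 ?mulr_gt0// => h.
    apply: le_trans (le_trans h _).
      rewrite le_eqVlt; apply/orP; left; apply/eqP; field.
      by rewrite gt_eqF.
    rewrite mulr_suml; apply: ler_sum => i _; rewrite mulr_suml; apply: ler_sum => j _.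
    by rewrite mulrAC.
  apply: le_trans (ler_wpM2l (expR_ge0 _) (edge_mgf_centered w01 p0 pi01 pip _)) _.
    move=> i j; rewrite /c normrM [X in _ * X]ger0_norm; last first.
      by rewrite invr_ge0 mulr_ge0// ltW.
    rewrite ler_pdivrMr ?mulr_gt0//; case: ifP; last by rewrite normr0; nra.
    by move=> /le_trans; apply; lra.
  rewrite -expRD ler_expR -/mu.
  have d64 : 0 <= (64 * d)^-1 by rewrite invr_ge0 mulr_ge0// ltW.
  have sc : \sum_i \sum_j c i j ^+ 2 <= (4 * n%:R) * (4 * n%:R) / (64 * d).
    apply: (@le_trans _ _ ((\sum_i grid_val R k i ^+ 2) * (\sum_j grid_val R k' j ^+ 2) / (64 * d))).
      rewrite !mulr_suml; apply: ler_sum => i _.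
      rewrite mulr_sumr mulr_suml; apply: ler_sum => j _.
      rewrite /c expr_div_n exprMn (sqr_sqrtr (ltW d0)).
      have -> : (8 : R) ^+ 2 = 64 by ring.
      rewrite ler_wpM2r//.
      by case: ifP => _; rewrite ?exprMn// expr0n mulr_ge0 ?sqr_ge0.
    rewrite ler_wpM2r//.
    by apply: ler_pM; rewrite ?grid_ball_sum// sumr_ge0// => i _; exact: sqr_ge0.
  have m4 : 0 <= 4 * mu by rewrite mulr_ge0// ltW.
  have := ler_wpM2l m4 sc.
  have -> : 4 * mu * (4 * n%:R * (4 * n%:R) / (64 * d)) = n%:R.
    by rewrite /d; field; rewrite !gt_eqF.
  lra.
rewrite -(pair_big (fun k : grid n => grid_ball k) (fun k : grid n => grid_ball k)
   (fun _ _ => expR (- ((r + 12) * n%:R))))/=.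
have cnt (x : R) : 0 <= x -> \sum_(k : grid n | grid_ball k) x <= 64 ^+ n * x.
  move=> x0; have := ler_wpM2r x0 (card_grid_ball R n).
  by rewrite mulr_suml; under eq_bigr do rewrite mul1r.
set E := expR _; have E0 : 0 <= E by exact: expR_ge0.
apply: le_trans (cnt _ _) _; first by rewrite sumr_ge0.
apply: (@le_trans _ _ (64 ^+ n * (64 ^+ n * E))).
  by rewrite ler_wpM2l ?exprn_ge0// cnt.
have h64 : (64 : R) ^+ n <= expR (6 * n%:R).
  rewrite expRM_natr lerXn2r ?nnegrE ?expR_ge0//.
  have -> : (6 : R) = 1 * 6%:R by rewrite mul1r.
  rewrite expRM_natr; have -> : (64 : R) = 2 ^+ 6 by ring.
  by rewrite lerXn2r ?nnegrE ?expR_ge0// expR1_ge2.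
apply: (@le_trans _ _ (expR (6 * n%:R) * (expR (6 * n%:R) * E))).
  by apply: ler_pM; rewrite ?mulr_ge0 ?exprn_ge0// ler_wpM2r.
rewrite /E -!expRD powR_expR// ler_expR.
have h : ln (n%:R : R) <= n%:R - 1.
  by have := expR_ge1Dx (ln (n%:R : R)); rewrite lnK ?posrE//; lra.
have := ler_wpM2l (le_trans ler01 r1) h; lra.
Qed.

(** Chernoff for fixed sets and fixed [t]; the union over [t] is free by monotonicity, and the one
    over pairs of sets factors into two entropy sums. Having every [t] in one event lets it be tuned
    later to the sets. *)
Lemma discrepancy_pr (r : R) : 1 <= r ->
  bern_pr pi (fun e => exists2 ST : {set 'I_n} * {set 'I_n}, (ST.1 != set0) && (ST.2 != set0) &
    exists2 t : R, 0 < t &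
      mu * #|ST.1|%:R * #|ST.2|%:R * (expR t - 1) +
        2 * (r + 2) * (subset_entropy R n #|ST.1| + subset_entropy R n #|ST.2|) <
      t * \sum_(i in ST.1) \sum_(j in ST.2) adj_of e i j) <= n%:R `^ (- r).
Proof.
move=> r1; apply: le_trans (bern_pr_union pi01 _ _) _ => /=.
pose G (S : {set 'I_n}) := expR (- ((r + 2) * subset_entropy R n #|S|)).
apply: (@le_trans _ _ (\sum_(ST : {set 'I_n} * {set 'I_n} | (ST.1 != set0) && (ST.2 != set0))
   G ST.1 * G ST.2)).
  apply: ler_sum => -[S T] _ /=.
  apply: bern_pr_exists_param => //; first by rewrite mulr_ge0// expR_ge0.
  move=> t t0; rewrite /G -expRD.
  apply: le_trans (bern_chernoff (t := mu * #|S|%:R * #|T|%:R * (expR t - 1) / 2 +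
     (r + 2) * (subset_entropy R n #|S| + subset_entropy R n #|T|)) pi01
    (h := fun e => t / 2 * \sum_(i in S) \sum_(j in T) adj_of e i j) _) _.
    by move=> e; lra.
  apply: le_trans (ler_wpM2l (expR_ge0 _) (edge_mgf_sets S T t0)) _.
  by rewrite -expRD ler_expR; lra.
rewrite -(pair_big (fun S : {set 'I_n} => S != set0) (fun S : {set 'I_n} => S != set0)
   (fun S T => G S * G T))/=.
under eq_bigr do rewrite -mulr_sumr.
rewrite -mulr_suml; have h := sum_entropy n0 r1.
have G0 : 0 <= \sum_(S : {set 'I_n} | S != set0) G S by apply: sumr_ge0 => S _; exact: expR_ge0.
apply: le_trans (ler_pM G0 G0 h h) _.
rewrite -[leRHS]mulr1 ler_wpM2l ?powR_ge0// powR_expR// expR_le1 mulNr oppr_le0.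
by rewrite mulr_ge0// ?ln_ge0 ?ler1n//; lra.
Qed.

End NoiseEvents.

(** * Heavy pairs *)

Section Geometric.
Variable R : realType.

Lemma sum_pow2_le (N : nat) (y : R) : 0 <= y -> \sum_(s < N | 2 ^+ s <= y) 2 ^+ s <= 2 * y.
Proof.
(* The bound [2 ^+ N] serves the induction when the term [2 ^+ N] enters: the new sum is then at
   most [2 ^+ N.+1 <= 2 * y]. *)
move=> y0; suff : \sum_(s < N | 2 ^+ s <= y) 2 ^+ s <= Num.min (2 ^+ N) (2 * y).
  by rewrite le_min => /andP[].
elim: N => [|N IH]; first by rewrite big_ord0 le_min mulr_ge0// ler01.
rewrite big_mkcond big_ord_recr/= -big_mkcond/=.
move: IH; rewrite !le_min => /andP[IH1 IH2].
have e0 : (0 : R) <= 2 ^+ N by rewrite exprn_ge0.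
rewrite exprS; case: ifP => h; apply/andP; split; lra.
Qed.

Lemma sum_inv_pow2_le (N : nat) (y : R) : 0 < y -> \sum_(s < N | y <= 2 ^+ s) 2 ^- s <= 2 / y.
Proof.
move=> y0.
(* Strengthened for the induction by subtracting the tail [2 * 2 ^- N] of the series. *)
suff : \sum_(s < N | y <= 2 ^+ s) 2 ^- s <= Num.max 0 (2 / y - 2 * 2 ^- N).
  rewrite le_max => /orP[|]; first by move/le_trans; apply; rewrite divr_ge0// ltW.
  by move/le_trans; apply; rewrite gerBl mulr_ge0// invr_ge0 exprn_ge0.
elim: N => [|N IH]; first by rewrite big_ord0 le_max lexx.
rewrite big_mkcond big_ord_recr/= -big_mkcond/=.
have e0 : (0 : R) < 2 ^+ N by rewrite exprn_gt0.
have -> : 2 ^- N.+1 = 2 ^- N / 2 :> R by rewrite exprS invfM mulrC.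
have i0 : 0 < 2 ^- N :> R by rewrite invr_gt0.
move: IH; rewrite !le_max; case: ifP => h.
  have hi : 2 ^- N <= y^-1 by rewrite lef_pV2 ?posrE.
  by move=> /orP[] H; apply/orP; right; lra.
have hi : y^-1 < 2 ^- N by rewrite ltf_pV2 ?posrE// ltNge h.
by move=> /orP[] H; apply/orP; left; lra.
Qed.

End Geometric.

Section Cell.
Variable R : realType.

Lemma ln_le_sub1 (x : R) : 0 < x -> ln x <= x - 1.
Proof. by move=> x0; have := expR_ge1Dx (ln x); rewrite lnK ?posrE//; lra. Qed.

(** Lets [1 + ln y] absorb the logarithm of [q] at the polynomial price [z]:
    [ln q <= 2 * ln y + 2 * ln z] and [ln z <= z - 1]. *)
Lemma entropy_ratio_le (y z q : R) : 1 <= y -> 1 <= z -> 0 < q -> q <= (y * z) ^+ 2 ->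
  1 + ln q <= 4 * z * (1 + ln y).
Proof.
move=> y1 z1 q0 qyz.
have y0 : 0 < y by lra.
have z0 : 0 < z by lra.
have hq : ln q <= 2 * (ln y + ln z).
  rewrite -lnM ?posrE//; apply: le_trans (_ : ln ((y * z) ^+ 2) <= _).
    by rewrite ler_ln ?posrE// exprn_gt0// mulr_gt0.
  by rewrite lnXn ?mulr_gt0// mulr_natl.
have hy : 0 <= ln y by rewrite ln_ge0.
have hz := ln_le_sub1 z0.
have : 0 <= (z - 1) * ln y by rewrite mulr_ge0//; lra.
lra.
Qed.

(* The exponent t = 1 + ln (2UV / (Dgh)) balances the two terms of the discrepancy inequality. *)
Lemma discrepancy_cell (n U V D g h P e a b : R) :
  0 < n -> 0 < U -> 0 < V -> 0 < D -> 0 < g <= 1 -> 0 < h <= 1 -> 0 <= P ->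
  U <= D * V -> V <= D * U -> D <= 2 * U * V ->
  a = 4 * n * g ^+ 2 / U ^+ 4 -> b = 4 * n * h ^+ 2 / V ^+ 4 ->
  (forall t, 0 < t -> t * e <= D ^+ 4 / n * a * b * (expR t - 1) +
     P * (a * (1 + ln (n / a)) + b * (1 + ln (n / b)))) ->
  16 * U ^+ 2 * V ^+ 2 * e <=
    256 * n * expR 1 * D ^+ 3 * (g ^+ 2 + h ^+ 2) / (U * V) +
    256 * n * P * D * (h ^+ 2 * U / V + g ^+ 2 * V / U).
Proof.
move=> n0 U0 V0 D0 /andP[g0 g1] /andP[h0 h1] P0 UDV VDU DUV aE bE disc.
(* In the application [U = 2 ^+ s], [V = 2 ^+ t], [D ^+ 4 = d], and [g ^+ 2], [h ^+ 2] are the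
   masses of two level classes. *)
pose y := 2 * U * V / (D * g * h).
have Dgh0 : 0 < D * g * h by rewrite !mulr_gt0.
have y1 : 1 <= y.
  rewrite ler_pdivlMr// mul1r; apply: le_trans DUV.
  rewrite -mulrA -[leRHS]mulr1 ler_pM2l//.
  by rewrite -[leRHS]mulr1; apply: ler_pM => //; exact: ltW.
have y0 : 0 < y by lra.
pose t := 1 + ln y.
have t1 : 1 <= t by rewrite lerDl ln_ge0.
have t0 : 0 < t by lra.
have et : expR t = expR 1 * y by rewrite expRD lnK ?posrE.
have W0 : 0 < 16 * U ^+ 2 * V ^+ 2 by rewrite !mulr_gt0// exprn_gt0.
have E1 := expR_gt0 (1 : R).
have U4 : 0 < U ^+ 4 by rewrite exprn_gt0.
have V4 : 0 < V ^+ 4 by rewrite exprn_gt0.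
have a0 : 0 < a by rewrite aE !mulr_gt0 ?exprn_gt0// invr_gt0.
have b0 : 0 < b by rewrite bE !mulr_gt0 ?exprn_gt0// invr_gt0.
rewrite -(ler_pM2l t0).
have -> : t * (16 * U ^+ 2 * V ^+ 2 * e) = 16 * U ^+ 2 * V ^+ 2 * (t * e) by ring.
apply: le_trans (ler_wpM2l (ltW W0) (disc t t0)) _.
have first : 16 * U ^+ 2 * V ^+ 2 * (D ^+ 4 / n * a * b * (expR t - 1)) <=
    t * (256 * n * expR 1 * D ^+ 3 * (g ^+ 2 + h ^+ 2) / (U * V)).
  set X := 256 * _ * _ * _ * _ / _.
  have X0 : 0 <= X.
    by rewrite !mulr_ge0 ?invr_ge0 ?addr_ge0 ?mulr_ge0 ?exprn_ge0// ltW.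
  apply: (@le_trans _ _ (1 * X)); last by rewrite ler_wpM2r.
  rewrite mul1r; apply: (@le_trans _ _ (16 * U ^+ 2 * V ^+ 2 * (D ^+ 4 / n * a * b * expR t))).
    rewrite ler_pM2l// ler_wpM2l//; last by rewrite gerBl.
    by rewrite !mulr_ge0 ?invr_ge0 ?exprn_ge0// ltW.
  rewrite et aE bE.
  have -> : 16 * U ^+ 2 * V ^+ 2 * (D ^+ 4 / n * (4 * n * g ^+ 2 / U ^+ 4) *
     (4 * n * h ^+ 2 / V ^+ 4) * (expR 1 * y)) = 256 * n * expR 1 * D ^+ 3 * (2 * g * h) / (U * V).
    by rewrite /y; field; rewrite !gt_eqF.
  rewrite ler_pM2r ?invr_gt0 ?mulr_gt0// ler_wpM2l//.
    by rewrite !mulr_ge0 ?exprn_ge0// ltW.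
  by have := sqr_ge0 (g - h); rewrite sqrrB; lra.
(* One entropy term, in a form that also gives the other by exchanging the two classes. Inside, [z]
   is the slack in the comparison of the two levels. *)
have key (n' U' V' g' h' b' : R) : 0 < n' -> 0 < U' -> 0 < V' -> 0 < g' <= 1 -> 0 < h' ->
    U' <= D * V' -> 2 * U' * V' / (D * g' * h') = y ->
    b' = 4 * n' * h' ^+ 2 / V' ^+ 4 ->
    16 * U' ^+ 2 * V' ^+ 2 * (P * (b' * (1 + ln (n' / b')))) <=
    t * (256 * n' * P * D * (h' ^+ 2 * U' / V')).
  move=> n'0 U'0 V'0 /andP[g'0 g'1] h'0 UDV' yE b'E.
  pose z := D * V' / U'.
  have z1 : 1 <= z by rewrite ler_pdivlMr// mul1r.
  have V'4 : 0 < V' ^+ 4 by rewrite exprn_gt0.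
  have q0 : 0 < n' / b' by rewrite b'E divr_gt0// !mulr_gt0 ?exprn_gt0// invr_gt0.
  have hq : n' / b' <= (y * z) ^+ 2.
    have -> : n' / b' = (V' ^+ 2 / (2 * h')) ^+ 2.
      by rewrite b'E; field; rewrite !gt_eqF.
    rewrite lerXn2r ?nnegrE//.
    - by rewrite divr_ge0 ?mulr_ge0 ?exprn_ge0// ltW.
    - by rewrite mulr_ge0//; lra.
    have -> : y * z = V' ^+ 2 / (2 * h') * (4 / g').
      by rewrite -yE /z; field; rewrite !gt_eqF.
    rewrite ler_peMr//; first by rewrite divr_ge0 ?mulr_ge0 ?exprn_ge0// ltW.
    by rewrite ler_pdivlMr//; lra.
  have := entropy_ratio_le y1 z1 q0 hq; rewrite -/t => H.
  have B0 : 0 <= 16 * U' ^+ 2 * V' ^+ 2 * (P * b').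
    have b'0 : 0 < b' by rewrite b'E divr_gt0// !mulr_gt0 ?exprn_gt0.
    by rewrite !mulr_ge0 ?exprn_ge0 ?(ltW U'0) ?(ltW V'0) ?(ltW b'0).
  apply: le_trans (_ : 16 * U' ^+ 2 * V' ^+ 2 * (P * b') * (4 * z * t) <= _).
    by rewrite (mulrA P) mulrA ler_wpM2l.
  rewrite le_eqVlt; apply/orP; left; apply/eqP.
  by rewrite b'E /z; field; rewrite !gt_eqF.
have k1 := key n U V g h b n0 U0 V0 (introT andP (conj g0 g1)) h0 UDV erefl bE.
have yE' : 2 * V * U / (D * h * g) = y by rewrite /y; congr (_ / _); ring.
have k2 := key n V U h g a n0 V0 U0 (introT andP (conj h0 h1)) g0 VDU yE' aE.
lra.
Qed.

End Cell.

Section Heavy.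
Variables (R : realType) (n : nat) (A : 'I_n -> 'I_n -> R) (gamma d P : R).
Hypothesis n0 : (0 < n)%N.
Hypothesis d0 : 0 < d.
Hypothesis P0 : 0 <= P.
Hypothesis A0 : forall i j, 0 <= A i j.
Hypothesis AC : forall i j, A i j = A j i.
Hypothesis disc : forall (S T : {set 'I_n}) (t : R), S != set0 -> T != set0 -> 0 < t ->
  t * \sum_(i in S) \sum_(j in T) A i j <=
  d / n%:R * #|S|%:R * #|T|%:R * (expR t - 1) +
  P * (subset_entropy R n #|S| + subset_entropy R n #|T|).

Let n0R : (0 : R) < n%:R. Proof. by rewrite ltr0n. Qed.
Let sd := Num.sqrt d.
Let D := Num.sqrt sd.
Let sd0 : 0 < sd. Proof. by rewrite sqrtr_gt0. Qed.
Let D0 : 0 < D. Proof. by rewrite sqrtr_gt0. Qed.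
Let D2 : D ^+ 2 = sd. Proof. by rewrite sqr_sqrtr// ltW. Qed.
Let sd2 : sd ^+ 2 = d. Proof. by rewrite sqr_sqrtr// ltW. Qed.
Let D4 : D ^+ 4 = d. Proof. by rewrite (exprM D 2 2) D2 sd2. Qed.

(** Levels are powers of 4, so that their square roots are the integers [2 ^ s]. The test [0 < k i]
    excludes zeros, which would fall in level 0 because [trunc_log 4 0] is 0. *)
Definition dyadic_class (k : 'I_n -> nat) (s : nat) : {set 'I_n} :=
  [set i | (0 < k i)%N && (trunc_log 4 (k i) == s)].

Lemma sum_dyadic_class (k : 'I_n -> nat) (N : nat) :
  \sum_(s < N) #|dyadic_class k s|%:R * (4 ^+ s) ^+ 2 <= \sum_i (k i)%:R ^+ 2 :> R.
Proof.
have -> : \sum_(s < N) #|dyadic_class k s|%:R * (4 ^+ s) ^+ 2 =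
    \sum_(s < N) \sum_i (if i \in dyadic_class k s then (4 ^+ s) ^+ 2 else 0) :> R.
  by apply: eq_bigr => s _; rewrite -big_mkcond/= sumr_const -[RHS]mulr_natl.
rewrite exchange_big/=; apply: ler_sum => i _.
under eq_bigr do rewrite inE andbC eq_sym.
have [->|k0] := posnP (k i).
  by rewrite expr0n/= big1// => s _; rewrite andbF.
rewrite -big_mkcond/=; under eq_bigl do rewrite andbT.
rewrite (big_ord1_eq _ (fun s => (4 ^+ s) ^+ 2 : R)).
case: ifP => _; last by rewrite sqr_ge0.
rewrite lerXn2r ?nnegrE ?exprn_ge0// -natrX ler_nat.
by apply: trunc_logP.
Qed.

Definition class_mass (k : 'I_n -> nat) (s : nat) : R :=
  #|dyadic_class k s|%:R * (4 ^+ s) ^+ 2 / (4 * n%:R).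

Lemma class_mass_ge0 k s : 0 <= class_mass k s.
Proof. by rewrite /class_mass divr_ge0// mulr_ge0// sqr_ge0. Qed.

Lemma sum_class_mass (k : 'I_n -> nat) (N : nat) : \sum_i (k i)%:R ^+ 2 <= 4 * n%:R :> R ->
  \sum_(s < N) class_mass k s <= 1.
Proof.
move=> k4; rewrite -mulr_suml ler_pdivrMr ?mulr_gt0// mul1r.
by apply: le_trans k4; exact: sum_dyadic_class.
Qed.

Lemma class_mass_le1 (k : 'I_n -> nat) (s : nat) : \sum_i (k i)%:R ^+ 2 <= 4 * n%:R :> R ->
  class_mass k s <= 1.
Proof.
move=> /(sum_class_mass s.+1); apply: le_trans.
by rewrite big_ord_recr/= lerDr sumr_ge0// => i _; exact: class_mass_ge0.
Qed.

(** Squared, the first two conditions say that the levels [4 ^+ s] and [4 ^+ t] are within a factor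
    sqrt d of each other; the third holds on any cell containing a heavy pair. *)
Definition good_cell (s t : nat) : bool :=
  [&& (2 : R) ^+ s <= D * 2 ^+ t, (2 : R) ^+ t <= D * 2 ^+ s & D <= 2 * 2 ^+ s * 2 ^+ t].

Let c1 : R := 256 * n%:R * expR 1 * D ^+ 3.
Let c2 : R := 256 * n%:R * P * D.

Lemma cell_bound (k k' : 'I_n -> nat) (s t : nat) :
  \sum_i (k i)%:R ^+ 2 <= 4 * n%:R :> R -> \sum_i (k' i)%:R ^+ 2 <= 4 * n%:R :> R ->
  good_cell s t ->
  16 * 4 ^+ s * 4 ^+ t * \sum_(i in dyadic_class k s) \sum_(j in dyadic_class k' t) A i j <=
  c1 * ((class_mass k s + class_mass k' t) / (2 ^+ s * 2 ^+ t)) +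
  c2 * (class_mass k' t * 2 ^+ s / 2 ^+ t + class_mass k s * 2 ^+ t / 2 ^+ s).
Proof.
move=> k4 k4' /and3P[st ts Dst].
have p2 m : 0 < (2 : R) ^+ m by rewrite exprn_gt0.
have m0 := class_mass_ge0 k s; have m0' := class_mass_ge0 k' t.
have rhs0 : 0 <= c1 * ((class_mass k s + class_mass k' t) / (2 ^+ s * 2 ^+ t)) +
  c2 * (class_mass k' t * 2 ^+ s / 2 ^+ t + class_mass k s * 2 ^+ t / 2 ^+ s).
  have i2 m : 0 <= (2 : R) ^- m by rewrite invr_ge0 ltW.
  have c10 : 0 <= c1 by rewrite /c1 !mulr_ge0 ?expR_ge0 ?exprn_ge0// ltW.
  have c20 : 0 <= c2 by rewrite /c2 !mulr_ge0// ltW.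
  have p20 m : 0 <= (2 : R) ^+ m by exact: ltW.
  apply: addr_ge0; apply: mulr_ge0 => //.
    by rewrite divr_ge0 ?addr_ge0// mulr_ge0.
  by rewrite addr_ge0// mulr_ge0// mulr_ge0.
have [E|Sn] := eqVneq (dyadic_class k s) set0; first by rewrite E big_set0 mulr0.
have [E|Tn] := eqVneq (dyadic_class k' t) set0.
  by rewrite E big1 ?mulr0// => i _; rewrite big_set0.
have pow4 m : (4 : R) ^+ m = (2 ^+ m) ^+ 2.
  by rewrite -exprM mulnC exprM; congr (_ ^+ _); ring.
have gE f m : Num.sqrt (class_mass f m) ^+ 2 = class_mass f m.
  by rewrite sqr_sqrtr// class_mass_ge0.
have card_gt0R (S : {set 'I_n}) : S != set0 -> (0 : R) < #|S|%:R.
  by rewrite -card_gt0 ltr0n.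
have g01 f m : \sum_i (f i)%:R ^+ 2 <= 4 * n%:R :> R -> dyadic_class f m != set0 ->
    0 < Num.sqrt (class_mass f m) <= 1.
  move=> f4 Fn; rewrite sqrtr_gt0 /class_mass divr_gt0 ?mulr_gt0 ?card_gt0R ?exprn_gt0//=.
  by rewrite -[leRHS]sqrtr1 ler_wsqrtr// class_mass_le1.
have aE f m : #|dyadic_class f m|%:R = 4 * n%:R * Num.sqrt (class_mass f m) ^+ 2 / (2 ^+ m) ^+ 4.
  rewrite gE /class_mass pow4; have := p2 m; move: (2 ^+ m) => x x0; field.
  by rewrite !gt_eqF.
have := @discrepancy_cell R n%:R (2 ^+ s) (2 ^+ t) D (Num.sqrt (class_mass k s))
  (Num.sqrt (class_mass k' t)) P
  (\sum_(i in dyadic_class k s) \sum_(j in dyadic_class k' t) A i j)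
  #|dyadic_class k s|%:R #|dyadic_class k' t|%:R n0R (p2 s) (p2 t) D0
  (g01 _ _ k4 Sn) (g01 _ _ k4' Tn) P0 st ts Dst (aE _ _) (aE _ _).
rewrite !gE -!pow4 => H.
apply: le_trans (H _) _; last by rewrite /c1 /c2 !mulrA.
by move=> x x0; rewrite D4; exact: disc.
Qed.

(** For fixed [s], the third condition of [good_cell] starts the geometric series in [t] at
    [D / (2 * 2 ^+ s)], and the powers of 2 cancel. *)
Let sum_cell_up (al : nat -> R) (N : nat) : (forall s, 0 <= al s) -> \sum_(s < N) al s <= 1 ->
  \sum_(s < N) \sum_(t < N | good_cell s t) al s / (2 ^+ s * 2 ^+ t) <= 4 / D.
Proof.
move=> al0 al1.
apply: (@le_trans _ _ (\sum_(s < N) al s * (4 / D))); last first.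
  by rewrite -mulr_suml -[leRHS]mul1r ler_wpM2r// divr_ge0// ltW.
apply: ler_sum => s _.
have s0 : 0 < (2 : R) ^+ s by rewrite exprn_gt0.
apply: (@le_trans _ _ (\sum_(t < N | D / (2 * 2 ^+ s) <= 2 ^+ t) al s / 2 ^+ s * 2 ^- t)).
  rewrite [leLHS]big_mkcond [leRHS]big_mkcond/=; apply: ler_sum => t _.
  case: ifP => [/and3P[_ _ h]|_].
    have -> : D / (2 * 2 ^+ s) <= 2 ^+ t by rewrite ler_pdivrMr ?mulr_gt0// mulrC.
    by rewrite invfM mulrA.
  by case: ifP => // _; rewrite !mulr_ge0 ?invr_ge0 ?exprn_ge0.
rewrite -mulr_sumr.
have y0 : 0 < D / (2 * 2 ^+ s) by rewrite divr_gt0// mulr_gt0.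
have h0 : 0 <= al s / 2 ^+ s by rewrite divr_ge0// ltW.
apply: le_trans (ler_wpM2l h0 (sum_inv_pow2_le N y0)) _.
rewrite le_eqVlt; apply/orP; left; apply/eqP; field.
by rewrite !gt_eqF.
Qed.

Let sum_cell_side (al : nat -> R) (N : nat) : (forall s, 0 <= al s) -> \sum_(s < N) al s <= 1 ->
  \sum_(s < N) \sum_(t < N | good_cell s t) al s * 2 ^+ t / 2 ^+ s <= 2 * D.
Proof.
move=> al0 al1.
apply: (@le_trans _ _ (\sum_(s < N) al s * (2 * D))); last first.
  by rewrite -mulr_suml -[leRHS]mul1r ler_wpM2r// mulr_ge0// ltW.
apply: ler_sum => s _.
have s0 : 0 < (2 : R) ^+ s by rewrite exprn_gt0.
apply: (@le_trans _ _ (\sum_(t < N | 2 ^+ t <= D * 2 ^+ s) al s / 2 ^+ s * 2 ^+ t)).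
  rewrite [leLHS]big_mkcond [leRHS]big_mkcond/=; apply: ler_sum => t _.
  case: ifP => [/and3P[_ h _]|_]; first by rewrite h mulrAC.
  by case: ifP => // _; rewrite !mulr_ge0 ?invr_ge0 ?exprn_ge0.
rewrite -mulr_sumr.
have y0 : 0 <= D * 2 ^+ s by rewrite mulr_ge0// ltW.
have h0 : 0 <= al s / 2 ^+ s by rewrite divr_ge0// ltW.
apply: le_trans (ler_wpM2l h0 (sum_pow2_le N y0)) _.
rewrite le_eqVlt; apply/orP; left; apply/eqP; field.
by rewrite !gt_eqF.
Qed.

Let good_cellC s t : good_cell s t = good_cell t s.
Proof. by rewrite /good_cell mulrAC andbCA. Qed.

(** Each of the four terms of [cell_bound] is a geometric series in one index times masses of total
    at most 1 in the other; the powers of [D] combine to [D ^+ 2 = sd]. *)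
Lemma sum_cells (k k' : 'I_n -> nat) (N : nat) :
  \sum_i (k i)%:R ^+ 2 <= 4 * n%:R :> R -> \sum_i (k' i)%:R ^+ 2 <= 4 * n%:R :> R ->
  \sum_(s < N) \sum_(t < N | good_cell s t) 16 * 4 ^+ s * 4 ^+ t *
     \sum_(i in dyadic_class k s) \sum_(j in dyadic_class k' t) A i j <=
  n%:R * sd * (2048 * expR 1 + 1024 * P).
Proof.
move=> k4 k4'.
pose al := class_mass k; pose be := class_mass k'.
have al0 s : 0 <= al s by exact: class_mass_ge0.
have be0 s : 0 <= be s by exact: class_mass_ge0.
have h1 := sum_cell_up al0 (sum_class_mass N k4).
have h2 := sum_cell_up be0 (sum_class_mass N k4').
have h3 := sum_cell_side al0 (sum_class_mass N k4).
have h4 := sum_cell_side be0 (sum_class_mass N k4').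
have exch (F : nat -> nat -> R) : \sum_(s < N) \sum_(t < N | good_cell s t) F t s =
    \sum_(s < N) \sum_(t < N | good_cell s t) F s t.
  under eq_bigr do rewrite big_mkcond/=.
  rewrite exchange_big/=; apply: eq_bigr => s _; rewrite [RHS]big_mkcond.
  by apply: eq_bigr => t _; rewrite good_cellC.
apply: (@le_trans _ _ (\sum_(s < N) \sum_(t < N | good_cell s t)
   (c1 * (al s / (2 ^+ s * 2 ^+ t)) + c1 * (be t / (2 ^+ t * 2 ^+ s)) +
    c2 * (be t * 2 ^+ s / 2 ^+ t) + c2 * (al s * 2 ^+ t / 2 ^+ s)))).
  apply: ler_sum => s _; apply: ler_sum => t st.
  apply: le_trans (cell_bound k4 k4' st) _; rewrite /al /be (mulrC (2 ^+ t)) mulrDl !mulrDr.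
  by rewrite !addrA.
have lin (F1 F2 F3 F4 : nat -> nat -> R) :
    \sum_(s < N) \sum_(t < N | good_cell s t)
      (c1 * F1 s t + c1 * F2 s t + c2 * F3 s t + c2 * F4 s t) =
    c1 * (\sum_(s < N) \sum_(t < N | good_cell s t) F1 s t) +
    c1 * (\sum_(s < N) \sum_(t < N | good_cell s t) F2 s t) +
    c2 * (\sum_(s < N) \sum_(t < N | good_cell s t) F3 s t) +
    c2 * (\sum_(s < N) \sum_(t < N | good_cell s t) F4 s t).
  rewrite !mulr_sumr -!big_split/=; apply: eq_bigr => s _.
  by rewrite !mulr_sumr -!big_split.
rewrite (lin (fun s t => al s / (2 ^+ s * 2 ^+ t)) (fun s t => be t / (2 ^+ t * 2 ^+ s))
  (fun s t => be t * 2 ^+ s / 2 ^+ t) (fun s t => al s * 2 ^+ t / 2 ^+ s)).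
rewrite (exch (fun t s => be t / (2 ^+ t * 2 ^+ s))) (exch (fun t s => be t * 2 ^+ s / 2 ^+ t)).
have c10 : 0 <= c1 by rewrite /c1 !mulr_ge0 ?expR_ge0 ?exprn_ge0// ltW.
have c20 : 0 <= c2 by rewrite /c2 !mulr_ge0// ltW.
apply: le_trans (lerD (lerD (lerD (ler_wpM2l c10 h1) (ler_wpM2l c10 h2))
  (ler_wpM2l c20 h4)) (ler_wpM2l c20 h3)) _.
rewrite le_eqVlt; apply/orP; left; apply/eqP; rewrite /c1 /c2 -D2; field.
by rewrite gt_eqF.
Qed.

(** A pair whose levels differ by more than a factor sqrt d has product at most [4 / sd] times the
    larger square, which the degree bound on the supports controls. Every other heavy pair lies in a
    good cell. *)
Lemma heavy_sum (k k' : 'I_n -> nat) : 0 <= gamma ->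
  \sum_i (k i)%:R ^+ 2 <= 4 * n%:R :> R -> \sum_i (k' i)%:R ^+ 2 <= 4 * n%:R :> R ->
  (forall i, (0 < k i)%N -> \sum_j A i j <= gamma * d) ->
  (forall i, (0 < k' i)%N -> \sum_j A i j <= gamma * d) ->
  \sum_i \sum_j (if 4 * sd < (k i)%:R * (k' j)%:R then (k i)%:R * (k' j)%:R else 0) * A i j <=
  n%:R * sd * (32 * gamma + 2048 * expR 1 + 1024 * P).
Proof.
move=> gamma0 k4 k4' deg deg'.
set N := (\max_i trunc_log 4 (k i) + \max_i trunc_log 4 (k' i)).+1.
have kN i : (trunc_log 4 (k i) < N)%N.
  by rewrite ltnS (leq_trans _ (leq_addr _ _))//; exact: leq_bigmax.
have kN' i : (trunc_log 4 (k' i) < N)%N.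
  by rewrite ltnS (leq_trans _ (leq_addl _ _))//; exact: leq_bigmax.
pose T i j : R := \sum_(st : 'I_N * 'I_N | good_cell st.1 st.2)
  (if (i \in dyadic_class k st.1) && (j \in dyadic_class k' st.2)
   then 16 * 4 ^+ st.1 * 4 ^+ st.2 else 0).
have T0 i j : 0 <= T i j.
  by apply: sumr_ge0 => st _; case: ifP => // _; rewrite !mulr_ge0 ?exprn_ge0.
have pow4 m : (4 : R) ^+ m = (2 ^+ m) ^+ 2.
  by rewrite -exprM mulnC exprM; congr (_ ^+ _); ring.
have q0 (x : nat) : 0 <= 4 / sd * x%:R ^+ 2 by rewrite mulr_ge0 ?sqr_ge0 ?divr_ge0 ?ltW.
have far (x y : nat) (s t : nat) : (4 ^ s <= x < 4 ^ s.+1)%N -> (4 ^ t <= y < 4 ^ t.+1)%N ->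
    D * 2 ^+ t < 2 ^+ s -> x%:R * y%:R <= 4 / sd * x%:R ^+ 2 :> R.
  move=> /andP[x1 _] /andP[_ y2] st.
  have y2' : y%:R <= 4 * 4 ^+ t :> R by rewrite -exprS -natrX ler_nat ltnW.
  have x1' : 4 ^+ s <= x%:R :> R by rewrite -natrX ler_nat.
  have h : sd * 4 ^+ t <= 4 ^+ s.
    rewrite -D2 !pow4 -exprMn lerXn2r ?nnegrE ?exprn_ge0 ?mulr_ge0 ?exprn_ge0 ?(ltW D0)//.
    exact: ltW.
  have h2 : sd * y%:R <= 4 * x%:R.
    by have := ler_wpM2l (ltW sd0) y2'; lra.
  rewrite -(ler_pM2l sd0).
  have -> : sd * (4 / sd * x%:R ^+ 2) = x%:R * (4 * x%:R) by field; rewrite gt_eqF.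
  by rewrite mulrCA ler_wpM2l.
have pt i j : (if 4 * sd < (k i)%:R * (k' j)%:R then (k i)%:R * (k' j)%:R else 0) <=
    4 / sd * (k i)%:R ^+ 2 + 4 / sd * (k' j)%:R ^+ 2 + T i j.
  case: ifP => [hv|_]; last by rewrite !addr_ge0.
  have ab0 : (0 < k i * k' j)%N.
    by rewrite -(ltr0n R) natrM; apply: le_lt_trans hv; rewrite mulr_ge0// ltW.
  move: ab0; rewrite muln_gt0 => /andP[a0 b0].
  have bs := trunc_log_bounds (isT : (1 < 4)%N) a0.
  have bt := trunc_log_bounds (isT : (1 < 4)%N) b0.
  set s := trunc_log 4 (k i) in bs; set t := trunc_log 4 (k' j) in bt.
  have := q0 (k i); have := q0 (k' j); have := T0 i j => T0' qb qa.
  have [st|st] := leP (2 ^+ s) (D * 2 ^+ t); last by have := far _ _ _ _ bs bt st; lra.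
  have [ts|ts] := leP (2 ^+ t) (D * 2 ^+ s); last first.
    by have := far _ _ _ _ bt bs ts; rewrite mulrC; lra.
  have up : (k i)%:R * (k' j)%:R <= 16 * 4 ^+ s * 4 ^+ t :> R.
    have -> : 16 * 4 ^+ s * 4 ^+ t = 4 ^+ s.+1 * 4 ^+ t.+1 :> R by rewrite !exprS; ring.
    move: bs bt => /andP[_ ha] /andP[_ hb].
    by rewrite -!natrX; apply: ler_pM; rewrite // ler_nat ltnW.
  have Dst : D <= 2 * 2 ^+ s * 2 ^+ t.
    rewrite leNgt; apply/negP => lt.
    have : (2 * 2 ^+ s * 2 ^+ t) ^+ 2 <= D ^+ 2.
      by rewrite lerXn2r ?nnegrE ?mulr_ge0 ?exprn_ge0 ?(ltW D0) ?(ltW lt).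
    by rewrite D2 !exprMn -!pow4; move: up hv; lra.
  have gc : good_cell s t by apply/and3P.
  suff : 16 * 4 ^+ s * 4 ^+ t <= T i j by lra.
  rewrite /T (bigD1 (Ordinal (kN i), Ordinal (kN' j)))//= !inE a0 b0 !eqxx/= lerDl.
  by apply: sumr_ge0 => st' _; case: ifP => // _; rewrite !mulr_ge0 ?exprn_ge0.
apply: (@le_trans _ _ (\sum_i \sum_j
   (4 / sd * ((k i)%:R ^+ 2 * A i j) + 4 / sd * ((k' j)%:R ^+ 2 * A i j) + T i j * A i j))).
  apply: ler_sum => i _; apply: ler_sum => j _.
  by apply: le_trans (ler_wpM2r (A0 i j) (pt i j)) _; lra.
have degsum (f : 'I_n -> nat) : \sum_i (f i)%:R ^+ 2 <= 4 * n%:R :> R ->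
    (forall i, (0 < f i)%N -> \sum_j A i j <= gamma * d) ->
    4 / sd * (\sum_i \sum_j (f i)%:R ^+ 2 * A i j) <= 16 * n%:R * sd * gamma.
  move=> f4 fdeg.
  have -> : 16 * n%:R * sd * gamma = 4 / sd * (4 * n%:R * (gamma * d)).
    by rewrite -sd2; field; rewrite gt_eqF.
  rewrite ler_wpM2l ?divr_ge0 ?(ltW sd0)//.
  apply: (@le_trans _ _ (\sum_i (f i)%:R ^+ 2 * (gamma * d))).
    apply: ler_sum => i _; rewrite -mulr_sumr.
    have [->|fi] := posnP (f i); first by rewrite expr0n !mul0r.
    by rewrite ler_wpM2l ?sqr_ge0// fdeg.
  by rewrite -mulr_suml ler_wpM2r// mulr_ge0// ltW.
have lin (F1 F2 F3 : 'I_n -> 'I_n -> R) (x : R) :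
   \sum_i \sum_j (x * F1 i j + x * F2 i j + F3 i j) =
   x * (\sum_i \sum_j F1 i j) + x * (\sum_i \sum_j F2 i j) + \sum_i \sum_j F3 i j.
  rewrite !mulr_sumr -!big_split/=; apply: eq_bigr => i _.
  by rewrite !mulr_sumr -!big_split.
rewrite (lin (fun i j => (k i)%:R ^+ 2 * A i j) (fun i j => (k' j)%:R ^+ 2 * A i j)).
have t1 := degsum _ k4 deg.
have t2 : 4 / sd * (\sum_i \sum_j (k' j)%:R ^+ 2 * A i j) <= 16 * n%:R * sd * gamma.
  rewrite exchange_big/=; under eq_bigr do under eq_bigr do rewrite AC.
  exact: degsum.
have t3 : \sum_i \sum_j T i j * A i j <= n%:R * sd * (2048 * expR 1 + 1024 * P).
  apply: le_trans (sum_cells N k4 k4').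
  rewrite (pair_big_dep xpredT (fun s t : 'I_N => good_cell s t) (fun s t : 'I_N =>
     16 * 4 ^+ s * 4 ^+ t * \sum_(i in dyadic_class k s) \sum_(j in dyadic_class k' t) A i j))/=.
  under [leRHS]eq_bigr do rewrite -sum_indicator.
  rewrite [leRHS]exchange_big/=; apply: ler_sum => i _.
  rewrite [leRHS]exchange_big/=; apply: ler_sum => j _.
  by rewrite /T mulr_suml.
lra.
Qed.

End Heavy.

(** * Operator norm of the trimmed noise *)

Section BilinearBound.
Variables (R : realType) (n : nat).
Implicit Types (M : 'I_n -> 'I_n -> R) (x y : 'I_n -> R).

(** Lagrange's identity: the double sum of squares is twice the gap. *)
Lemma cauchy_schwarz (I : finType) (P : pred I) (a b : I -> R) :
  (\sum_(i | P i) a i * b i) ^+ 2 <= (\sum_(i | P i) a i ^+ 2) * (\sum_(i | P i) b i ^+ 2).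
Proof.
have : 0 <= \sum_(i | P i) \sum_(j | P j) (a i * b j - a j * b i) ^+ 2.
  by do 2!apply: sumr_ge0 => ? _; exact: sqr_ge0.
have -> : \sum_(i | P i) \sum_(j | P j) (a i * b j - a j * b i) ^+ 2 =
   (\sum_(i | P i) a i ^+ 2) * (\sum_(i | P i) b i ^+ 2) +
   (\sum_(i | P i) b i ^+ 2) * (\sum_(i | P i) a i ^+ 2) -
   2 * ((\sum_(i | P i) a i * b i) * (\sum_(i | P i) a i * b i)).
  set A := \sum_(i | P i) a i ^+ 2; set B := \sum_(i | P i) b i ^+ 2.
  set C := \sum_(i | P i) a i * b i.
  transitivity (\sum_(i | P i) (a i ^+ 2 * B + b i ^+ 2 * A - 2 * (a i * b i * C))).
    apply: eq_bigr => i _; rewrite /A /B /C !mulr_sumr -big_split -sumrB.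
    by apply: eq_bigr => j _ /=; ring.
  by rewrite sumrB big_split/= -!mulr_suml -mulr_sumr -mulr_suml.
by rewrite expr2; lra.
Qed.

(** Operator norm at most [K]; a one-sided bound is enough, as [x] may be replaced by its
    opposite. *)
Definition bilinear_le M (K : R) := forall x y,
  \sum_i \sum_j x i * y j * M i j <= K * Num.sqrt (\sum_i x i ^+ 2) * Num.sqrt (\sum_j y j ^+ 2).

Lemma bilinear_leD M1 M2 K1 K2 : bilinear_le M1 K1 -> bilinear_le M2 K2 ->
  bilinear_le (fun i j => M1 i j + M2 i j) (K1 + K2).
Proof.
move=> h1 h2 x y; rewrite !mulrDl; apply: le_trans (lerD (h1 x y) (h2 x y)).
rewrite -big_split le_eqVlt; apply/orP; left; apply/eqP; apply: eq_bigr => i _ /=.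
by rewrite -big_split; apply: eq_bigr => j _ /=; rewrite mulrDr.
Qed.

Lemma bilinear_leZ M K c : 0 <= c -> bilinear_le M K ->
  bilinear_le (fun i j => c * M i j) (c * K).
Proof.
move=> c0 h x y; have := ler_wpM2l c0 (h x y); rewrite !mulrA; apply: le_trans.
rewrite mulr_sumr.
rewrite le_eqVlt; apply/orP; left; apply/eqP; apply: eq_bigr => i _ /=.
by rewrite mulr_sumr; apply: eq_bigr => j _ /=; rewrite mulrCA.
Qed.

Lemma bilinear_le_ext M M' K : (forall i j, M i j = M' i j) -> bilinear_le M K -> bilinear_le M' K.
Proof.
move=> MM h x y; apply: le_trans (h x y); rewrite le_eqVlt; apply/orP; left; apply/eqP.
by apply: eq_bigr => i _; apply: eq_bigr => j _; rewrite MM.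
Qed.

Lemma bilinear_le_frob M K : 0 <= K -> \sum_i \sum_j M i j ^+ 2 <= K ^+ 2 -> bilinear_le M K.
Proof.
move=> K0 h x y.
have s0 (z : 'I_n -> R) : 0 <= \sum_i z i ^+ 2 by apply: sumr_ge0 => i _; exact: sqr_ge0.
rewrite -mulrA -sqrtrM//; set xy := _ * (\sum_j _); have xy0 : 0 <= xy by exact: mulr_ge0.
rewrite -[K]ger0_norm// -sqrtr_sqr -sqrtrM ?sqr_ge0//.
apply: le_trans (ler_norm _) _; rewrite -sqrtr_sqr ler_wsqrtr// pair_big/=.
apply: le_trans (cauchy_schwarz _ (fun ij : 'I_n * 'I_n => x ij.1 * y ij.2) (fun ij => M ij.1 ij.2)) _.
rewrite mulrC; apply: ler_pM; rewrite ?sumr_ge0// => *; rewrite ?sqr_ge0//.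
  by rewrite pair_big in h.
rewrite /xy mulr_suml; under [leRHS]eq_bigr do rewrite mulr_sumr.
by rewrite pair_big/= le_eqVlt; apply/orP; left; apply/eqP; apply: eq_bigr => ij _; rewrite exprMn.
Qed.

Hypothesis n0 : (0 < n)%N.
Let n0R : (0 : R) < n%:R. Proof. by rewrite ltr0n. Qed.

(* A linear form only increases when each coordinate is rounded in the direction of its coefficient. *)
Lemma grid_round (f t : 'I_n -> R) : \sum_i t i ^+ 2 <= n%:R ->
  exists2 k : grid n, grid_ball k & \sum_i f i * t i <= \sum_i f i * grid_val R k i.
Proof.
move=> tn.
pose z i : int := if 0 <= f i then - Num.floor (- t i) else Num.floor (t i).
have fl (a : R) : (Num.floor a)%:~R <= a /\ a < (Num.floor a)%:~R + 1.
  by have /andP[] := floor_itv a; rewrite intrD.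
(* From [z^2 <= 2 t^2 + 2 (z - t)^2] and [|z - t| <= 1]; the sum over [i] gives the [4 * n] of
   [grid_ball]. *)
have zt i : (z i)%:~R ^+ 2 <= 2 * t i ^+ 2 + 2 :> R.
  have : ((z i)%:~R - t i) ^+ 2 <= 1 :> R.
    rewrite /z; case: ifP => _; rewrite ?mulrNz.
      by have [] := fl (- t i); nra.
    by have [] := fl (t i); nra.
  by have := sqr_ge0 ((z i)%:~R - 2 * t i); nra.
have absE i : (`|z i|%N)%:R ^+ 2 = (z i)%:~R ^+ 2 :> R.
  by rewrite pmulrn abszE intr_norm real_normK// num_real.
have tot : (\sum_i `|z i| ^ 2 <= 4 * n)%N.
  rewrite -(ler_nat R) natr_sum.
  apply: (@le_trans _ _ (\sum_i (2 * t i ^+ 2 + 2))).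
    by apply: ler_sum => i _; rewrite natrX absE.
  by rewrite big_split/= -mulr_sumr sumr_const card_ord -[X in _ + X]mulr_natr natrM; lra.
have zb i : (`|z i| < (4 * n).+1)%N.
  rewrite ltnS; apply: leq_trans tot; rewrite (bigD1 i)//=.
  by apply: leq_trans (leq_addr _ _); case: `|z i|%N => // m; rewrite expnS leq_pmulr// expn_gt0.
exists [ffun i => (z i < 0, Ordinal (zb i))].
  by rewrite /grid_ball; under eq_bigr do rewrite ffunE.
apply: ler_sum => i _; rewrite /grid_val ffunE/=.
have -> : (if z i < 0 then - (`|z i|%N)%:R else (`|z i|%N)%:R) = (z i)%:~R :> R.
  case: ifP => zi.
    by rewrite pmulrn abszE ltr0_norm// mulrNz opprK.
  by rewrite pmulrn abszE ger0_norm// leNgt zi.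
rewrite /z; case: ifP => f0.
  by rewrite ler_wpM2l// mulrNz; have [] := fl (- t i); lra.
by rewrite ler_wnM2l//; [move: f0; case: leP => // /ltW|have [] := fl (t i)].
Qed.

(** The form is linear in each argument, so both can be rounded in turn without decreasing it:
    passing to the grid costs no approximation error. Homogeneity reduces to vectors of norm sqrt
    n. *)
Lemma bilinear_le_grid M K :
  (forall k k' : grid n, grid_ball k -> grid_ball k' ->
     \sum_i \sum_j grid_val R k i * grid_val R k' j * M i j <= n%:R * K) ->
  bilinear_le M K.
Proof.
move=> H x y.
have unit (a b : 'I_n -> R) : \sum_i a i ^+ 2 <= n%:R -> \sum_i b i ^+ 2 <= n%:R ->
    \sum_i \sum_j a i * b j * M i j <= n%:R * K.
  move=> an bn.
  have [k kb h] := grid_round (fun i => \sum_j b j * M i j) an.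
  have [k' kb' h'] := grid_round (fun j => \sum_i grid_val R k i * M i j) bn.
  apply: le_trans (H k k' kb kb').
  apply: (@le_trans _ _ (\sum_i (\sum_j b j * M i j) * a i)).
    rewrite le_eqVlt; apply/orP; left; apply/eqP; apply: eq_bigr => i _.
    by rewrite mulr_suml; apply: eq_bigr => j _; ring.
  apply: le_trans h _.
  apply: (@le_trans _ _ (\sum_j (\sum_i grid_val R k i * M i j) * b j)).
    rewrite le_eqVlt; apply/orP; left; apply/eqP.
    under eq_bigr do rewrite mulr_suml; rewrite exchange_big; apply: eq_bigr => j _.
    by rewrite mulr_suml; apply: eq_bigr => i _; ring.
  apply: le_trans h' _; rewrite le_eqVlt; apply/orP; left; apply/eqP.
  under eq_bigr do rewrite mulr_suml; rewrite exchange_big; apply: eq_bigr => i _.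
  by apply: eq_bigr => j _; ring.
have zero (a : 'I_n -> R) : \sum_i a i ^+ 2 = 0 -> forall i, a i = 0.
  move=> /psumr_eq0P a0 i; apply/eqP; rewrite -sqrf_eq0; apply/eqP.
  by apply: a0 => // j _; exact: sqr_ge0.
have s0 (z : 'I_n -> R) : 0 <= \sum_i z i ^+ 2 by apply: sumr_ge0 => i _; exact: sqr_ge0.
set X := \sum_i x i ^+ 2; set Y := \sum_j y j ^+ 2.
have [X0|Xn] := eqVneq X 0.
  rewrite X0 sqrtr0 mulr0 mul0r big1// => i _; rewrite big1// => j _.
  by rewrite (zero _ X0) !mul0r.
have [Y0|Yn] := eqVneq Y 0.
  rewrite Y0 sqrtr0 mulr0 big1// => i _; rewrite big1// => j _.
  by rewrite (zero _ Y0) mulr0 mul0r.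
have X0 : 0 < X by rewrite lt0r Xn s0.
have Y0 : 0 < Y by rewrite lt0r Yn s0.
have sX : 0 < Num.sqrt X by rewrite sqrtr_gt0.
have sY : 0 < Num.sqrt Y by rewrite sqrtr_gt0.
have sn : 0 < Num.sqrt (n%:R : R) by rewrite sqrtr_gt0.
have nE : Num.sqrt (n%:R : R) ^+ 2 = n%:R by rewrite sqr_sqrtr// ltW.
pose a i := Num.sqrt n%:R / Num.sqrt X * x i; pose b i := Num.sqrt n%:R / Num.sqrt Y * y i.
have norm (z : 'I_n -> R) (Z : R) : Z = \sum_i z i ^+ 2 -> 0 < Z ->
    \sum_i (Num.sqrt n%:R / Num.sqrt Z * z i) ^+ 2 <= n%:R.
  move=> ZE Z0; under eq_bigr do rewrite exprMn.
  by rewrite -mulr_sumr -ZE expr_div_n nE (sqr_sqrtr (ltW Z0)) divfK ?gt_eqF.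
have := unit a b (norm x X erefl X0) (norm y Y erefl Y0).
have -> : \sum_i \sum_j a i * b j * M i j =
   n%:R / (Num.sqrt X * Num.sqrt Y) * \sum_i \sum_j x i * y j * M i j.
  rewrite mulr_sumr; apply: eq_bigr => i _; rewrite mulr_sumr; apply: eq_bigr => j _.
  rewrite -[X in _ = X / _ * _]nE /a /b; field.
  by rewrite !gt_eqF.
by rewrite -mulrA ler_pM2l// mulrC ler_pdivrMr ?mulr_gt0// mulrA.
Qed.

End BilinearBound.

(** * Light, heavy and trimmed pairs combined *)

Section TrimmedNoise.
Variables (R : realType) (L n : nat) (w p : 'I_L -> R) (pi : 'I_L * 'I_n * 'I_n -> R).
Variables (gamma r : R).
Hypothesis n0 : (0 < n)%N.
Hypothesis w01 : forall l, 0 <= w l <= 1.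
Hypothesis p0 : forall l, 0 <= p l.
Hypothesis pi01 : forall x, 0 <= pi x <= 1.
Hypothesis pip : forall x, pi x <= p x.1.1.
Hypothesis gamma1 : expR 1 < gamma.
Hypothesis r1 : 1 <= r.

Let mu := \sum_l w l * p l.
Hypothesis mu0 : 0 < mu.
Let d := n%:R * mu.
Let sd := Num.sqrt d.
Let m i j := layer_sum w pi i j.

Let n0R : (0 : R) < n%:R. Proof. by rewrite ltr0n. Qed.
Let d0 : 0 < d. Proof. exact: mulr_gt0. Qed.
Let sd0 : 0 < sd. Proof. by rewrite sqrtr_gt0. Qed.
Let sd2 : sd ^+ 2 = d. Proof. by rewrite sqr_sqrtr// ltW. Qed.

Let m_ge0 i j : 0 <= m i j.
Proof. by apply: layer_sum_ge0 => // x; case/andP: (pi01 x). Qed.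
Let m_le i j : m i j <= mu.
Proof. exact: layer_sum_le. Qed.

(** In order: light pairs, the mean on heavy pairs, the matrix itself on heavy pairs (three terms),
    and the trimmed rows and columns of the mean. *)
Definition noise_cst : R :=
  8 * (r + 13) + 4 + 32 * gamma + 2048 * expR 1 + 2048 * (r + 2) + 4.

Section Fixed.
Variable A : 'I_n -> 'I_n -> R.
Hypothesis A0 : forall i j, 0 <= A i j.
Hypothesis AC : forall i j, A i j = A j i.
Hypothesis disc : forall (S T : {set 'I_n}) (t : R), S != set0 -> T != set0 -> 0 < t ->
  t * \sum_(i in S) \sum_(j in T) A i j <=
  d / n%:R * #|S|%:R * #|T|%:R * (expR t - 1) +
  2 * (r + 2) * (subset_entropy R n #|S| + subset_entropy R n #|T|).
Hypothesis light : forall k k' : grid n, grid_ball k -> grid_ball k' ->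
  \sum_i \sum_j (if `|grid_val R k i * grid_val R k' j| <= 4 * sd
                   then grid_val R k i * grid_val R k' j else 0) * (A i j - m i j) <=
  8 * (r + 13) * n%:R * sd.
Let J := [set i | gamma * n%:R * mu < \sum_j A i j].
Hypothesis cardI : #|J|%:R <= 4 / mu.

Let gamma0 : 0 <= gamma.
Proof. by apply: ltW; apply: lt_trans gamma1; exact: expR_gt0. Qed.

(** Setting the grid vectors to 0 on [J] performs the trimming, keeps them in the ball and bounds
    the degrees on their supports; the light and heavy estimates for the untrimmed [A] then
    apply. *)
Let bilinear_kept : bilinear_le (fun i j => if (i \in J) || (j \in J) then 0 else A i j - m i j)
  ((8 * (r + 13) + 4 + 32 * gamma + 2048 * expR 1 + 2048 * (r + 2)) * sd).
Proof.
apply: bilinear_le_grid => // k0 k0' kb0 kb0'.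
pose cut (k : grid n) : grid n := [ffun i => if i \in J then (false, ord0) else k i].
have cutE k i : grid_val R (cut k) i = if i \in J then 0 else grid_val R k i.
  by rewrite /grid_val ffunE; case: (i \in J) => /=; rewrite ?mulr0n.
have cut_ball k : grid_ball k -> grid_ball (cut k).
  move=> kb; apply: leq_trans kb; apply: leq_sum => i _; rewrite ffunE.
  by case: ifP => // _; rewrite exp0n.
have cut_deg k i : (0 < (cut k i).2)%N -> \sum_j A i j <= gamma * d.
  by rewrite ffunE; case: ifP => //; rewrite inE -mulrA => /negbT; rewrite -leNgt.
set k := cut k0; set k' := cut k0'.
have kb : grid_ball k by exact: cut_ball.
have kb' : grid_ball k' by exact: cut_ball.
have nkb (h : grid n) : grid_ball h -> \sum_i ((h i).2 : nat)%:R ^+ 2 <= 4 * n%:R :> R.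
  move=> hb; suff -> : \sum_i ((h i).2 : nat)%:R ^+ 2 = \sum_i grid_val R h i ^+ 2 by exact: grid_ball_sum.
  by apply: eq_bigr => i _; rewrite grid_val_sqr natrX.
have P0 : 0 <= 2 * (r + 2) by rewrite mulr_ge0//; move: r1; lra.
have hv := heavy_sum n0 d0 P0 A0 AC disc gamma0 (nkb k kb) (nkb k' kb') (cut_deg k0) (cut_deg k0').
have lt := light kb kb'.
pose F i j := grid_val R k i * grid_val R k' j.
pose a i j : R := (k i).2%:R * (k' j).2%:R.
have absF i j : `|F i j| = a i j.
  rewrite /F /a normrM /grid_val; case: ifP => _; case: ifP => _;
  by rewrite ?normrN !normr_nat.
have a0 i j : 0 <= a i j by rewrite -absF.
have F2 i j : F i j ^+ 2 = a i j ^+ 2 by rewrite -absF real_normK// num_real.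
(* On a heavy pair [a i j / (4 * sd)] exceeds 1, so the mean costs at most [q * a i j ^+ 2] there;
   these sum to at most [4 * n * sd]. *)
pose q : R := mu / (4 * sd).
have q0 : 0 <= q by rewrite divr_ge0 ?mulr_ge0// ltW.
have pt i j : grid_val R k0 i * grid_val R k0' j * (if (i \in J) || (j \in J) then 0 else A i j - m i j) <=
   (if `|F i j| <= 4 * sd then F i j else 0) * (A i j - m i j) +
   (if 4 * sd < a i j then a i j else 0) * A i j + q * (F i j ^+ 2).
  have -> : grid_val R k0 i * grid_val R k0' j * (if (i \in J) || (j \in J) then 0 else A i j - m i j) =
    F i j * (A i j - m i j).
    rewrite /F !cutE; case: (i \in J) => /=; first by rewrite mulr0 !mul0r.
    by case: (j \in J) => /=; rewrite ?mulr0 ?mul0r.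
  rewrite absF; case: leP => h.
    by rewrite mul0r addr0 lerDl mulr_ge0// sqr_ge0.
  rewrite mul0r add0r F2.
  have h1 : F i j * A i j <= a i j * A i j by rewrite ler_wpM2r// -absF ler_norm.
  have h2 : - F i j * m i j <= a i j * m i j.
    by rewrite ler_wpM2r// -absF -normrN ler_norm.
  have h3 : a i j * m i j <= a i j * mu by rewrite ler_wpM2l.
  have h4 : a i j * mu <= q * a i j ^+ 2.
    have -> : q * a i j ^+ 2 = a i j * mu * (a i j / (4 * sd)).
      by rewrite /q; field; rewrite gt_eqF.
    rewrite ler_peMr ?mulr_ge0 ?(ltW mu0)// ler_pdivlMr ?mulr_gt0// mul1r.
    exact: ltW.
  lra.
apply: (@le_trans _ _ (\sum_i \sum_j
   ((if `|F i j| <= 4 * sd then F i j else 0) * (A i j - m i j) +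
    (if 4 * sd < a i j then a i j else 0) * A i j + q * (F i j ^+ 2)))).
  by apply: ler_sum => i _; apply: ler_sum => j _; exact: pt.
have -> : \sum_i \sum_j ((if `|F i j| <= 4 * sd then F i j else 0) * (A i j - m i j) +
    (if 4 * sd < a i j then a i j else 0) * A i j + q * (F i j ^+ 2)) =
  \sum_i \sum_j (if `|F i j| <= 4 * sd then F i j else 0) * (A i j - m i j) +
  \sum_i \sum_j (if 4 * sd < a i j then a i j else 0) * A i j +
  q * (\sum_i \sum_j F i j ^+ 2).
  rewrite mulr_sumr -!big_split/=; apply: eq_bigr => i _.
  by rewrite mulr_sumr -!big_split.
have FF : \sum_i \sum_j F i j ^+ 2 <= (4 * n%:R) * (4 * n%:R).
  have -> : \sum_i \sum_j F i j ^+ 2 =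
      (\sum_i grid_val R k i ^+ 2) * (\sum_j grid_val R k' j ^+ 2).
    rewrite mulr_suml; apply: eq_bigr => i _; rewrite mulr_sumr.
    by apply: eq_bigr => j _; rewrite /F exprMn.
  by apply: ler_pM; rewrite ?grid_ball_sum// sumr_ge0// => i _; exact: sqr_ge0.
have qF := ler_wpM2l q0 FF.
have qE : q * (4 * n%:R * (4 * n%:R)) = 4 * n%:R * sd.
  have -> : 4 * n%:R * sd = 4 * n%:R * sd ^+ 2 / sd by field; rewrite gt_eqF.
  by rewrite sd2 /q /d; field; rewrite gt_eqF.
rewrite qE in qF.
have -> : n%:R * ((8 * (r + 13) + 4 + 32 * gamma + 2048 * expR 1 + 2048 * (r + 2)) * sd) =
  8 * (r + 13) * n%:R * sd + n%:R * sd * (32 * gamma + 2048 * expR 1 + 1024 * (2 * (r + 2))) +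
  4 * n%:R * sd by ring.
exact: lerD (lerD lt hv) qF.
Qed.

Let sum_abs_le (S : {set 'I_n}) (x : 'I_n -> R) :
  \sum_(i in S) `|x i| <= Num.sqrt #|S|%:R * Num.sqrt (\sum_i x i ^+ 2).
Proof.
have s0 : 0 <= \sum_i x i ^+ 2 by apply: sumr_ge0 => i _; exact: sqr_ge0.
rewrite -sqrtrM ?ler0n//; apply: le_trans (ler_norm _) _; rewrite -sqrtr_sqr ler_wsqrtr//.
have := cauchy_schwarz (mem S) (fun=> 1) (fun i => `|x i|).
under eq_bigr do rewrite mul1r.
move=> /le_trans; apply; rewrite sumr_const expr1n ler_wpM2l ?ler0n//.
rewrite [leLHS]big_mkcond/=; apply: ler_sum => i _.
by case: ifP => _; rewrite ?sqr_ge0// real_normK// num_real.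
Qed.

(** The entries are at most [mu] in absolute value and live on the rows and columns of [J]: the norm
    is at most [2 * mu * sqrt (#|J| * n)], and [#|J| <= 4 / mu]. *)
Let bilinear_cut : bilinear_le (fun i j => if (i \in J) || (j \in J) then - m i j else 0) (4 * sd).
Proof.
move=> x y.
pose X := Num.sqrt (\sum_i x i ^+ 2); pose Y := Num.sqrt (\sum_j y j ^+ 2).
apply: (@le_trans _ _ (mu * ((\sum_(i in J) `|x i|) * (\sum_(j in setT) `|y j|) +
   (\sum_(i in setT) `|x i|) * (\sum_(j in J) `|y j|)))).
  have E (M : R) : M * ((\sum_(i in J) `|x i|) * (\sum_(j in setT) `|y j|) +
       (\sum_(i in setT) `|x i|) * (\sum_(j in J) `|y j|)) =
     \sum_i \sum_j M * ((if i \in J then `|x i| else 0) * `|y j| + `|x i| * (if j \in J then `|y j| else 0)).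
    under [\sum_(i in setT) _]eq_bigl do rewrite inE.
    under [\sum_(j in setT) _]eq_bigl do rewrite inE.
    rewrite [\sum_(i in J) `|x i|]big_mkcond [\sum_(j in J) `|y j|]big_mkcond /=.
    rewrite mulrDr !mulr_suml !mulr_sumr -big_split; apply: eq_bigr => i _ /=.
    by rewrite !mulr_sumr -big_split; apply: eq_bigr => j _ /=; ring.
  rewrite E; apply: ler_sum => i _; apply: ler_sum => j _.
  have key : x i * y j * - m i j <= mu * (`|x i| * `|y j|).
    rewrite mulrN -mulNr mulrC -normrM -normrN.
    apply: le_trans (ler_wpM2l (m_ge0 i j) (ler_norm _)) _.
    by rewrite ler_wpM2r.
  have xy0 : 0 <= `|x i| * `|y j| by rewrite mulr_ge0.
  have muxy : 0 <= mu * (`|x i| * `|y j|) by rewrite mulr_ge0// ltW.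
  by case: (i \in J); case: (j \in J) => /=;
    rewrite ?mul0r ?mulr0 ?addr0 ?add0r ?mulrDr ?mulr0//; lra.
have hI := sum_abs_le J; have hT := sum_abs_le setT; rewrite cardsT card_ord in hT.
have n1 (S : {set 'I_n}) (z : 'I_n -> R) : 0 <= \sum_(i in S) `|z i| by apply: sumr_ge0.
have t1 := ler_pM (n1 _ _) (n1 _ _) (hI x) (hT y).
have t2 := ler_pM (n1 _ _) (n1 _ _) (hT x) (hI y).
apply: le_trans (ler_wpM2l (ltW mu0) (lerD t1 t2)) _; rewrite -/X -/Y.
have -> : mu * (Num.sqrt #|J|%:R * X * (Num.sqrt n%:R * Y) + Num.sqrt n%:R * X * (Num.sqrt #|J|%:R * Y)) =
  2 * mu * (Num.sqrt #|J|%:R * Num.sqrt n%:R) * X * Y by ring.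
rewrite !ler_wpM2r ?sqrtr_ge0// -sqrtrM ?ler0n//.
apply: (@le_trans _ _ (2 * mu * (2 * Num.sqrt (n%:R / mu)))).
  rewrite ler_wpM2l ?mulr_ge0 ?(ltW mu0)//.
  have -> : 2 = Num.sqrt 4 :> R.
    by rewrite -[LHS]ger0_norm// -sqrtr_sqr; congr Num.sqrt; ring.
  rewrite -sqrtrM// ler_wsqrtr//.
  have -> : 4 * (n%:R / mu) = 4 / mu * n%:R by rewrite mulrCA mulrC.
  by rewrite ler_wpM2r.
have -> : n%:R / mu = (sd / mu) ^+ 2 by rewrite expr_div_n sd2 /d; field; rewrite gt_eqF.
rewrite sqrtr_sqr ger0_norm ?divr_ge0 ?(ltW mu0) ?(ltW sd0)//.
by rewrite le_eqVlt; apply/orP; left; apply/eqP; field; rewrite gt_eqF.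
Qed.

Lemma trimmed_noise_bound :
  bilinear_le (fun i j => (if (i \in J) || (j \in J) then 0 else A i j) - m i j) (noise_cst * sd).
Proof.
rewrite /noise_cst mulrDl; have := bilinear_leD bilinear_kept bilinear_cut.
by apply: bilinear_le_ext => i j; case: ifP => _; rewrite ?add0r ?addr0 ?sub0r.
Qed.

End Fixed.

Lemma trimmed_noise_pr :
  bern_pr pi (fun e => let A := layer_sum w (fun x => (e x)%:R) in
     let J := [set i | gamma * n%:R * mu < \sum_j A i j] in
     ~ bilinear_le (fun i j => (if (i \in J) || (j \in J) then 0 else A i j) - m i j)
         (noise_cst * sd)) <=
  2 * n%:R `^ (- r) + (2 : R) ^- n.
Proof.
have h1 := light_pr n0 w01 p0 pi01 pip mu0 r1.
have h2 := discrepancy_pr n0 w01 p0 pi01 pip r1.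
have h3 := trim_card_pr n0 w01 p0 pi01 pip mu0 gamma1.
have -> : 2 * n%:R `^ (- r) + (2 : R) ^- n = n%:R `^ (- r) + n%:R `^ (- r) + 2 ^- n by ring.
apply: le_trans (lerD (lerD h1 h2) h3); rewrite -/mu.
apply: le_trans (lerD (bern_pr_or pi01 _ _) (lexx _)).
apply: le_trans (bern_pr_or pi01 _ _).
apply: bern_pr_sub => // e; apply: contra_notP => /not_orP[/not_orP[H1 H2] H3].
apply: trimmed_noise_bound.
- by move=> i j; apply: layer_sum_ge0 => // x; exact: ler0n.
- by move=> i j; exact: layer_sumC.
- move=> S T t S0 T0 t0; rewrite leNgt; apply/negP => lt; apply: H2.
  exists (S, T); first by rewrite S0 T0.
  exists t => //; apply: le_lt_trans lt => /=.
  by rewrite /d (mulrC n%:R) mulfK ?gt_eqF.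
- move=> k k' kb kb'; rewrite leNgt; apply/negP => lt; apply: H1.
  by exists (k, k'); [rewrite kb kb'|].
- by rewrite leNgt; apply/negP => /ltW lt; exact: H3.
Qed.

End TrimmedNoise.

(** * Label fluctuations *)

Section ColumnTail.
Variables (R : realType) (L : nat) (rho : R) (c : 'I_L -> R).
Hypothesis rho01 : 0 <= rho <= 1.
Hypothesis c1 : forall l, `|c l| <= 1.
Let lam := L%:R * rho.
Let rho0 : 0 <= rho. Proof. by case/andP: rho01. Qed.
Let lam0 : 0 <= lam. Proof. by rewrite mulr_ge0. Qed.

Definition centered_sum (h : {ffun 'I_L -> bool}) : R := \sum_l c l * ((h l)%:R - rho).

Local Notation E := (bern_mean (fun=> rho)).

Let mgf (t x : R) : (forall l, expR (t * c l) - 1 - t * c l <= x) ->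
  E (fun h => expR (t * centered_sum h)) <= expR (lam * x).
Proof.
move=> tx.
have -> : E (fun h => expR (t * centered_sum h)) =
    E (fun h => expR (\sum_l (t * c l) * ((h l)%:R - rho))).
  congr bern_mean; apply/funext => h; congr expR.
  by rewrite mulr_sumr; apply: eq_bigr => l _; rewrite mulrA.
apply: le_trans (bern_mgf_centered_le (fun=> rho01) _) _; rewrite ler_expR.
apply: (@le_trans _ _ (\sum_(l < L) rho * x)).
  by apply: ler_sum => l _; rewrite ler_wpM2l.
by rewrite sumr_const card_ord -[leLHS]mulr_natl mulrA.
Qed.

Lemma column_mgf_small (t : R) : `|t| <= 1 ->
  E (fun h => expR (t * centered_sum h)) <= expR (lam * (2 * t ^+ 2)).
Proof.
move=> t1; apply: mgf => l.
have tc : `|t * c l| <= 1 by rewrite normrM -[leRHS]mulr1 ler_pM.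
have := expR_le_quadratic (le_trans (ler_norm _) tc).
have c2 : c l ^+ 2 <= 1 by rewrite -real_normK ?num_real// expr_le1.
by have := ler_wpM2l (sqr_ge0 t) c2; rewrite exprMn; lra.
Qed.

Lemma column_mgf_large (t : R) :
  E (fun h => expR (t * centered_sum h)) <= expR (lam * (2 * expR `|t|)).
Proof.
apply: mgf => l.
have tc : `|t * c l| <= `|t| by rewrite normrM ler_piMr.
have h1 : expR (t * c l) <= expR `|t| by rewrite ler_expR (le_trans (ler_norm _)).
have h2 : - (t * c l) <= `|t| by rewrite (le_trans (ler_norm _))// normrN.
have := expR_ge1Dx `|t|; lra.
Qed.

(** [sqr_le_cosh] with [t ^+ 2 = 1 / (2 * (lam + 1))], which makes the exponent [z] at most 1 and
    [expR z - 1] at most [3 * z]. The bound stays proportional to [lam] for small [lam]. *)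
Lemma column_second_moment : E (fun h => centered_sum h ^+ 2) <= 48 * lam.
Proof.
pose M := 2 * (lam + 1).
have lam0' := lam0.
have M2 : 2 <= M by rewrite /M; lra.
have M0 : 0 < M by lra.
pose t := Num.sqrt M^-1.
have t2 : t ^+ 2 = M^-1 by rewrite sqr_sqrtr// invr_ge0 ltW.
have t0 : 0 < t by rewrite sqrtr_gt0 invr_gt0.
have t1 : `|t| <= 1.
  rewrite ger0_norm ?(ltW t0)// -[leRHS]sqrtr1 ler_wsqrtr// invf_le1//; lra.
pose z := lam * (2 * t ^+ 2).
have z1 : z <= 1.
  by rewrite /z t2 mulrA ler_pdivrMr// mul1r /M; lra.
have z0 : 0 <= z by rewrite mulr_ge0// mulr_ge0// sqr_ge0.
have h1 := column_mgf_small t1.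
have h2 := @column_mgf_small (- t); rewrite normrN sqrrN in h2; have {}h2 := h2 t1.
rewrite -/z in h1 h2.
have ez : expR z - 1 <= 3 * z.
  by have := expR_le_quadratic z1; have := ler_wpM2l z0 z1; rewrite -expr2; lra.
have step : E (fun h => centered_sum h ^+ 2) <=
    4 * M * (E (fun h => expR (t * centered_sum h)) + E (fun h => expR (- t * centered_sum h)) - 2).
  have -> : 4 * M * (E (fun h => expR (t * centered_sum h)) +
      E (fun h => expR (- t * centered_sum h)) - 2) =
    E (fun h => 4 * M * (expR (t * centered_sum h) + expR (- t * centered_sum h) + - 2)).
    by rewrite bern_meanZ !bern_meanD bern_mean_cst.
  apply: bern_mean_le => // h; have := sqr_le_cosh (t * centered_sum h).
  rewrite exprMn t2 => H; have := ler_wpM2l (ltW M0) H.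
  by rewrite mulrA mulfV ?gt_eqF// mul1r mulNr; lra.
apply: le_trans step _.
have M4 : 0 <= 4 * M by lra.
apply: le_trans (ler_wpM2l M4 (_ : _ <= 6 * z)) _; first lra.
by rewrite /z t2 le_eqVlt; apply/orP; left; apply/eqP; field; rewrite gt_eqF.
Qed.

Lemma column_tail (B t x : R) : 0 <= B -> 0 < t ->
  E (fun h => expR (t * centered_sum h)) <= expR x ->
  E (fun h => expR (- t * centered_sum h)) <= expR x ->
  bern_pr (fun=> rho) (fun h => B ^+ 2 < centered_sum h ^+ 2) <= 2 * expR (x - t * B).
Proof.
move=> B0 t0 h1 h2.
apply: (@le_trans _ _ (bern_pr (fun=> rho) (fun h => t * B < t * centered_sum h \/
   t * B < - t * centered_sum h))).
  apply: bern_pr_sub => // h; rewrite -[ltRHS]real_normK ?num_real//.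
  rewrite ltr_pXn2r ?nnegrE// ltr_normr => /orP[] H; [left|right];
  by rewrite ?mulNr -?mulrN ltr_pM2l.
apply: le_trans (bern_pr_or _ _ _) _ => //.
have ch (s : R) : E (fun h => expR (s * centered_sum h)) <= expR x ->
    bern_pr (fun=> rho) (fun h => t * B < s * centered_sum h) <= expR (x - t * B).
  move=> hs; apply: le_trans (bern_chernoff (t := t * B) (fun=> rho01)
    (h := fun h => s * centered_sum h) _) _; first by move=> e /ltW.
  by rewrite addrC expRD ler_wpM2l ?expR_ge0.
by have := ch _ h1; have := ch _ h2; lra.
Qed.

End ColumnTail.

(** * Sums of squares over independent columns *)

Section ColumnSums.
Variables (R : realType) (L n : nat) (rho : R) (c : 'I_L -> R).
Hypothesis rho01 : 0 <= rho <= 1.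
Hypothesis c1 : forall l, `|c l| <= 1.
Let lam := L%:R * rho.
Let rho0 : 0 <= rho. Proof. by case/andP: rho01. Qed.
Let lam0 : 0 <= lam. Proof. by rewrite mulr_ge0. Qed.

Local Notation col f j := [ffun l => f (l, j)].
Local Notation G := (centered_sum rho c).

(* The squares have no useful exponential moment, so they are capped at B. *)
Lemma columns_truncated (B eps K : R) : 0 < B ->
  bern_pr (fun=> rho) (fun h => B < G h ^+ 2) <= eps ->
  bern_pr (fun=> rho) (fun f : {ffun 'I_L * 'I_n -> bool} => K < \sum_j G (col f j) ^+ 2) <=
  n%:R * eps + expR ((144 * n%:R * lam - K) / B).
Proof.
move=> B0 tail.
pose Y h := Num.min (G h ^+ 2) B / B.
have Y0 h : 0 <= Y h by rewrite divr_ge0 ?(ltW B0)// le_min sqr_ge0 ltW.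
have Y1 h : Y h <= 1 by rewrite ler_pdivrMr// mul1r ge_min lexx orbT.
apply: (@le_trans _ _ (bern_pr (fun=> rho) (fun f : {ffun 'I_L * 'I_n -> bool} =>
   (exists2 j, xpredT j & B < G (col f j) ^+ 2) \/ K / B <= \sum_j Y (col f j)))).
  apply: bern_pr_sub => // f KG.
  have [ex|nex] := pselect (exists2 j, xpredT j & B < G (col f j) ^+ 2); [by left|right].
  rewrite -mulr_suml ler_pM2r ?invr_gt0//; apply: le_trans (ltW KG) _.
  apply: ler_sum => j _; rewrite le_min lexx /= leNgt; apply/negP => H.
  by apply: nex; exists j.
apply: le_trans (bern_pr_or _ _ _) _ => //; apply: lerD.
  apply: le_trans (bern_pr_union _ _ _) _ => //=.
  apply: (@le_trans _ _ (\sum_(j < n) eps)); last by rewrite sumr_const card_ord -[leLHS]mulr_natl.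
  apply: ler_sum => j _; apply: le_trans tail.
  (* An event on one column is a product over columns with all other factors 1, so independence
     reduces it to that column. *)
  pose F (b : 'I_n) (h : {ffun 'I_L -> bool}) : R := if b == j then (`[< B < G h ^+ 2 >])%:R else 1.
  have -> : bern_pr (fun=> rho) (fun f : {ffun 'I_L * 'I_n -> bool} => B < G (col f j) ^+ 2) =
      bern_mean (fun=> rho) (fun f : {ffun 'I_L * 'I_n -> bool} => \prod_b F b (col f b)).
    congr bern_mean; apply/funext => f; rewrite (bigD1 j)//= /F eqxx big1 ?mulr1//.
    by move=> b /negbTE ->.
  rewrite bern_mean_columns (bigD1 j)//= big1 ?mulr1; last first.
    by move=> b /negbTE bj; rewrite /F bj bern_mean_cst.
  by rewrite /F eqxx.
apply: le_trans (bern_chernoff (t := K / B) _ (h := fun f => \sum_j Y (col f j)) _) _ => //.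
have -> : (144 * n%:R * lam - K) / B = - (K / B) + 144 * lam / B *+ n.
  by rewrite -(mulr_natl (144 * lam / B)); ring.
rewrite expRD ler_wpM2l ?expR_ge0//.
have -> : bern_mean (fun=> rho) (fun f : {ffun 'I_L * 'I_n -> bool} => expR (\sum_j Y (col f j))) =
   bern_mean (fun=> rho) (fun f : {ffun 'I_L * 'I_n -> bool} => \prod_j (fun _ h => expR (Y h)) j (col f j)).
  by congr bern_mean; apply/funext => f; rewrite expR_sum.
rewrite (bern_mean_columns _ (fun (_ : 'I_n) h => expR (Y h))) prodr_const card_ord.
rewrite -mulr_natr expRM_natr lerXn2r ?nnegrE ?expR_ge0//.
  by apply: sumr_ge0 => h _; rewrite mulr_ge0 ?expR_ge0// bern_weight_ge0.
apply: le_trans (expR_ge1Dx _).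
(* As [Y] lies in [0, 1], [expR Y <= 1 + 3 * Y]; with the second moment this gives 144 = 3 times
   48. *)
apply: (@le_trans _ _ (bern_mean (fun=> rho) (fun h => 1 + 3 / B * G h ^+ 2))).
  apply: bern_mean_le => // h.
  have := expR_le_quadratic (Y1 h); have := ler_wpM2l (Y0 h) (Y1 h); rewrite -expr2.
  have : 3 * Y h <= 3 / B * G h ^+ 2.
    rewrite -mulrA ler_wpM2l// mulrC ler_wpM2r ?invr_ge0 ?(ltW B0)//.
    by rewrite ge_min lexx.
  lra.
rewrite bern_meanD bern_mean_cst// lerD2l bern_meanZ.
have B3 : 0 <= 3 / B by rewrite divr_ge0// ltW.
apply: le_trans (ler_wpM2l B3 (column_second_moment rho01 c1)) _.
by rewrite -/lam le_eqVlt; apply/orP; left; apply/eqP; field; rewrite gt_eqF.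
Qed.

(** The 144 comes from the mean of the capped squares, the cubic term from the deviation
    [r * B * ln n] for a cap [B]. *)
Definition column_cst (r : R) : R := 144 + 432 * (r + 1) ^+ 3.

Lemma columns_pr (r : R) : (1 < n)%N -> 1 <= r ->
  bern_pr (fun=> rho) (fun f : {ffun 'I_L * 'I_n -> bool} =>
    column_cst r * (n%:R * lam + ln n%:R) < \sum_j G (col f j) ^+ 2) <=
  33 * n%:R `^ (- r).
Proof.
move=> n1 r1.
have n0 : (0 : R) < n%:R by rewrite ltr0n ltnW.
set l := ln (n%:R : R).
have l0 : 0 < l by rewrite ln_gt0// ltr1n.
have nE : n%:R = expR l by rewrite lnK ?posrE.
have powE a : n%:R `^ a = expR (a * l) by rewrite powR_expR.
pose s := Num.sqrt (n%:R : R).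
have s2 : s ^+ 2 = n%:R by rewrite sqr_sqrtr// ltW.
have s0 : 0 < s by rewrite sqrtr_gt0.
have sE : s = expR (l / 2).
  rewrite /s nE; have -> : expR l = expR (l / 2) ^+ 2 by rewrite expr2 -expRD; congr expR; field.
  by rewrite sqrtr_sqr ger0_norm// expR_ge0.
have e4 : expR (1 : R) <= 4 by have := @expR_le_quadratic R 1 (lexx _); lra.
(* One column must exceed the cap with probability of order [n ^ (- (r + 1))], to survive the union
   over [n] columns, while a deviation [r * B * ln n] must remain affordable. *)
suff [B [B0 [tail cond]]] : exists B, 0 < B /\
    (bern_pr (fun=> rho) (fun h => B < G h ^+ 2) <= 32 * expR (- ((r + 1) * l)) /\
     r * B * l <= 432 * (r + 1) ^+ 3 * (n%:R * lam + l)).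
  apply: le_trans (columns_truncated _ B0 tail) _.
  have -> : n%:R * (32 * expR (- ((r + 1) * l))) = 32 * expR (- r * l).
    by rewrite {1}nE mulrCA -expRD; congr (_ * expR _); ring.
  rewrite powE; have -> : 33 * expR (- r * l) = 32 * expR (- r * l) + expR (- r * l) by ring.
  rewrite lerD2l ler_expR ler_pdivrMr// /column_cst.
  by have := mulr_ge0 (ltW l0) (ltW l0); lra.
(* For lam <= n ^ (- 1 / 2) a constant cap suffices; otherwise it is of order max(lam, 1) ln^2 n,
   which is affordable because n lam is then at least sqrt n * max(lam, 1). *)
have [sparse|dense] := leP (lam * s) 1.
  pose b := 2 * (r + 2); have b0 : 0 < b by rewrite /b; lra.
  exists (b ^+ 2); split; first by rewrite exprn_gt0.
  split.
    have l2 : 0 < l / 2 by rewrite divr_gt0.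
    (* At [|t| = ln n / 2] the exponent of [column_mgf_large] is [2 * lam * sqrt n], at most 2 in
       the sparse case. *)
    have small t : `|t| = l / 2 ->
        bern_mean (fun=> rho) (fun h => expR (t * G h)) <= expR 2.
      move=> tl; apply: le_trans (column_mgf_large rho01 c1 t) _.
      by rewrite ler_expR tl -sE -/lam; lra.
    have tl := small (l / 2) (ger0_norm (ltW l2)).
    have tl' := small (- (l / 2)); rewrite normrN in tl'.
    have {}tl' := tl' (ger0_norm (ltW l2)).
    apply: le_trans (column_tail rho01 (ltW b0) l2 tl tl') _.
    have -> : 2 - l / 2 * b = 1 + (1 + (- ((r + 1) * l) - l)) by rewrite /b; field.
    rewrite !expRD; have E0 := expR_ge0 (- ((r + 1) * l)).
    have El : expR (- l) <= 1 by rewrite expR_le1; lra.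
    have e0 := expR_ge0 (1 : R).
    have h1 := ler_wpM2l E0 El.
    have h2 := ler_pM e0 e0 e4 e4.
    have h3 := ler_pM (mulr_ge0 e0 e0) (mulr_ge0 E0 (expR_ge0 (- l))) h2 h1.
    lra.
  have h1 : r * b ^+ 2 <= 432 * (r + 1) ^+ 3.
    have r3 : 0 <= (r + 1) ^+ 2 by exact: sqr_ge0.
    have : b ^+ 2 <= 16 * (r + 1) ^+ 2.
      by rewrite /b; nra.
    move=> hb; have := ler_wpM2l (le_trans ler01 r1) hb.
    have : 0 <= (r + 1) * (r + 1) ^+ 2 by rewrite mulr_ge0//; lra.
    rewrite (exprS (r + 1) 2) => h2 h3.
    have : r * (r + 1) ^+ 2 <= (r + 1) * (r + 1) ^+ 2 by rewrite ler_wpM2r//; lra.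
    lra.
  have c0 : 0 <= 432 * (r + 1) ^+ 3 by apply: le_trans h1; rewrite mulr_ge0 ?sqr_ge0//; lra.
  have := ler_wpM2r (ltW l0) h1.
  have := mulr_ge0 c0 (mulr_ge0 (ltW n0) lam0); lra.
pose La := 2 * Num.max lam 1.
have La2 : 2 <= La by rewrite /La ler_peMr// le_max lexx orbT.
have Lal : 2 * lam <= La by rewrite /La ler_pM2l// le_max lexx.
have La0 : 0 < La by lra.
pose b := Num.sqrt La * ((r + 1) * l).
have sLa : 0 < Num.sqrt La by rewrite sqrtr_gt0.
have rl0 : 0 < (r + 1) * l by rewrite mulr_gt0//; lra.
have b0 : 0 < b by rewrite mulr_gt0.
exists (b ^+ 2); split; first by rewrite exprn_gt0.
split.
  pose t := (Num.sqrt La)^-1.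
  have t0 : 0 < t by rewrite invr_gt0.
  have t2 : t ^+ 2 = La^-1 by rewrite exprVn sqr_sqrtr// ltW.
  have t1 : `|t| <= 1.
    rewrite ger0_norm ?(ltW t0)// invf_le1// -[leLHS]sqrtr1 ler_wsqrtr//; lra.
  have small t' : `|t'| <= 1 -> t' ^+ 2 = La^-1 ->
      bern_mean (fun=> rho) (fun h => expR (t' * G h)) <= expR 1.
    move=> t1' t2'; apply: le_trans (column_mgf_small rho01 c1 t1') _.
    by rewrite ler_expR t2' -/lam mulrA ler_pdivrMr// mul1r; lra.
  have tl := small t t1 t2.
  have tl' := small (- t); rewrite normrN sqrrN in tl'.
  have {}tl' := tl' t1 t2.
  apply: le_trans (column_tail rho01 (ltW b0) t0 tl tl') _.
  have -> : t * b = (r + 1) * l by rewrite /t /b mulKf// gt_eqF.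
  rewrite expRD; have := expR_ge0 (- ((r + 1) * l)) => E0.
  by have := ler_wpM2r E0 e4; lra.
have bE : b ^+ 2 = La * ((r + 1) ^+ 2 * l ^+ 2).
  by rewrite /b exprMn (sqr_sqrtr (ltW La0)) exprMn.
(* From [x <= expR x] at [x = l / 6], cubed. *)
have l3 : l ^+ 3 <= 216 * s.
  have h : l / 6 <= expR (l / 6) by have := expR_ge1Dx (l / 6); lra.
  have -> : s = expR (l / 6) ^+ 3.
    by rewrite sE -expRM_natr; congr expR; field.
  have -> : l ^+ 3 = 216 * (l / 6) ^+ 3 by field.
  rewrite ler_wpM2l// lerXn2r ?nnegrE ?expR_ge0//.
  by rewrite divr_ge0// ltW.
have sLa2 : s * La <= 2 * (n%:R * lam).
  have s1 : 1 <= s.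
    by rewrite sE -[leLHS]expR0 ler_expR divr_ge0// ltW.
  rewrite /La -s2; case: (leP lam 1) => hl.
    by rewrite mulr1; have := ler_wpM2l (ltW s0) (ltW dense); lra.
  have : s * lam <= s ^+ 2 * lam by rewrite ler_wpM2r// expr2 ler_peMr// ltW.
  lra.
have r3 : 0 <= (r + 1) ^+ 3 by rewrite exprn_ge0//; lra.
rewrite bE.
have -> : r * (La * ((r + 1) ^+ 2 * l ^+ 2)) * l = r * (r + 1) ^+ 2 * La * l ^+ 3 by ring.
have q2 : 0 <= (r + 1) ^+ 2 by exact: sqr_ge0.
have hr : r * (r + 1) ^+ 2 <= (r + 1) ^+ 3.
  by rewrite (exprS _ 2) ler_wpM2r//; lra.
apply: (@le_trans _ _ ((r + 1) ^+ 3 * La * (216 * s))).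
  have l30 : 0 <= l ^+ 3 by rewrite exprn_ge0// ltW.
  apply: ler_pM => //; first by rewrite mulr_ge0 ?(ltW La0)// mulr_ge0//; lra.
  by rewrite ler_wpM2r// ltW.
have := ler_wpM2l r3 sLa2; have := mulr_ge0 r3 (ltW l0); lra.
Qed.

End ColumnSums.

Section LabelNoise.
Variables (R : realType) (L n : nat) (rho r : R) (b : 'I_L -> R).
Hypothesis rho01 : 0 <= rho <= 1.
Hypothesis b1 : forall l, `|b l| <= 1.
Hypothesis n1 : (1 < n)%N.
Hypothesis r1 : 1 <= r.
Let lam := L%:R * rho.
Implicit Types f : {ffun 'I_L * 'I_n -> bool}.

Definition label_bound : R := column_cst (r + 8) * (n%:R * lam + ln n%:R).

Definition flip_dev f l i : R := (f (l, i))%:R - rho.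

Definition label_lin f i : R := \sum_l b l * flip_dev f l i.

Definition label_quad f i j : R := \sum_l b l * flip_dev f l i * flip_dev f l j.

(** Given the flips of node [i], row [i] of the quadratic form is linear in the other flips, with
    coefficients still at most 1. Passing from [r] to [r + 8] pays for the factor 33 and the [n + 1]
    events, as [n >= 2]. *)
Lemma label_noise_pr :
  bern_pr (fun=> rho) (fun f => ~ (\sum_i label_lin f i ^+ 2 <= label_bound /\
    forall i, \sum_(j | j != i) label_quad f i j ^+ 2 <= label_bound)) <= n%:R `^ (- r).
Proof.
have r8 : 1 <= r + 8 by have := r1; lra.
have n0 : (0 : R) < n%:R by rewrite ltr0n ltnW.
pose p := 33 * n%:R `^ (- (r + 8)) : R.
have p0 : 0 <= p by rewrite mulr_ge0// powR_ge0.
have P1 : bern_pr (fun=> rho) (fun f => label_bound < \sum_i label_lin f i ^+ 2) <= p.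
  apply: le_trans (columns_pr rho01 b1 n1 r8); apply: bern_pr_sub => // f.
  rewrite /label_bound => /lt_le_trans; apply; rewrite le_eqVlt; apply/orP; left; apply/eqP.
  by apply: eq_bigr => i _; congr (_ ^+ 2); apply: eq_bigr => l _; rewrite ffunE.
have P2 i : bern_pr (fun=> rho)
    (fun f => label_bound < \sum_(j | j != i) label_quad f i j ^+ 2) <= p.
  apply: (@bern_pr_merge _ _ _ _ (fun li : 'I_L * 'I_n => li.2 == i)) => // f.
  pose c l := b l * flip_dev f l i.
  have c1 l : `|c l| <= 1.
    rewrite /c normrM -[leRHS]mulr1; apply: ler_pM => //.
    have /andP[h0 h1] := rho01; rewrite /flip_dev ler_norml.
    by case: (f (l, i)); rewrite /= ?mulr1n ?mulr0n; apply/andP; split; lra.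
  apply: le_trans (columns_pr rho01 c1 n1 r8); apply: bern_pr_sub => // g.
  rewrite /label_bound => /lt_le_trans; apply.
  rewrite [leLHS]big_mkcond/=; apply: ler_sum => j _; case: ifP => [ji|_]; last exact: sqr_ge0.
  rewrite le_eqVlt; apply/orP; left; apply/eqP; congr (_ ^+ 2); apply: eq_bigr => l _.
  by rewrite /c /flip_dev !ffunE/= eqxx (negbTE ji).
apply: (@le_trans _ _ (bern_pr (fun=> rho) (fun f => label_bound < \sum_i label_lin f i ^+ 2 \/
   exists2 i, xpredT i & label_bound < \sum_(j | j != i) label_quad f i j ^+ 2))).
  apply: bern_pr_sub => // f /not_andP[H|/existsNP[i H]].
    by left; rewrite ltNge; apply/negP.
  by right; exists i => //; rewrite ltNge; apply/negP.
apply: le_trans (bern_pr_or _ _ _) _ => //.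
apply: le_trans (lerD P1 (bern_pr_union _ _ _)) _ => //=.
apply: (@le_trans _ _ (p + \sum_(i < n) p)); first by rewrite lerD2l ler_sum.
rewrite sumr_const card_ord -mulrS -[leLHS]mulr_natl /p.
have nE : n%:R = expR (ln n%:R) :> R by rewrite lnK ?posrE.
have -> : n%:R `^ (- r) = n%:R `^ (- (r + 8)) * n%:R ^+ 8.
  rewrite !powR_expR// [X in _ * X ^+ 8]nE -expRM_natr -expRD; congr expR; ring.
rewrite mulrA mulrC ler_wpM2l ?powR_ge0//.
rewrite [leRHS]exprS.
have n2 : 2 <= n%:R :> R by rewrite (ler_nat R 2 n).
have : (2 : R) ^+ 7 <= n%:R ^+ 7 by rewrite lerXn2r ?nnegrE.
have -> : (2 : R) ^+ 7 = 128 by ring.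
move=> h; have := ler_wpM2l (ltW n0) h.
rewrite -natr1; lra.
Qed.

End LabelNoise.

(** * Perturbation of the leading eigenspace *)

Section Dot.
Variables (R : realType) (n : nat).
Implicit Types (x y : 'cV[R]_n) (S : 'M[R]_n).

Definition dot x y : R := (x^T *m y) 0 0.

Lemma dotE x y : dot x y = \sum_i x i 0 * y i 0.
Proof. by rewrite /dot mxE; apply: eq_bigr => i _; rewrite mxE. Qed.

Lemma dotxx x : dot x x = \sum_i x i 0 ^+ 2.
Proof. by rewrite dotE; apply: eq_bigr => i _; rewrite expr2. Qed.

Lemma dotC x y : dot x y = dot y x.
Proof. by rewrite !dotE; apply: eq_bigr => i _; rewrite mulrC. Qed.

Lemma dotDl x y z : dot (x + y) z = dot x z + dot y z.
Proof. by rewrite /dot linearD mulmxDl mxE. Qed.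

Lemma dotZl a x y : dot (a *: x) y = a * dot x y.
Proof. by rewrite /dot linearZ -scalemxAl mxE. Qed.

Lemma dotDr x y z : dot x (y + z) = dot x y + dot x z.
Proof. by rewrite dotC dotDl !(dotC x). Qed.

Lemma dotZr a x y : dot x (a *: y) = a * dot x y.
Proof. by rewrite dotC dotZl dotC. Qed.

Lemma dot_ge0 x : 0 <= dot x x.
Proof. by rewrite dotxx sumr_ge0// => i _; exact: sqr_ge0. Qed.

Lemma dot_eq0 x : (dot x x == 0) = (x == 0).
Proof.
apply/eqP/eqP => [|->]; last by rewrite /dot mulmx0 mxE.
rewrite dotxx => /psumr_eq0P H; apply/matrixP => i j; rewrite ord1 !mxE.
by apply/eqP; rewrite -sqrf_eq0; apply/eqP; apply: H => // k _; exact: sqr_ge0.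
Qed.

Lemma dot_gt0 x : x != 0 -> 0 < dot x x.
Proof. by move=> x0; rewrite lt0r dot_eq0 x0 dot_ge0. Qed.

Lemma dotD_le x y : dot (x + y) (x + y) <= 2 * dot x x + 2 * dot y y.
Proof.
have := dot_ge0 (x + (-1) *: y).
by rewrite !dotDl !dotDr !dotZl !dotZr (dotC y x); lra.
Qed.

Lemma quad_formE S x : dot x (S *m x) = \sum_i \sum_j x i 0 * x j 0 * S i j.
Proof.
rewrite dotE; apply: eq_bigr => i _; rewrite mxE mulr_sumr.
by apply: eq_bigr => j _; ring.
Qed.

(** The added 1 keeps the constant positive, so that it can be inverted in [top_eigenvector]. *)
Lemma quad_form_bounded S : exists2 C, 0 < C & forall x, dot x (S *m x) <= C * dot x x.
Proof.
set F := \sum_i \sum_j S i j ^+ 2.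
have F0 : 0 <= F by do 2!apply: sumr_ge0 => ? _; exact: sqr_ge0.
exists (Num.sqrt F + 1) => [|x]; first by rewrite ltr_wpDl// sqrtr_ge0.
have h : F <= (Num.sqrt F + 1) ^+ 2.
  by rewrite sqrrD sqr_sqrtr// expr1n mulr1; have := sqrtr_ge0 F; rewrite mulr2n; lra.
have K0 : 0 <= Num.sqrt F + 1 by rewrite addr_ge0// sqrtr_ge0.
have := bilinear_le_frob K0 h (fun i => x i 0) (fun i => x i 0).
rewrite quad_formE => /le_trans; apply; rewrite -mulrA -expr2 sqr_sqrtr ?dotxx//.
by apply: sumr_ge0 => i _; exact: sqr_ge0.
Qed.

Lemma dot_mulmx_bilinear (M : 'M[R]_n) K x : 0 <= K -> bilinear_le (fun i j => M i j) K ->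
  dot (M *m x) (M *m x) <= K ^+ 2 * dot x x.
Proof.
move=> K0 H; set y := M *m x.
have := H (fun i => y i 0) (fun j => x j 0).
have -> : \sum_i \sum_j y i 0 * x j 0 * M i j = dot y y.
  rewrite dotE; apply: eq_bigr => i _; rewrite [in RHS]/y mxE mulr_sumr.
  by rewrite -/y; apply: eq_bigr => j _; ring.
rewrite -!dotxx; set a := dot y y; set b := dot x x => h.
have a0 : 0 <= a by exact: dot_ge0.
have b0 : 0 <= b by exact: dot_ge0.
have aE : a = Num.sqrt a ^+ 2 by rewrite sqr_sqrtr.
have bE : b = Num.sqrt b ^+ 2 by rewrite sqr_sqrtr.
have sa := sqrtr_ge0 a; have sb := sqrtr_ge0 b.
have [s0|s0] := eqVneq (Num.sqrt a) 0.
  by rewrite aE s0 expr0n mulr_ge0 ?sqr_ge0.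
have s1 : 0 < Num.sqrt a by rewrite lt0r s0.
have h2 : Num.sqrt a <= K * Num.sqrt b.
  by rewrite -(ler_pM2r s1) -expr2 -aE mulrAC.
by rewrite aE bE -exprMn lerXn2r ?nnegrE// mulr_ge0.
Qed.

End Dot.

Lemma dot_mulmx (R : realType) (m n : nat) (M : 'M[R]_(m, n)) (x : 'cV[R]_n) (y : 'cV[R]_m) :
  dot (M *m x) y = dot x (M^T *m y).
Proof. by rewrite /dot trmx_mul mulmxA. Qed.

(** * A top eigenvector of a symmetric matrix *)

Section Spectral.
Variables (R : realType) (n : nat) (S : 'M[R]_n).
Hypothesis n0 : (0 < n)%N.
Hypothesis symS : S^T = S.

(* With M the supremum of |Sx|^2 over unit vectors, M - S^2 is positive semidefinite;
   if it were invertible it would be bounded below, contradicting the choice of M. *)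
Lemma top_eigenvector : exists (v : 'cV[R]_n) (mu : R), [/\ v != 0, S *m v = mu *: v &
  forall x : 'cV[R]_n, dot (S *m x) (S *m x) <= mu ^+ 2 * dot x x].
Proof.
have SS x : dot (S *m x) (S *m x) = dot x ((S *m S) *m x) by rewrite dot_mulmx symS mulmxA.
pose E (a : R) := exists2 x : 'cV[R]_n, dot x x = 1 & a = dot (S *m x) (S *m x).
have [C C0 HC] := quad_form_bounded (S *m S).
have unitize (x : 'cV[R]_n) : x != 0 -> dot ((Num.sqrt (dot x x))^-1 *: x) ((Num.sqrt (dot x x))^-1 *: x) = 1.
  move=> x0; have p := dot_gt0 x0; rewrite dotZl dotZr mulrA -expr2 exprVn (sqr_sqrtr (ltW p)).
  by rewrite mulVf ?gt_eqF.
have supE : classical_sets.has_sup E.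
  split.
    pose x : 'cV[R]_n := const_mx 1.
    have x0 : x != 0.
      apply/eqP => /matrixP/(_ (Ordinal n0) 0); rewrite !mxE => /eqP.
      by rewrite oner_eq0.
    by eexists; exists ((Num.sqrt (dot x x))^-1 *: x); [exact: unitize|reflexivity].
  by exists C => a [x x1 ->]; rewrite SS; have := HC x; rewrite x1 mulr1.
pose M := sup E.
have HM x : dot (S *m x) (S *m x) <= M * dot x x.
  have [->|x0] := eqVneq x 0; first by rewrite mulmx0 /dot !mulmx0 !mxE mulr0.
  have p := dot_gt0 x0.
  have : E (dot (S *m ((Num.sqrt (dot x x))^-1 *: x)) (S *m ((Num.sqrt (dot x x))^-1 *: x))).
    by exists ((Num.sqrt (dot x x))^-1 *: x) => //; exact: unitize.
  move=> /(ub_le_sup supE.2); rewrite -scalemxAr dotZl dotZr mulrA -expr2 exprVn (sqr_sqrtr (ltW p)).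
  by rewrite mulrC ler_pdivrMr.
pose N := M%:M - S *m S.
have Nx x : N *m x = M *: x + (-1) *: (S *m S *m x).
  by rewrite /N mulmxBl mul_scalar_mx scaleN1r.
have symN : N^T = N.
  by rewrite /N linearB /= tr_scalar_mx trmx_mul symS.
have posN x : 0 <= dot x (N *m x).
  by rewrite Nx dotDr !dotZr -SS; have := HM x; lra.
have Nsing : N \notin unitmx.
  apply/negP => Nu; have [D D0 HD] := quad_form_bounded (invmx N).
  suff : M <= M - D^-1 by have := invr_gt0 D; rewrite D0 => h; lra.
  apply: ge_sup; first exact: supE.1.
  move=> _ [x x1 ->]; pose y := invmx N *m x.
  have Ny : N *m y = x by rewrite /y mulmxA mulmxV// mul1mx.
  (* Expanded with [dot x y <= D], nonnegativity at [x - y / D] gives [1 / D <= dot x (N *m x)], a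
     uniform gap below [M]. *)
  have h := posN (x + (- D^-1) *: y).
  have yN : dot y (N *m x) = 1 by rewrite -[in LHS]symN -dot_mulmx Ny.
  move: h; rewrite mulmxDr -scalemxAr Ny !dotDl !dotDr !dotZl !dotZr yN x1.
  have h2 := HD x; rewrite -/y x1 mulr1 in h2; rewrite (dotC y x).
  have h3 : D^-1 * (D^-1 * dot x y) <= D^-1.
    by rewrite -[leRHS]mulr1 ler_pM2l ?invr_gt0// mulrC ler_pdivrMr// mul1r.
  rewrite Nx dotDr !dotZr x1 -SS; lra.
have [v v0 Nv] : exists2 v : 'cV[R]_n, v != 0 & N *m v = 0.
  have : kermx N != 0 by rewrite kermx_eq0 row_free_unit.
  move=> /(fun h => h) K0; exists (nz_row (kermx N))^T; first by rewrite trmx_eq0 nz_row_eq0.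
  have := nz_row_sub (kermx N) => /sub_kermxP h.
  by apply: trmx_inj; rewrite trmx_mul trmxK symN h trmx0.
have M0 : 0 <= M.
  have := HM v; have p := dot_gt0 v0; have := dot_ge0 (S *m v) => h1 h2.
  by rewrite -(pmulr_lge0 _ p); exact: le_trans h2.
pose s := Num.sqrt M; have s2 : s ^+ 2 = M by rewrite sqr_sqrtr.
have SSv : S *m (S *m v) = (s ^+ 2) *: v.
  by move: Nv; rewrite Nx scaleN1r s2 mulmxA => /eqP; rewrite subr_eq0 => /eqP <-.
(* [S - s] kills [(S + s) v]: this vector is an eigenvector for [s], unless it vanishes and [v] is
   one for [- s]. *)
have [u0|u0] := eqVneq (S *m v + s *: v) 0.
  exists v, (- s); split; rewrite ?sqrrN ?s2//.
  by rewrite scaleNr; apply/eqP; rewrite -addr_eq0 u0.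
exists (S *m v + s *: v), s; split; rewrite ?s2//.
by rewrite mulmxDr SSv -scalemxAr scalerDr scalerA addrC -expr2.
Qed.

End Spectral.

(** * A sin-theta bound *)

Section DavisKahan.
Variables (R : realType) (n : nat) (T P : 'M[R]_n) (U : 'M[R]_(n, 2)) (K : R).
Hypothesis n0 : (0 < n)%N.
Hypothesis symT : T^T = T.
Hypothesis leadU : leading2_eigvecs T U.
Hypothesis TP : forall x : 'cV[R]_n, dot ((T - P) *m x) ((T - P) *m x) <= K ^+ 2 * dot x x.
Variables a1 a2 : 'cV[R]_n.
Hypothesis rankP : forall x, dot a1 x = 0 -> dot a2 x = 0 -> P *m x = 0.

Let UU : U^T *m U = 1%:M. Proof. by case: leadU. Qed.
Let Q : 'M[R]_n := 1%:M - U *m U^T.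

Let symQ : Q^T = Q.
Proof. by rewrite /Q linearB /= trmx1 trmx_mul trmxK. Qed.

Let UQ : U^T *m Q = 0.
Proof. by rewrite /Q mulmxBr mulmx1 mulmxA UU mul1mx subrr. Qed.

Let QU : Q *m U = 0.
Proof. by rewrite /Q mulmxBl mul1mx -mulmxA UU mulmx1 subrr. Qed.

Let QQ : Q *m Q = Q.
Proof. by rewrite {1}/Q mulmxBl mul1mx -mulmxA UQ mulmx0 subr0. Qed.

Lemma proj_dot_le (x : 'cV[R]_n) : dot (Q *m x) (Q *m x) <= dot x x.
Proof.
have E : dot x x = dot (Q *m x) (Q *m x) + dot (U^T *m x) (U^T *m x).
  rewrite !dot_mulmx symQ trmxK !mulmxA QQ -dotDr -mulmxDl.
  by rewrite /Q subrK mul1mx.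
by rewrite E lerDl dot_ge0.
Qed.

(* T restricted to the orthogonal complement of U has norm at most K: otherwise the span of
   U and of its top eigenvector there would be a 3-dimensional space on which T is larger
   than K, while P vanishes somewhere on it. *)
Lemma complement_norm_le (x : 'cV[R]_n) :
  dot (Q *m T *m Q *m x) (Q *m T *m Q *m x) <= K ^+ 2 * dot x x.
Proof.
case: (leadU) => _ [lam [eigU maxU]].
set S := Q *m T *m Q.
have symS : S^T = S by rewrite /S !trmx_mul symQ symT mulmxA.
have [v [mu [v0 Sv HS]]] := top_eigenvector n0 symS.
suff muK : mu ^+ 2 <= K ^+ 2.
  by apply: le_trans (HS x) _; rewrite ler_wpM2r// dot_ge0.
have [->|mu0] := eqVneq mu 0; first by rewrite expr0n sqr_ge0.
(* As [mu] is nonzero, [v] lies in the range of [Q]. The span of [U] being invariant under [T], [v]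
   is then an eigenvector of [T] itself, and maximality compares [mu] with [lam]. *)
have Uv : U^T *m v = 0.
  have : U^T *m (S *m v) = 0 by rewrite /S !mulmxA UQ !mul0mx.
  by rewrite Sv -scalemxAr => /eqP; rewrite scaler_eq0 (negbTE mu0) => /eqP.
have Qv : Q *m v = v by rewrite /Q mulmxBl mul1mx -mulmxA Uv mulmx0 subr0.
have TU : T *m U = U *m diag_mx (\row_k lam k).
  apply/matrixP => i k; have /matrixP/(_ i 0) := eigU k.
  rewrite mul_mx_diag !mxE mulrC => <-.
  by apply: eq_bigr => j _; rewrite mxE.
have UTv : U^T *m (T *m v) = 0.
  rewrite mulmxA; have -> : U^T *m T = (T *m U)^T by rewrite trmx_mul symT.
  by rewrite TU trmx_mul -mulmxA Uv mulmx0.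
have Tv : T *m v = mu *: v.
  rewrite -Sv /S -[RHS]mulmxA Qv -[RHS]mulmxA /Q mulmxBl mul1mx -mulmxA UTv.
  by rewrite mulmx0 subr0.
have lam_ge k : mu ^+ 2 <= lam k ^+ 2.
  have := maxU v mu v0 Uv Tv k.
  by rewrite -[mu ^+ 2]real_normK ?num_real// -[lam k ^+ 2]real_normK ?num_real// => h;
    rewrite lerXn2r ?nnegrE.
pose W : 'M[R]_(n, 2 + 1) := row_mx U v.
(* Three coordinates against two linear conditions: some nonzero combination of the columns of [W]
   is orthogonal to [a1] and [a2], hence killed by [P]. *)
pose B : 'M[R]_(2 + 1, 1 + 1) := W^T *m row_mx a1 a2.
have [c c0 cB] : exists2 c : 'rV[R]_(2 + 1), c != 0 & c *m B = 0.
  have K1 : kermx B != 0.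
    by rewrite kermx_eq0 /row_free neq_ltn (leq_ltn_trans (rank_leq_col _)).
  exists (nz_row (kermx B)); first by rewrite nz_row_eq0.
  by have := nz_row_sub (kermx B) => /sub_kermxP.
pose y : 'cV[R]_2 := (lsubmx c)^T; pose s := rsubmx c 0 0.
have cE : c = row_mx y^T (s%:M).
  by rewrite -[LHS]hsubmxK /y trmxK; congr row_mx; rewrite [LHS]mx11_scalar.
pose z := U *m y + s *: v.
have zE : z = W *m c^T.
  by rewrite /W cE tr_row_mx mul_row_col trmxK tr_scalar_mx mul_mx_scalar.
have orth (a : 'cV[R]_n) : c *m (W^T *m a) = 0 -> dot a z = 0.
  move=> h; rewrite dotC /dot zE trmx_mul trmxK -mulmxA h mxE.
  by [].
have [cB1 cB2] : c *m (W^T *m a1) = 0 /\ c *m (W^T *m a2) = 0.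
  move: cB; rewrite /B mul_mx_row mul_mx_row -[RHS]row_mx0 => /eq_row_mx.
  by [].
have Pz : P *m z = 0 by apply: rankP; exact: orth.
have dotUU (y1 y2 : 'cV[R]_2) : dot (U *m y1) (U *m y2) = dot y1 y2.
  by rewrite dot_mulmx mulmxA UU mul1mx.
have dotUv (y1 : 'cV[R]_2) : dot (U *m y1) v = 0.
  by rewrite dot_mulmx Uv /dot mulmx0 mxE.
have zz : dot z z = dot y y + s ^+ 2 * dot v v.
  rewrite /z dotDl !dotDr !dotZl !dotZr dotUU dotUv (dotC v) dotUv; ring.
have z0 : 0 < dot z z.
  have yp := dot_ge0 y; have vp := dot_gt0 v0.
  have sp := mulr_ge0 (sqr_ge0 s) (ltW vp).
  rewrite lt0r zz addr_ge0// andbT; apply/negP => /eqP h.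
  move/negP: c0; apply; rewrite cE.
  have y0 : y = 0 by apply/eqP; rewrite -dot_eq0; apply/eqP; lra.
  have s0 : s = 0.
    have /eqP : s ^+ 2 * dot v v = 0 by lra.
    by rewrite mulf_eq0 (gt_eqF vp) orbF sqrf_eq0 => /eqP.
  by rewrite y0 s0 trmx0 raddf0 row_mx0.
have Tz : T *m z = U *m (diag_mx (\row_k lam k) *m y) + (s * mu) *: v.
  by rewrite /z mulmxDr mulmxA TU -scalemxAr Tv scalerA mulmxA.
have TzTz : dot (T *m z) (T *m z) =
    dot (diag_mx (\row_k lam k) *m y) (diag_mx (\row_k lam k) *m y) + s ^+ 2 * (mu ^+ 2 * dot v v).
  rewrite Tz dotDl !dotDr !dotZl !dotZr dotUU dotUv (dotC v) dotUv; ring.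
have lowy : mu ^+ 2 * dot y y <=
    dot (diag_mx (\row_k lam k) *m y) (diag_mx (\row_k lam k) *m y).
  rewrite !dotxx mulr_sumr; apply: ler_sum => k _.
  by rewrite mul_diag_mx !mxE exprMn ler_wpM2r// sqr_ge0.
have := TP z; rewrite mulmxBl Pz subr0 => up.
rewrite -(ler_pM2r z0); apply: le_trans up.
by rewrite TzTz zz; lra.
Qed.

(** Since the span of [U] is invariant under [T], [Q T = Q T Q], and [Q P x] is [Q T Q x] minus a
    projected perturbation, each of norm at most [K] times that of [x]. The eigengap enters later,
    through a short preimage under [P]. *)
Lemma davis_kahan (x : 'cV[R]_n) :
  dot (Q *m (P *m x)) (Q *m (P *m x)) <= 4 * K ^+ 2 * dot x x.
Proof.
case: (leadU) => _ [lam [eigU _]].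
have TU : T *m U = U *m diag_mx (\row_k lam k).
  apply/matrixP => i k; have /matrixP/(_ i 0) := eigU k.
  rewrite mul_mx_diag !mxE mulrC => <-.
  by apply: eq_bigr => j _; rewrite mxE.
have QTU : Q *m T *m U = 0 by rewrite -mulmxA TU mulmxA QU mul0mx.
have QT : Q *m T = Q *m T *m Q.
  transitivity (Q *m T *m (1%:M - U *m U^T)) => //.
  by rewrite mulmxBr mulmx1 mulmxA QTU mul0mx subr0.
have E : Q *m (P *m x) = Q *m T *m Q *m x + Q *m (- ((T - P) *m x)).
  have -> : (T - P) *m x = T *m x - P *m x by rewrite mulmxBl.
  by rewrite -QT opprB mulmxDr mulmxN !mulmxA addrC subrK.
rewrite E; apply: le_trans (dotD_le _ _) _.
have h1 := complement_norm_le x.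
have h2 := le_trans (proj_dot_le (- ((T - P) *m x))) _.
have h3 : dot (- ((T - P) *m x)) (- ((T - P) *m x)) <= K ^+ 2 * dot x x.
  by rewrite -scaleN1r dotZl dotZr mulrA mulrNN mulr1 mul1r TP.
have := h2 _ h3; lra.
Qed.

End DavisKahan.

(** * Approximate k-means on the leading eigenvectors *)

Section TwoBlocks.
Variables (R : realType) (n : nat) (zs : 'I_n -> bool).
Hypothesis n0 : (0 < n)%N.
Let n0R : (0 : R) < n%:R. Proof. by rewrite ltr0n. Qed.

Definition block_card (b : bool) : R := #|[set i | zs i == b]|%:R.

Hypothesis block_ge : forall b, n%:R / 10 <= block_card b.

Let bc0 b : 0 < block_card b.
Proof. by apply: lt_le_trans (block_ge b); rewrite divr_gt0. Qed.

Let bc_le b : block_card b <= n%:R.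
Proof. by rewrite ler_nat -[leqRHS]card_ord max_card. Qed.

Definition block_vec (b : bool) : 'cV[R]_n := \col_i (zs i == b)%:R.

Lemma dot_block_vec b (y : 'cV[R]_n) : dot (block_vec b) y = \sum_(i | zs i == b) y i 0.
Proof.
rewrite dotE [RHS]big_mkcond; apply: eq_bigr => i _; rewrite mxE.
by case: (zs i == b); rewrite ?mul1r ?mul0r.
Qed.

Lemma dot_block_vec2 b b' : dot (block_vec b) (block_vec b') = if b == b' then block_card b else 0.
Proof.
rewrite dot_block_vec; case: eqP => [<-|bb'].
  rewrite (eq_bigr (fun=> 1)) => [|i /eqP <-]; last by rewrite mxE eqxx.
  by rewrite sumr_const /block_card cardsE.
rewrite big1// => i /eqP zi; rewrite mxE zi.
by have /eqP/negbTE -> : b <> b' by [].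
Qed.

Definition two_block_mx (al ka : R) : 'M[R]_n :=
  \matrix_(i, j) (if zs i == zs j then al + ka else al - ka).

Lemma two_block_mx_mul al ka (x : 'cV[R]_n) : two_block_mx al ka *m x =
  \sum_b ((al + ka) * dot (block_vec b) x + (al - ka) * dot (block_vec (~~ b)) x) *: block_vec b.
Proof.
apply/matrixP => i j; rewrite ord1 mxE summxE big_bool !mxE !dot_block_vec /=.
have split_sum (f : 'I_n -> R) : \sum_j f j = \sum_(j | zs j == true) f j + \sum_(j | zs j == false) f j.
  rewrite (bigID (fun j => zs j == true))/=; congr (_ + _); apply: eq_bigl => k.
  by case: (zs k).
rewrite split_sum.
rewrite (eq_bigr (fun k => (if zs i then al + ka else al - ka) * x k 0)); last first.
  by move=> k /eqP zk; rewrite mxE zk eqb_id.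
rewrite [X in _ + X](eq_bigr (fun k => (if zs i then al - ka else al + ka) * x k 0)); last first.
  by move=> k /eqP zk; rewrite mxE zk; case: (zs i).
by rewrite -!mulr_sumr; case: (zs i); rewrite /= ?mulr1 ?mulr0 ?addr0 ?add0r// addrC.
Qed.

Section Estimate.
Variables (al ka K eps : R) (T : 'M[R]_n) (U : 'M[R]_(n, 2)) (g : 'I_n -> 'I_2) (X : 'M[R]_2).
Hypothesis ka0 : 0 < ka.
Hypothesis ka_al : ka <= al.
Hypothesis symT : T^T = T.
Hypothesis leadU : leading2_eigvecs T U.
Hypothesis TP : forall x : 'cV[R]_n,
  dot ((T - two_block_mx al ka) *m x) ((T - two_block_mx al ka) *m x) <= K ^+ 2 * dot x x.
Hypothesis eps0 : 0 < eps.
Hypothesis kmX : kmeans_approx eps U g X.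

Let UU : U^T *m U = 1%:M. Proof. by case: leadU. Qed.
Let Q : 'M[R]_n := 1%:M - U *m U^T.

Let pyth (x : 'cV[R]_n) : dot (U^T *m x) (U^T *m x) = dot x x - dot (Q *m x) (Q *m x).
Proof.
have symQ : Q^T = Q by rewrite /Q linearB /= trmx1 trmx_mul trmxK.
have UQ : U^T *m Q = 0 by rewrite /Q mulmxBr mulmx1 mulmxA UU mul1mx subrr.
have QQ : Q *m Q = Q by rewrite {1}/Q mulmxBl mul1mx -mulmxA UQ mulmx0 subr0.
apply/eqP; rewrite eq_sym subr_eq addrC; apply/eqP.
rewrite !dot_mulmx symQ trmxK !mulmxA QQ -dotDr -mulmxDl.
by rewrite /Q subrK mul1mx.
Qed.

(* Sum of the squared sines of the angles between the span of U and that of the block vectors. *)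
Definition sin_dist2 : R := \sum_b dot (Q *m block_vec b) (Q *m block_vec b) / block_card b.

(** The block vector is the image of an explicit [w], found by inverting the matrix on the span of
    the block vectors; [4 * al * ka] is [(al + ka)^2 - (al - ka)^2]. Large blocks make [w] short:
    its squared norm is at most [5 / (n * ka ^+ 2)]. *)
Let proj_block b : dot (Q *m block_vec b) (Q *m block_vec b) <=
  K ^+ 2 / ka ^+ 2 * (20 / n%:R).
Proof.
have al0 : 0 < al by exact: lt_le_trans ka_al.
have neq : b == ~~ b = false by case: b.
have neq' : ~~ b == b = false by case: (b).
have no_third i : (i != b) && (i != ~~ b) = false by case: (b); case: i.
pose w := (al + ka) / (4 * al * ka * block_card b) *: block_vec b +
          - (al - ka) / (4 * al * ka * block_card (~~ b)) *: block_vec (~~ b).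
have Pw : two_block_mx al ka *m w = block_vec b.
  rewrite two_block_mx_mul (bigD1 b)//= (bigD1 (~~ b))/=; last by rewrite neq'.
  rewrite big1 ?addr0; last by move=> i; rewrite no_third.
  rewrite negbK /w !dotDr !dotZr !dot_block_vec2 !eqxx neq neq' !mulr0 !add0r !addr0.
  have b1 := bc0 b; have b2 := bc0 (~~ b).
  rewrite [X in X *: block_vec b + _](_ : _ = 1); last first.
    by field; rewrite !gt_eqF.
  rewrite [X in _ + X *: _](_ : _ = 0); last by field; rewrite !gt_eqF.
  by rewrite scale1r scale0r addr0.
have ww : dot w w = ((al + ka) ^+ 2 / block_card b + (al - ka) ^+ 2 / block_card (~~ b)) / (4 * al * ka) ^+ 2.
  have b1 := bc0 b; have b2 := bc0 (~~ b).
  rewrite /w !dotDl !dotDr !dotZl !dotZr !dot_block_vec2 !eqxx neq neq'.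
  by field; rewrite !gt_eqF.
have ibc b' : (block_card b')^-1 <= 10 / n%:R.
  rewrite -invf_div lef_pV2 ?posrE ?divr_gt0//.
have wle : dot w w <= 5 / (n%:R * ka ^+ 2).
  rewrite ww ler_pdivrMr ?exprn_gt0 ?mulr_gt0//.
  have -> : 5 / (n%:R * ka ^+ 2) * (4 * al * ka) ^+ 2 = (4 * al ^+ 2) * (10 / n%:R) + (4 * al ^+ 2) * (10 / n%:R).
    by field; rewrite !gt_eqF.
  have ib0 b' : 0 <= (block_card b')^-1 by rewrite invr_ge0 ltW.
  have ? := ka0; have ? := ka_al.
  apply: lerD; apply: ler_pM; rewrite ?sqr_ge0//; nra.
have rk (x : 'cV[R]_n) : dot (block_vec true) x = 0 -> dot (block_vec false) x = 0 ->
    two_block_mx al ka *m x = 0.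
  move=> x1 x2; rewrite two_block_mx_mul big_bool /= x1 x2.
  by rewrite !mulr0 !addr0 !scale0r addr0.
have := davis_kahan n0 symT leadU TP rk w; rewrite Pw => /le_trans; apply.
have K2 : 0 <= 4 * K ^+ 2 by rewrite mulr_ge0// sqr_ge0.
apply: le_trans (ler_wpM2l K2 wle) _.
rewrite le_eqVlt; apply/orP; left; apply/eqP; field.
by rewrite !gt_eqF.
Qed.

Lemma sin_dist2_le : sin_dist2 <= 400 * K ^+ 2 / (n%:R ^+ 2 * ka ^+ 2).
Proof.
have -> : 400 * K ^+ 2 / (n%:R ^+ 2 * ka ^+ 2) =
  \sum_(b : bool) K ^+ 2 / ka ^+ 2 * (20 / n%:R) * (10 / n%:R).
  by rewrite big_bool/=; field; rewrite !gt_eqF.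
apply: ler_sum => b _; apply: ler_pM (proj_block b) _; rewrite ?dot_ge0 ?invr_ge0 ?(ltW (bc0 b))//.
by rewrite -[leRHS]invf_div lef_pV2 ?posrE ?divr_gt0.
Qed.

Lemma sin_dist2_ge0 : 0 <= sin_dist2.
Proof. by apply: sumr_ge0 => b _; rewrite divr_ge0 ?dot_ge0// ltW. Qed.

Let gs (i : 'I_n) : 'I_2 := if zs i then ord0 else ord_max.

(** The mean of the rows of [U] over block [b]. *)
Let center (b : bool) : 'cV[R]_2 := (block_card b)^-1 *: (U^T *m block_vec b).

Let Xs : 'M[R]_2 := \matrix_(k, l) center (k == ord0) l 0.

Lemma memb_mx_mul m (h : 'I_n -> 'I_2) (Y : 'M[R]_(2, m)) i k : (memb_mx R h *m Y) i k = Y (h i) k.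
Proof.
rewrite mxE (bigD1 (h i))//= mxE eqxx mul1r big1 ?addr0// => j ji.
by rewrite mxE eq_sym (negbTE ji) mul0r.
Qed.

Let Xs_row i k : (memb_mx R gs *m Xs) i k = center (zs i) k 0.
Proof. by rewrite memb_mx_mul mxE /gs; case: (zs i). Qed.

Let centerE b k : center b k 0 = (block_card b)^-1 * \sum_(i | zs i == b) U i k.
Proof.
rewrite /center mxE; congr (_ * _).
rewrite mxE [RHS]big_mkcond; apply: eq_bigr => i _; rewrite !mxE.
by case: (zs i == b); rewrite ?mulr1 ?mulr0.
Qed.

Let split_block (f : 'I_n -> R) : \sum_i f i = \sum_b \sum_(i | zs i == b) f i.
Proof. by rewrite (partition_big zs xpredT). Qed.

(** The cost is the squared norm 2 of [U] minus the squared norm of its block means. There are as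
    many columns as blocks, so the 2 splits into one unit per block, leaving the squared sine of
    each unit block vector. *)
Lemma ideal_cost : frob2 (memb_mx R gs *m Xs - U) = sin_dist2.
Proof.
have tr2 : \sum_k \sum_i U i k ^+ 2 = 2.
  rewrite (eq_bigr (fun=> 1)); first by rewrite sumr_const card_ord.
  move=> k _; have /matrixP/(_ k k) := UU; rewrite !mxE eqxx /= mulr1n => <-.
  by apply: eq_bigr => i _; rewrite mxE expr2.
have step : frob2 (memb_mx R gs *m Xs - U) =
    \sum_k (\sum_i U i k ^+ 2 - \sum_b block_card b * center b k 0 ^+ 2).
  rewrite /frob2 exchange_big/=; apply: eq_bigr => k _.
  rewrite !split_block -sumrB; apply: eq_bigr => b _.
  have cb : block_card b * center b k 0 = \sum_(i | zs i == b) U i k.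
    by rewrite centerE mulVKf// gt_eqF.
  have -> : block_card b * center b k 0 ^+ 2 = \sum_(i | zs i == b) (2 * center b k 0 * U i k - center b k 0 ^+ 2).
    rewrite sumrB -mulr_sumr -cb sumr_const -[X in _ - X]mulr_natl.
    by rewrite -[#|_|%:R]/(#|[pred i | zs i == b]|%:R) -cardsE -/(block_card b); ring.
  rewrite -sumrB; apply: eq_bigr => i /eqP zi.
  rewrite [(memb_mx R gs *m Xs - U) i k]mxE Xs_row [(- U) i k]mxE zi; ring.
rewrite step sumrB tr2 exchange_big/=.
have -> : sin_dist2 = \sum_(b : bool) (1 - \sum_k block_card b * center b k 0 ^+ 2).
  apply: eq_bigr => b _.
  have -> : \sum_k block_card b * center b k 0 ^+ 2 = block_card b * dot (center b) (center b).
    by rewrite dotxx mulr_sumr.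
  rewrite /center dotZl dotZr pyth dot_block_vec2 eqxx.
  by have b1 := bc0 b; field; rewrite gt_eqF.
by rewrite sumrB sumr_const card_bool.
Qed.

Let sep2 : R := dot (center true - center false) (center true - center false).

(** [sep2] is the squared norm of the projection of [e], and [dot e e >= 2 / n]; small angles
    preserve at least half of it. *)
Lemma separation : sin_dist2 <= 1 / 4 -> 1 / n%:R <= sep2.
Proof.
move=> d4.
pose e := (block_card true)^-1 *: block_vec true + (- (block_card false)^-1) *: block_vec false.
have b1 := bc0 true; have b2 := bc0 false.
have ee : dot e e = (block_card true)^-1 + (block_card false)^-1.
  rewrite /e !dotDl !dotDr !dotZl !dotZr !dot_block_vec2 /=.
  by field; rewrite !gt_eqF.
have -> : sep2 = dot e e - dot (Q *m e) (Q *m e).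
  rewrite -pyth /sep2 /center /e mulmxDr -!scalemxAr scaleNr.
  by [].
have i1 : (n%:R : R)^-1 <= (block_card true)^-1 by rewrite lef_pV2 ?posrE.
have i2 : (n%:R : R)^-1 <= (block_card false)^-1 by rewrite lef_pV2 ?posrE.
have Qe : dot (Q *m e) (Q *m e) <= 2 * sin_dist2 * dot e e.
  rewrite /e mulmxDr -!scalemxAr; apply: le_trans (dotD_le _ _) _.
  rewrite -/e ee !dotZl !dotZr /sin_dist2 big_bool/=.
  set qt := dot _ (Q *m block_vec true); set qf := dot _ (Q *m block_vec false).
  have qt0 : 0 <= qt by exact: dot_ge0.
  have qf0 : 0 <= qf by exact: dot_ge0.
  set x := (block_card true)^-1; set y := (block_card false)^-1.
  have x0 : 0 <= x by rewrite invr_ge0 ltW.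
  have y0 : 0 <= y by rewrite invr_ge0 ltW.
  have := mulr_ge0 (mulr_ge0 qt0 x0) y0; have := mulr_ge0 (mulr_ge0 qf0 x0) y0.
  lra.
have e0 := dot_ge0 e.
have : 2 * sin_dist2 * dot e e <= 2 * (1 / 4) * dot e e.
  by rewrite ler_wpM2r// ler_wpM2l.
rewrite ee in Qe *; lra.
Qed.

Let drow i : R := \sum_k (X (g i) k - center (zs i) k 0) ^+ 2.

(** The true blocks with their means compete in the k-means problem, so both fits are close to [U];
    [2 + eps] is [(1 + eps) + 1]. *)
Lemma total_deviation : \sum_i drow i <= 2 * (2 + eps) * sin_dist2.
Proof.
have h1 : frob2 (memb_mx R g *m X - U) <= (1 + eps) * sin_dist2.
  by rewrite -ideal_cost; exact: kmX.
have h2 := ideal_cost.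
apply: (@le_trans _ _ (2 * frob2 (memb_mx R g *m X - U) + 2 * frob2 (memb_mx R gs *m Xs - U))).
  rewrite /frob2 !mulr_sumr -big_split; apply: ler_sum => i _.
  rewrite !mulr_sumr -big_split; apply: ler_sum => k _ /=.
  rewrite [(memb_mx R g *m X - U) i k]mxE [(memb_mx R gs *m Xs - U) i k]mxE.
  rewrite memb_mx_mul Xs_row [(- U) i k]mxE.
  set a := X _ _; set b := center _ _ _; set u := U i k.
  by have := sqr_ge0 (a + b - 2 * u); nra.
rewrite h2; lra.
Qed.

Let bad := [set i | sep2 / 4 <= drow i].

Lemma card_bad : sin_dist2 <= 1 / 4 -> #|bad|%:R <= 8 * (2 + eps) * sin_dist2 * n%:R.
Proof.
move=> /separation hs.
have h : #|bad|%:R * (1 / n%:R / 4) <= 2 * (2 + eps) * sin_dist2.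
  apply: le_trans total_deviation.
  apply: (@le_trans _ _ (\sum_(i in bad) drow i)).
    rewrite mulr_natl -sumr_const; apply: ler_sum => i; rewrite inE; apply: le_trans.
    by lra.
  rewrite [leLHS]big_mkcond; apply: ler_sum => i _; case: ifP => // _.
  by apply: sumr_ge0 => k _; exact: sqr_ge0.
have := ler_wpM2r (ltW n0R) h.
have -> : #|bad|%:R * (1 / n%:R / 4) * n%:R = #|bad|%:R / 4 :> R by field; rewrite gt_eqF.
lra.
Qed.

Lemma good_separated i j : i \notin bad -> j \notin bad -> zs i -> ~~ zs j -> g i != g j.
Proof.
rewrite !inE -!ltNge => hi hj zi zj; apply/eqP => gij.
suff : sep2 <= 2 * drow i + 2 * drow j by lra.
rewrite /sep2 /drow gij zi (negbTE zj) dotxx !mulr_sumr -big_split.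
apply: ler_sum => k _ /=; rewrite !mxE.
set a := X _ _; set b := _ * _; set c := _ * (\sum_i0 _).
by have := sqr_ge0 (2 * a - b - c); nra.
Qed.

(** Nodes outside [bad] are labelled correctly up to a global swap. If the angles are large or a
    whole block is bad, the right side is at least 1: a block has at least [n / 10] nodes, which
    turns the 8 of [card_bad] into 80. *)
Lemma loss_le : loss R (fun i => g i == ord0) zs <= 80 * (2 + eps) * sin_dist2.
Proof.
have d0 := sin_dist2_ge0.
have e2 : 2 < 2 + eps by have := eps0; lra.
have le1 : loss R (fun i => g i == ord0) zs <= 1.
  rewrite /loss ler_pdivrMr// mul1r ler_nat (leq_trans (geq_minl _ _))//.
  by rewrite -[leqRHS]card_ord max_card.
have [d4|d4] := leP sin_dist2 (1 / 4); last first.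
  apply: le_trans le1 _; have := mulr_ge0 (ltW eps0) d0; lra.
have cb := card_bad d4.
have badle m : (m <= #|bad|)%N -> m%:R / n%:R <= 80 * (2 + eps) * sin_dist2.
  move=> mb; rewrite ler_pdivrMr//; apply: (@le_trans _ _ #|bad|%:R); first by rewrite ler_nat.
  apply: le_trans cb _; rewrite ler_wpM2r ?ler0n// ler_wpM2r//; lra.
have all_bad b : (forall i, zs i == b -> i \in bad) ->
    loss R (fun i => g i == ord0) zs <= 80 * (2 + eps) * sin_dist2.
  move=> H; apply: le_trans le1 _.
  have : block_card b <= #|bad|%:R.
    by rewrite ler_nat; apply/subset_leq_card/fintype.subsetP => i; rewrite inE; exact: H.
  move=> h; have h3 := le_trans (le_trans (block_ge b) h) cb.
  rewrite -(ler_pM2r n0R); lra.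
have [/existsP[i0 /andP[zi0 gi0]]|/existsPn noi] := boolP [exists i, zs i && (i \notin bad)]; last first.
  by apply: (all_bad true) => i /eqP zi; have := noi i; rewrite zi /= negbK.
have [/existsP[j0 /andP[zj0 gj0]]|/existsPn noj] := boolP [exists i, ~~ zs i && (i \notin bad)]; last first.
  by apply: (all_bad false) => i /eqP zi; have := noj i; rewrite zi /= negbK.
have two (a b : 'I_2) : a != b -> (a == ord0) = ~~ (b == ord0).
  by case: a => [[|[|a]] ha]; case: b => [[|[|b]] hb].
have h0 := two _ _ (good_separated gi0 gj0 zi0 zj0).
have hp i : i \notin bad -> zs i -> (g i == ord0) = (g i0 == ord0).
  by move=> gi zi; rewrite (two _ _ (good_separated gi gj0 zi zj0)) h0.
have hm i : i \notin bad -> ~~ zs i -> (g i == ord0) = ~~ (g i0 == ord0).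
  by move=> gi zi; rewrite (two _ _ (good_separated gi0 gi zi0 zi)) negbK.
rewrite /loss; case c : (g i0 == ord0).
  apply: le_trans (badle (hamming (fun i => g i == ord0) zs) _).
    by rewrite ler_pM2r ?invr_gt0// ler_nat geq_minl.
  apply/subset_leq_card/fintype.subsetP => i; rewrite inE; apply: contraR => gi.
  by case zi : (zs i); [rewrite hp// c|rewrite hm ?zi// c].
apply: le_trans (badle (hamming (fun i => ~~ (g i == ord0)) zs) _).
  by rewrite ler_pM2r ?invr_gt0// ler_nat geq_minr.
apply/subset_leq_card/fintype.subsetP => i; rewrite inE; apply: contraR => gi.
by case zi : (zs i); [rewrite hp// c|rewrite hm ?zi// c].
Qed.

End Estimate.

Lemma spectral_clustering_loss (al ka K eps : R) (T : 'M[R]_n) (U : 'M[R]_(n, 2))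
    (g : 'I_n -> 'I_2) (X : 'M[R]_2) :
  0 < ka -> ka <= al -> T^T = T -> leading2_eigvecs T U -> 0 <= K ->
  bilinear_le (fun i j => T i j - two_block_mx al ka i j) K ->
  0 < eps -> kmeans_approx eps U g X ->
  loss R (fun i => g i == ord0) zs <= 80 * 400 * (2 + eps) * K ^+ 2 / (n%:R ^+ 2 * ka ^+ 2).
Proof.
move=> ka0 ka_al symT leadU K0 TP eps0 kmX.
have TP' (x : 'cV[R]_n) :
    dot ((T - two_block_mx al ka) *m x) ((T - two_block_mx al ka) *m x) <= K ^+ 2 * dot x x.
  by apply: dot_mulmx_bilinear => //; apply: bilinear_le_ext TP => i j; rewrite !mxE.
have h1 := loss_le leadU eps0 kmX.
have h2 := sin_dist2_le ka0 ka_al symT leadU TP'.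
apply: le_trans h1 _.
have e0 : 0 <= 80 * (2 + eps) by lra.
apply: le_trans (ler_wpM2l e0 h2) _.
by rewrite le_eqVlt; apply/orP; left; apply/eqP; field; rewrite !gt_eqF.
Qed.

End TwoBlocks.

(** * The inhomogeneous multilayer block model *)

Section Model.
Variables (R : realType) (L n : nat) (zs : 'I_n -> bool) (rho : R) (p q : 'I_L -> R).

(** The value 0 off [i < j] matches the factor of [imlsbm_weight] that forces those entries to be
    false. *)
Definition edge_prob (xi : {ffun 'I_L * 'I_n -> bool}) (x : 'I_L * 'I_n * 'I_n) : R :=
  if (x.1.2 < x.2)%N then
    if layer_label zs xi x.1.1 x.1.2 == layer_label zs xi x.1.1 x.2 then p x.1.1 else q x.1.1
  else 0.

Lemma imlsbm_probE (E : Omega L n -> Prop) :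
  imlsbm_prob zs rho p q E =
  bern_mean (fun=> rho) (fun xi => bern_pr (edge_prob xi) (fun e => E (xi, e))).
Proof.
rewrite /imlsbm_prob /bern_pr /bern_mean.
under [RHS]eq_bigr do rewrite mulr_sumr.
rewrite pair_big/=; apply: eq_bigr => -[xi e] _ /=.
rewrite mulrA; case: asboolP => _; rewrite ?mulr1 ?mulr0//.
rewrite /imlsbm_weight /bern_weight /=; congr (_ * _); apply: eq_bigr => x _.
by rewrite /edge_prob; case: ifP => // _; rewrite subr0.
Qed.

Section EdgeProb.
Hypothesis qp : forall l, 0 < q l /\ q l < p l /\ p l < 1.

Lemma edge_prob01 xi x : 0 <= edge_prob xi x <= 1.
Proof.
have [h1 [h2 h3]] := qp x.1.1.
by rewrite /edge_prob; do 2?case: ifP => _; apply/andP; split; lra.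
Qed.

Lemma edge_prob_le xi x : edge_prob xi x <= p x.1.1.
Proof.
have [h1 [h2 h3]] := qp x.1.1.
by rewrite /edge_prob; do 2?case: ifP => _; lra.
Qed.

End EdgeProb.

Hypothesis rho01 : 0 <= rho <= 1.
Hypothesis edge01 : forall xi x, 0 <= edge_prob xi x <= 1.

Lemma imlsbm_prob_ge0 (E : Omega L n -> Prop) : 0 <= imlsbm_prob zs rho p q E.
Proof.
rewrite imlsbm_probE; apply: sumr_ge0 => xi _; rewrite mulr_ge0 ?bern_weight_ge0//.
by apply: sumr_ge0 => e _; rewrite mulr_ge0 ?bern_weight_ge0.
Qed.

Lemma imlsbm_prob_ge (G1 : {ffun 'I_L * 'I_n -> bool} -> Prop)
    (G2 E : Omega L n -> Prop) (d1 d2 : R) :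
  bern_pr (fun=> rho) (fun xi => ~ G1 xi) <= d1 ->
  (forall xi, bern_pr (edge_prob xi) (fun e => ~ G2 (xi, e)) <= d2) ->
  (forall w, G1 w.1 -> G2 w -> E w) ->
  1 - d1 - d2 <= imlsbm_prob zs rho p q E.
Proof.
move=> h1 h2 hE; rewrite imlsbm_probE.
have step xi : 1 + - 1 * (`[< ~ G1 xi >])%:R + - d2 <= bern_pr (edge_prob xi) (fun e => E (xi, e)).
  case: asboolP => H1 /=.
    have d20 : 0 <= d2.
      apply: le_trans (h2 xi); apply: sumr_ge0 => e _.
      by rewrite mulr_ge0 ?bern_weight_ge0.
    (* On bad labels the claimed bound is [- d2], which is nonpositive. *)
    apply: (@le_trans _ _ 0); first by rewrite mulr1; lra.
    by apply: sumr_ge0 => e _; rewrite mulr_ge0 ?bern_weight_ge0.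
  have : 1 <= bern_pr (edge_prob xi) (fun e => E (xi, e)) +
      bern_pr (edge_prob xi) (fun e => ~ G2 (xi, e)).
    rewrite -(bern_mean_cst (edge_prob xi) 1).
    apply: le_trans (bern_pr_or (edge01 xi) _ _); apply: bern_mean_le => // e.
    rewrite asboolT//; have [g2|ng2] := pselect (G2 (xi, e)); [left|by right].
    by apply: hE => //=; exact: contrapT.
  by have := h2 xi; lra.
apply: le_trans (bern_mean_le (fun=> rho01) step).
rewrite !bern_meanD bern_meanZ !bern_mean_cst//.
by move: h1; rewrite /bern_pr; lra.
Qed.

End Model.

Lemma bilinear_le_diag (R : realType) (n : nat) (a : R) : 0 <= a ->
  bilinear_le (fun i j : 'I_n => if i == j then - a else 0) a.
Proof.
move=> a0 x y.
have s0 (z : 'I_n -> R) : 0 <= \sum_i z i ^+ 2 by apply: sumr_ge0 => i _; exact: sqr_ge0.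
have -> : \sum_i \sum_j x i * y j * (if i == j then - a else 0) = a * - \sum_i x i * y i.
  rewrite mulrN -mulNr mulr_sumr; apply: eq_bigr => i _.
  rewrite (bigD1 i)//= eqxx big1 ?addr0; first by rewrite mulrC.
  by move=> j; rewrite eq_sym => /negbTE ->; rewrite mulr0.
rewrite -mulrA ler_wpM2l// -sqrtrM//.
apply: le_trans (ler_norm _) _; rewrite normrN -sqrtr_sqr ler_wsqrtr//.
exact: cauchy_schwarz.
Qed.

(* The left-hand side of the condition exceeds 1 while 2 (rho - rho^2) <= 1 / 2. *)
Lemma imbalance_le (R : realType) (beta c' rho pb qb : R) :
  0 <= c' < 1 -> 0 <= rho < 1 / 2 -> 1 <= beta -> 0 < qb -> qb < pb ->
  (beta = 1 \/
   pb / (pb - qb) <= c' * (2 * (1 - 2 * rho) ^+ 2 / (beta - beta^-1)) + 2 * (rho - rho ^+ 2)) ->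
  beta <= 5.
Proof.
move=> /andP[c'0 c'1] /andP[rho0 rho1] b1 q0 qp [->|H]; first lra.
rewrite leNgt; apply/negP => b5.
have b0 : 0 < beta by lra.
have ib : beta^-1 <= 1 by rewrite invf_le1.
have D4 : 4 <= beta - beta^-1 by lra.
have D0 : 0 < beta - beta^-1 by lra.
have r2 : (1 - 2 * rho) ^+ 2 <= 1 by rewrite expr_le1//; lra.
have h1 : 2 * (1 - 2 * rho) ^+ 2 / (beta - beta^-1) <= 1 / 2.
  by rewrite ler_pdivrMr//; lra.
have h0 : 0 <= 2 * (1 - 2 * rho) ^+ 2 / (beta - beta^-1).
  by rewrite divr_ge0 ?(ltW D0)// mulr_ge0// sqr_ge0.
have h2 : 2 * (rho - rho ^+ 2) <= 1 / 2.
  by have := sqr_ge0 (1 - 2 * rho); rewrite sqrrB !expr2; lra.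
have h3 : 1 < pb / (pb - qb) by rewrite ltr_pdivlMr; lra.
have h4 : c' * (2 * (1 - 2 * rho) ^+ 2 / (beta - beta^-1)) <= 1 * (1 / 2).
  by apply: ler_pM => //; exact: ltW.
lra.
Qed.

Lemma maxL_ge (R : realType) (L : nat) (f : 'I_L -> R) l : f l <= maxL f.
Proof. by rewrite /maxL (bigD1 l)//= le_max lexx. Qed.

Lemma wavg_gt0 (R : realType) (L : nat) (om f : 'I_L -> R) : (0 < L)%N ->
  (forall l, 0 < om l) -> (forall l, 0 < f l) -> 0 < wavg om f.
Proof.
move=> L0 om0 f0; rewrite /wavg (bigD1 (Ordinal L0))//= ltr_pwDl ?mulr_gt0//.
by apply: sumr_ge0 => l _; rewrite mulr_ge0// ltW.
Qed.

Lemma wavg_lt (R : realType) (L : nat) (om f g : 'I_L -> R) : (0 < L)%N ->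
  (forall l, 0 < om l) -> (forall l, f l < g l) -> wavg om f < wavg om g.
Proof.
move=> L0 om0 fg; rewrite -subr_gt0.
have -> : wavg om g - wavg om f = wavg om (fun l => g l - f l).
  by rewrite /wavg -sumrB; apply: eq_bigr => l _; rewrite mulrBr.
by apply: wavg_gt0 => // l; rewrite subr_gt0.
Qed.

(** * Assembling the bounds for one instance *)

Section Instance.
Variables (R : realType) (L n : nat) (zs : 'I_n -> bool) (rho gamma r c0 : R).
Variables (p q om : 'I_L -> R).
Hypothesis n1 : (1 < n)%N.
Hypothesis L0 : (0 < L)%N.
Hypothesis r1 : 1 <= r.
Hypothesis c0_gt0 : 0 < c0.
Hypothesis gamma1 : expR 1 < gamma.
Hypothesis rho_lt : 0 <= rho < 1 / 2.
Hypothesis qp : forall l, 0 < q l /\ q l < p l /\ p l < 1.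
Hypothesis om0 : forall l, 0 < om l.
Hypothesis om_bal : maxL om * wavg om p <= c0 * \sum_l om l ^+ 2 * p l.
Hypothesis block_ge : forall b, n%:R / 10 <= block_card R zs b.

Let n0 : (0 < n)%N. Proof. exact: ltnW. Qed.
Let n0R : (0 : R) < n%:R. Proof. by rewrite ltr0n. Qed.
Let l0 : 'I_L := Ordinal L0.
Let rho01 : 0 <= rho <= 1.
Proof. by move: rho_lt => /andP[h1 h2]; apply/andP; split; lra. Qed.

Let omx := maxL om.
Let omx0 : 0 < omx. Proof. exact: lt_le_trans (om0 l0) (maxL_ge om l0). Qed.
(** Scaled into [0, 1], the range assumed by the edge bounds; the factor [omx] is put back in
    [good_loss]. *)
Let w l := om l / omx.
Let w01 l : 0 <= w l <= 1.
Proof.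
apply/andP; split; first by rewrite divr_ge0// ltW.
by rewrite ler_pdivrMr// mul1r maxL_ge.
Qed.
Let omE l : om l = omx * w l. Proof. by rewrite /w mulrC divfK// gt_eqF. Qed.

Let p0 l : 0 <= p l. Proof. by have [h1 [h2 _]] := qp l; lra. Qed.

Let mu := \sum_l w l * p l.
Let pbE : wavg om p = omx * mu.
Proof. by rewrite /wavg mulr_sumr; apply: eq_bigr => l _; rewrite [in LHS]omE mulrA. Qed.

Let qb0 : 0 < wavg om q.
Proof. by apply: wavg_gt0 => // l; case: (qp l). Qed.

Let qb_pb : wavg om q < wavg om p.
Proof. by apply: wavg_lt => // l; have [_ []] := qp l. Qed.

Let mu0 : 0 < mu.
Proof. by rewrite -(pmulr_rgt0 _ omx0) -pbE; exact: lt_trans qb0 qb_pb. Qed.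

Let B2 := maxL (fun l => om l ^+ 2 * (p l - q l) ^+ 2).
Let dl l := om l * (p l - q l).
Let dl0 l : 0 < dl l.
Proof. by rewrite mulr_gt0// subr_gt0; have [_ []] := qp l. Qed.
Let dl_B2 l : dl l ^+ 2 <= B2.
Proof. by rewrite exprMn; exact: (maxL_ge (fun l => om l ^+ 2 * (p l - q l) ^+ 2) l). Qed.
Let B20 : 0 < B2. Proof. by apply: lt_le_trans (dl_B2 l0); rewrite exprn_gt0. Qed.
Let sB := Num.sqrt B2.
Let sB0 : 0 < sB. Proof. by rewrite sqrtr_gt0. Qed.
Let sB2 : sB ^+ 2 = B2. Proof. by rewrite sqr_sqrtr// ltW. Qed.
Let b l := dl l / sB.
Let b1 l : `|b l| <= 1.
Proof.
rewrite ger0_norm; last by rewrite divr_ge0// ltW.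
rewrite ler_pdivrMr// mul1r -[leLHS]ger0_norm ?(ltW (dl0 l))//.
by rewrite -sqrtr_sqr ler_wsqrtr.
Qed.

Let al := (wavg om p + wavg om q) / 2.
Let ka := (1 - 2 * rho) ^+ 2 * (wavg om p - wavg om q) / 2.

Let ka0 : 0 < ka.
Proof.
have := rho_lt => /andP[_ h]; rewrite divr_gt0// mulr_gt0 ?subr_gt0//.
by rewrite exprn_gt0//; lra.
Qed.

Let ka_al : ka <= al.
Proof.
have /andP[h1 h2] := rho_lt.
have r2 : (1 - 2 * rho) ^+ 2 <= 1 by rewrite expr_le1//; lra.
have := qb0; have := qb_pb => h3 h4.
have h5 : 0 <= wavg om p - wavg om q by rewrite subr_ge0 ltW.
have := ler_wpM2r h5 r2; rewrite /ka /al; lra.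
Qed.

Let edge01 xi x := edge_prob01 zs qp xi x.
Let edge_le xi x := edge_prob_le zs qp xi x.

Let X := label_bound L n rho r.

Definition good_labels (xi : {ffun 'I_L * 'I_n -> bool}) : Prop :=
  \sum_i label_lin rho b xi i ^+ 2 <= X /\
  forall i, \sum_(j | j != i) label_quad rho b xi i j ^+ 2 <= X.

Definition good_edges (om' : Omega L n) : Prop :=
  let A := layer_sum w (fun x => (om'.2 x)%:R) in
  let J := [set i | gamma * n%:R * mu < \sum_j A i j] in
  bilinear_le (fun i j => (if (i \in J) || (j \in J) then 0 else A i j) -
     layer_sum w (edge_prob zs p q om'.1) i j) (noise_cst gamma r * Num.sqrt (n%:R * mu)).

Let sgn i j : R := if zs i == zs j then 1 else -1.

(** With flips as signs, an edge probability is [(p + q) / 2] plus [sgn * (p - q) / 2] times two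
    factors [(1 - 2 * rho) - 2 * flip_dev]. The constant part of their product gives [ka], the rest
    the linear and quadratic terms. *)
Let mean_dev xi i j : i != j ->
  omx * layer_sum w (edge_prob zs p q xi) i j - two_block_mx zs al ka i j =
  sgn i j * sB * (- (1 - 2 * rho) * (label_lin rho b xi i + label_lin rho b xi j) +
                  2 * label_quad rho b xi i j).
Proof.
move=> ij.
have layer l : om l * (if (i < j)%N then edge_prob zs p q xi (l, i, j)
      else if (j < i)%N then edge_prob zs p q xi (l, j, i) else 0) =
    om l * (if layer_label zs xi l i == layer_label zs xi l j then p l else q l).
  congr (_ * _); rewrite /edge_prob /=; case: (ltngtP i j) => // h.
  - by rewrite eq_sym.
  - by move: ij; rewrite (val_inj h) eqxx.
have -> : omx * layer_sum w (edge_prob zs p q xi) i j =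
    \sum_l om l * (if layer_label zs xi l i == layer_label zs xi l j then p l else q l).
  rewrite /layer_sum mulr_sumr; apply: eq_bigr => l _.
  by rewrite mulrA -omE layer.
have -> : two_block_mx zs al ka i j =
    \sum_l om l * ((p l + q l) / 2 + sgn i j * ((1 - 2 * rho) ^+ 2 * (p l - q l) / 2)).
  have alE : al = \sum_l om l * ((p l + q l) / 2).
    rewrite /al /wavg -big_split mulr_suml; apply: eq_bigr => l _ /=; ring.
  have kaE : ka = \sum_l om l * ((1 - 2 * rho) ^+ 2 * (p l - q l) / 2).
    rewrite /ka /wavg -sumrB mulr_sumr mulr_suml; apply: eq_bigr => l _ /=; ring.
  transitivity (al + sgn i j * ka).
    by rewrite mxE /sgn; case: ifP => _; rewrite ?mul1r ?mulN1r.
  rewrite {1}alE kaE mulr_sumr -big_split; apply: eq_bigr => l _ /=; ring.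
rewrite /label_lin /label_quad -big_split/= mulr_sumr mulr_sumr -big_split mulr_sumr -sumrB.
apply: eq_bigr => l _ /=.
have -> : b l = om l * (p l - q l) / sB by [].
have s0 : sB != 0 by rewrite gt_eqF.
move: (sB) s0 => s s0.
rewrite /flip_dev /layer_label /sgn.
by case: (zs i); case: (zs j); case: (xi (l, i)); case: (xi (l, j)) => /=; field.
Qed.

Let KN := Num.sqrt (18 * n%:R * B2 * X).

Let X0 : 0 <= X.
Proof.
have h := r1; have /andP[h1 h2] := rho01.
rewrite /X /label_bound mulr_ge0//; last first.
  by rewrite addr_ge0 ?mulr_ge0 ?ln_ge0 ?ler1n.
by rewrite /column_cst addr_ge0// mulr_ge0// exprn_ge0//; lra.
Qed.

(** The square of a sum of three terms gives weights 3, 3 and 12, hence the 18; each of the three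
    sums is at most [n * B2 * X]. *)
Let label_frob xi : good_labels xi ->
  bilinear_le (fun i j => if i == j then 0 else
     omx * layer_sum w (edge_prob zs p q xi) i j - two_block_mx zs al ka i j) KN.
Proof.
move=> [h1 h2]; apply: bilinear_le_frob; first exact: sqrtr_ge0.
have X18 : 0 <= 18 * n%:R * B2 * X by rewrite mulr_ge0 ?X0// mulr_ge0 ?(ltW B20)// mulr_ge0.
rewrite sqr_sqrtr//.
set G := label_lin rho b xi in h1 *; set Qd := label_quad rho b xi in h2 *.
apply: (@le_trans _ _ (\sum_i \sum_j (3 * B2 * G i ^+ 2 + 3 * B2 * G j ^+ 2 +
   12 * B2 * (if j != i then Qd i j ^+ 2 else 0)))).
  apply: ler_sum => i _; apply: ler_sum => j _.
  have [<-|ij] := eqVneq i j.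
    by rewrite expr0n /= mulr0 addr0 addr_ge0// mulr_ge0 ?sqr_ge0// mulr_ge0// ltW.
  rewrite /= mean_dev// -/G -/Qd !exprMn sB2.
  have -> : sgn i j ^+ 2 = 1 by rewrite /sgn; case: ifP => _; rewrite ?sqrrN expr1n.
  set x := G i; set y := G j; set z := Qd i j; set t := - (1 - 2 * rho).
  have t2 : t ^+ 2 <= 1.
    have /andP[h3 h4] := rho_lt.
    by rewrite /t sqrrN expr_le1//; lra.
  have e1 : (t * (x + y) + 2 * z) ^+ 2 <= 3 * (t ^+ 2 * x ^+ 2) + 3 * (t ^+ 2 * y ^+ 2) + 3 * (2 * z) ^+ 2.
    have := sqr_ge0 (t * x - t * y); have := sqr_ge0 (t * x - 2 * z).
    by have := sqr_ge0 (t * y - 2 * z); lra.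
  have e2 := ler_wpM2r (sqr_ge0 x) t2; have e3 := ler_wpM2r (sqr_ge0 y) t2.
  have e4 : (t * (x + y) + 2 * z) ^+ 2 <= 3 * x ^+ 2 + 3 * y ^+ 2 + 12 * z ^+ 2 by lra.
  by have := ler_wpM2l (ltW B20) e4; lra.
have B3 : 0 <= 3 * B2 by rewrite mulr_ge0// ltW.
have B12 : 0 <= 12 * B2 by rewrite mulr_ge0// ltW.
have -> : \sum_i \sum_j (3 * B2 * G i ^+ 2 + 3 * B2 * G j ^+ 2 +
   12 * B2 * (if j != i then Qd i j ^+ 2 else 0)) =
  n%:R * (3 * B2 * \sum_i G i ^+ 2) + n%:R * (3 * B2 * \sum_j G j ^+ 2) +
  12 * B2 * \sum_i \sum_(j | j != i) Qd i j ^+ 2.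
  transitivity (\sum_i (n%:R * (3 * B2 * G i ^+ 2) + \sum_j (3 * B2 * G j ^+ 2) +
      12 * B2 * \sum_(j | j != i) Qd i j ^+ 2)).
    apply: eq_bigr => i _; rewrite !big_split/=; congr (_ + _ + _).
      by rewrite sumr_const card_ord -[LHS]mulr_natl.
    by rewrite [in RHS]big_mkcond/= mulr_sumr.
  rewrite !big_split/=; congr (_ + _ + _).
  - by rewrite !mulr_sumr; apply: eq_bigr => i _.
  - by rewrite sumr_const card_ord -[LHS]mulr_natl; congr (_ * _); rewrite mulr_sumr.
  - by rewrite [RHS]mulr_sumr.
have hq : \sum_i \sum_(j | j != i) Qd i j ^+ 2 <= n%:R * X.
  apply: (@le_trans _ _ (\sum_(i < n) X)); first by apply: ler_sum => i _; exact: h2.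
  by rewrite sumr_const card_ord mulr_natl.
have t1 := ler_wpM2l (ltW n0R) (ler_wpM2l B3 h1).
have t2 := ler_wpM2l B12 hq.
lra.
Qed.

Let AbarE (om' : Omega L n) i j :
  Abar om (adj R om') i j = omx * layer_sum w (fun x => (om'.2 x)%:R) i j.
Proof.
rewrite /Abar summxE /layer_sum mulr_sumr; apply: eq_bigr => l _.
by rewrite !mxE mulrA -omE.
Qed.

Let N0 := noise_cst gamma r.

(** [80 * 400] comes from clustering, 4 from the 1/2 in [ka], 3 from squaring a sum of three norms;
    the bracket collects the factors of Delta_2, Delta_3 and Delta_1. *)
Definition clustering_cst : R :=
  80 * 400 * 4 * 3 * (c0 * noise_cst gamma r ^+ 2 + 18 * column_cst (r + 8) + 1).

Let N0_ge0 : 0 <= N0.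
Proof.
have g0 : 0 <= gamma by apply: ltW; apply: lt_trans gamma1; exact: expR_gt0.
have e0 := expR_ge0 (1 : R); have h := r1.
by rewrite /N0 /noise_cst; lra.
Qed.

Let al_ka : al + ka = wavg om p - 2 * rho * (1 - rho) * (wavg om p - wavg om q).
Proof. by rewrite /al /ka; field. Qed.

Lemma good_loss (om' : Omega L n) (zt : 'I_n -> bool) (eps : R) : 0 < eps ->
  good_labels om'.1 -> good_edges om' ->
  alg1_output (adj R om') om p gamma eps zt ->
  loss R zt zs <= error_bound n om p q rho clustering_cst eps.
Proof.
move=> eps0 gl ge [U [g [Y [leadU [kmY ztE]]]]].
set Ab := Abar om (adj R om') in leadU; set T := trim _ _ in leadU.
pose A := layer_sum w (fun x => (om'.2 x)%:R).
pose J := [set i | gamma * n%:R * mu < \sum_j A i j].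
have JE : trim_set gamma (wavg om p) Ab = J.
  apply/setP => i; rewrite !inE pbE.
  have -> : \sum_j Ab i j = omx * \sum_j A i j.
    by rewrite mulr_sumr; apply: eq_bigr => j _; exact: AbarE.
  by rewrite mulrCA ltr_pM2l.
have TE i j : T i j = omx * (if (i \in J) || (j \in J) then 0 else A i j).
  by rewrite /T mxE JE; case: ifP => _; rewrite ?mulr0// AbarE.
have symT : T^T = T.
  by apply/matrixP => i j; rewrite mxE !TE orbC /A layer_sumC.
pose m := layer_sum w (edge_prob zs p q om'.1).
pose K1 := omx * (N0 * Num.sqrt (n%:R * mu)).
pose K := K1 + KN + (al + ka).
have ak0 : 0 <= al + ka by have := ka0; have := ka_al; lra.
have K10 : 0 <= K1 by rewrite mulr_ge0 ?(ltW omx0)// mulr_ge0// sqrtr_ge0.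
have KN0 : 0 <= KN by exact: sqrtr_ge0.
have K0 : 0 <= K by rewrite /K addr_ge0// addr_ge0.
have TP : bilinear_le (fun i j => T i j - two_block_mx zs al ka i j) K.
  have h1 := bilinear_leZ (ltW omx0) ge; have h2 := label_frob gl.
  (* The conditional mean vanishes on the diagonal, where the two-block matrix equals [al + ka]. *)
  have h3 := @bilinear_le_diag R n _ ak0.
  have h : bilinear_le _ K := bilinear_leD (bilinear_leD h1 h2) h3.
  apply: bilinear_le_ext h => i j /=.
  rewrite TE -/A -/J; have [<-|ij] := eqVneq i j; last by rewrite addr0 mulrBr addrA subrK.
  have -> : layer_sum w (edge_prob zs p q om'.1) i i = 0.
    by rewrite /layer_sum big1// => l _; rewrite ltnn mulr0.
  by rewrite subr0 addr0 mxE eqxx.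
have E : zt = (fun i => g i == ord0) by apply/funext.
rewrite E; apply: le_trans (spectral_clustering_loss n0 block_ge ka0 ka_al symT leadU K0 TP eps0 kmY) _.
rewrite /error_bound.
set D1 := (_ - _) ^+ 2; set D2 := n%:R * _; set D3 := _ + rho ^+ 2 * _ * _.
have D10 : 0 <= D1 by exact: sqr_ge0.
have akD : (al + ka) ^+ 2 = D1 by rewrite al_ka.
have S20 : 0 <= \sum_l om l ^+ 2 * p l.
  by apply: sumr_ge0 => l _; rewrite mulr_ge0 ?sqr_ge0.
have D20 : 0 <= D2 by rewrite mulr_ge0.
have /andP[rho0 rho1] := rho01.
have lam0 : 0 <= n%:R ^+ 2 * L%:R * rho by rewrite !mulr_ge0.
have ln0 : 0 <= n%:R * ln n%:R :> R by rewrite mulr_ge0 ?ln_ge0// ler1n.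
have L20 : 0 <= L%:R ^+ 2 * rho ^+ 2 :> R by rewrite mulr_ge0 ?sqr_ge0.
have last0 : 0 <= rho ^+ 2 * (1 - rho) ^+ 2 * (wavg om p - wavg om q) ^+ 2.
  by rewrite mulr_ge0 ?sqr_ge0// mulr_ge0 ?sqr_ge0.
have B2n : 0 <= B2 := ltW B20.
have D3E : D3 = B2 * (L%:R ^+ 2 * rho ^+ 2 + n%:R ^+ 2 * L%:R * rho + n%:R * ln n%:R) +
   rho ^+ 2 * (1 - rho) ^+ 2 * (wavg om p - wavg om q) ^+ 2 by [].
have hB : B2 * (n%:R ^+ 2 * L%:R * rho + n%:R * ln n%:R) <= D3.
  rewrite D3E; have := mulr_ge0 B2n L20; lra.
have D30 : 0 <= D3.
  by apply: le_trans hB; rewrite mulr_ge0// addr_ge0.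
(* [omx ^+ 2 * n * mu] is [n * omx * wavg om p], which the first balance condition on the weights
   bounds by [c0 * D2]. *)
have K1D : K1 ^+ 2 <= c0 * N0 ^+ 2 * D2.
  have -> : K1 ^+ 2 = N0 ^+ 2 * (n%:R * (omx * wavg om p)).
    by rewrite /K1 pbE !exprMn sqr_sqrtr ?mulr_ge0// ?(ltW mu0)//; ring.
  have nn : 0 <= N0 ^+ 2 * n%:R by rewrite mulr_ge0 ?sqr_ge0.
  by have := ler_wpM2l nn om_bal; rewrite -/omx /D2; lra.
have cc0 : 0 <= column_cst (r + 8).
  have h := r1; rewrite /column_cst addr_ge0// mulr_ge0// exprn_ge0//; lra.
have KND : KN ^+ 2 <= 18 * column_cst (r + 8) * D3.
  rewrite /KN sqr_sqrtr; last first.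
    by rewrite mulr_ge0 ?X0// mulr_ge0// mulr_ge0.
  have c18 : 0 <= 18 * column_cst (r + 8) by rewrite mulr_ge0.
  by have := ler_wpM2l c18 hB; rewrite /X /label_bound; lra.
have K2 : K ^+ 2 <= 3 * (c0 * N0 ^+ 2 + 18 * column_cst (r + 8) + 1) * (D1 + D2 + D3).
  have sq3 : K ^+ 2 <= 3 * (K1 ^+ 2 + KN ^+ 2 + (al + ka) ^+ 2).
    rewrite /K; have := sqr_ge0 (K1 - KN); have := sqr_ge0 (K1 - (al + ka)).
    by have := sqr_ge0 (KN - (al + ka)); lra.
  have cN : 0 <= c0 * N0 ^+ 2 by rewrite mulr_ge0 ?sqr_ge0 ?(ltW c0_gt0).
  have t1 := mulr_ge0 cN D10; have t2 := mulr_ge0 cN D30.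
  have t3 := mulr_ge0 cc0 D10; have t4 := mulr_ge0 cc0 D20.
  rewrite akD in sq3; lra.
have den0 : 0 < n%:R ^+ 2 * (1 - 2 * rho) ^+ 4 * (wavg om p - wavg om q) ^+ 2.
  have /andP[_ h] := rho_lt.
  by rewrite mulr_gt0 ?exprn_gt0 ?subr_gt0// mulr_gt0 ?exprn_gt0//; lra.
have denE : (n%:R ^+ 2 * ka ^+ 2)^-1 =
    4 / (n%:R ^+ 2 * (1 - 2 * rho) ^+ 4 * (wavg om p - wavg om q) ^+ 2).
  have -> : n%:R ^+ 2 * ka ^+ 2 =
      n%:R ^+ 2 * (1 - 2 * rho) ^+ 4 * (wavg om p - wavg om q) ^+ 2 / 4 by rewrite /ka; field.
  by rewrite invf_div.
rewrite denE mulrA ler_pM2r ?invr_gt0//.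
have c4 : 0 <= 80 * 400 * 4 * (2 + eps).
  by rewrite mulr_ge0 ?mulr_ge0// addr_ge0// ltW.
by have := ler_wpM2l c4 K2; rewrite /clustering_cst -/N0; lra.
Qed.

Lemma good_pr (eps : R) : 0 < eps ->
  1 - 11 * n%:R `^ (- r) - (2 : R) ^- n <= imlsbm_prob zs rho p q
    (fun om' => forall zt : 'I_n -> bool,
       alg1_output (adj R om') om p gamma eps zt ->
       loss R zt zs <= error_bound n om p q rho clustering_cst eps).
Proof.
move=> eps0.
have h1 := label_noise_pr rho01 b1 n1 r1.
have h2 xi := trimmed_noise_pr n0 w01 p0 (edge01 xi) (edge_le xi) gamma1 r1 mu0.
have := @imlsbm_prob_ge R L n zs rho p q rho01 edge01 good_labels good_edges
  (fun om' => forall zt : 'I_n -> bool,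
       alg1_output (adj R om') om p gamma eps zt ->
       loss R zt zs <= error_bound n om p q rho clustering_cst eps)
  _ _ h1 h2 (fun om' gl ge zt => good_loss eps0 gl ge).
apply: le_trans; have := powR_ge0 (n%:R : R) (- r); lra.
Qed.

End Instance.

Theorem mainTheorem6 (R : realType) (c1 gamma : R) :
  1 <= c1 -> expR c1 < gamma ->
  exists c2 : R, 1 < c2 /\
  forall (c C0 c' c0 r : R),
    0 <= c -> 0 < C0 -> 0 <= c' < 1 -> 0 < c0 -> 1 <= r ->
  exists C : R,
  forall (eps : R) (n L : nat) (zs : 'I_n -> bool) (rho beta : R)
         (p q om : 'I_L -> R),
    0 < eps -> (0 < n)%N -> (0 < L)%N ->
    L%:R <= C0 * n%:R `^ c ->
    0 <= rho < 1 / 2 -> 1 <= beta -> balanced_labels beta zs ->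
    (forall l, 0 < q l /\ q l < p l /\ p l < 1) ->
    balanced_weights om p q c0 c1 ->
    (beta = 1 \/
     wavg om p / (wavg om p - wavg om q)
       <= c' * (2 * (1 - 2 * rho) ^+ 2 / (beta - beta^-1)) + 2 * (rho - rho ^+ 2)) ->
    1 - 11 * n%:R `^ (- r) - c2 ^- n
      <= imlsbm_prob zs rho p q
           (fun w => forall zt : 'I_n -> bool,
              alg1_output (adj R w) om p gamma eps zt ->
              loss R zt zs <= error_bound n om p q rho C eps).
Proof.
move=> c1_1 c1_gamma.
have gamma1 : expR 1 < gamma by apply: le_lt_trans c1_gamma; rewrite ler_expR.
(* The base of the exponential term comes from the trimming event, of failure probability at most
   [2 ^- n]. *)
exists 2; split; first by rewrite ltr1n.
move=> c C0 c' c0 r _ _ c'01 c0_gt0 r1; exists (clustering_cst gamma r c0).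
move=> eps n L zs rho beta p q om eps0 n0 L0 _ rho_lt b1 [balT balF] qp [om0 [om1 [om_bal _]]] imb.
have /andP[rho0 rho1] := rho_lt.
have rho01 : 0 <= rho <= 1 by apply/andP; split; lra.
have edge01 := edge_prob01 zs qp.
(* For [n = 1] the claimed lower bound is negative; beyond that [ln n] is positive, as the label
   bounds require. *)
have [n1|n1] := leqP n 1.
  apply: le_trans (imlsbm_prob_ge0 rho01 edge01 _).
  have -> : n = 1%N by apply/eqP; rewrite eqn_leq n1.
  by rewrite powR1 expr1; lra.
have n0R : (0 : R) < n%:R by rewrite ltr0n.
have qb0 : 0 < wavg om q by apply: wavg_gt0 => // l; case: (qp l).
have qb_pb : wavg om q < wavg om p by apply: wavg_lt => // l; have [_ []] := qp l.
have b5 := imbalance_le c'01 rho_lt b1 qb0 qb_pb imb.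
(* [beta <= 5] turns the label balance into blocks of at least [n / 10] nodes. *)
have bal b : n%:R / 10 <= block_card R zs b.
  apply: (@le_trans _ _ (n%:R / (2 * beta))).
    by rewrite ler_pM2l// lef_pV2 ?posrE ?mulr_gt0//; lra.
  have -> : block_card R zs b = if b then #|[set i | zs i]|%:R else #|[set i | ~~ zs i]|%:R.
    by rewrite /block_card; case: b; congr (_%:R); apply: eq_card => i; rewrite !inE; case: (zs i).
  by case: b; [case/andP: balT|case/andP: balF].
exact: good_pr.
Qed.
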